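(* Let $g\in C^{1,1}$ be a Riemannian metric on $\mathbb R^d$ such that $(\mathbb R^d,g)$ is geodesically complete, with generalized smooth embedding $\tilde g=[g^\varepsilon_{ij}(-)]$, each $g^\varepsilon$ being a smooth Riemannian metric. Let $p,q\in\mathbb R^d$ and let $\gamma\in\mathcal{GC}^\infty_{>0}(p,q)$ be such that $L_{\tilde g}(\gamma)$ is minimal. Assume that $\mathrm{st}(L_{\tilde g}(\gamma))$ exists and that there exists $w\in C^1_{>0}(p,q)$ such that $L_g(w)=\mathrm{st}(L_{\tilde g}(\gamma))$. Then $w$ is $g$-minimizing and a $g$-geodesic.
   Context: Generalized numbers. Let $I_0=(0,1]\subseteq\mathbb R$; ''for $\varepsilon$ small'' means for all $\varepsilon\in(0,\varepsilon_0]$ for some $\varepsilon_0\in I_0$. Fix a net $\rho=(\rho_\varepsilon)_{\varepsilon\in I_0}$ of reals with $\rho_\varepsilon\to0^+$ as $\varepsilon\to0^+$. A net $(x_\varepsilon)$ in $\mathbb R^n$ is moderate if $|x_\varepsilon|=O(\rho_\varepsilon^{-N})$ for some $N\in\mathbb R_{>0}$; $(x_\varepsilon)\sim(y_\varepsilon)$ if $|x_\varepsilon-y_\varepsilon|=O(\rho_\varepsilon^{N})$ for every $N\in\mathbb R_{>0}$. $\widetilde{\mathbb R}$ is the ring of moderate real nets modulo $\sim$, with classes $[x_\varepsilon]$; $\widetilde{\mathbb R}^n$ is defined analogously. $\mathbb R\subseteq\widetilde{\mathbb R}$ via constant nets; $d\rho=[\rho_\varepsilon]$. $x\le y$ iff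 there are representatives with $x_\varepsilon\le y_\varepsilon$ for all $\varepsilon$; $x<y$ iff $y-x\ge0$ and $y-x$ is invertible; $|[x_\varepsilon]|=[|x_\varepsilon|]$. For generalized curves, $[0,1]=\{x\in\widetilde{\mathbb R}:0\le x\le1\}$. For $x=[x_\varepsilon]$, the standard part is $\mathrm{st}(x)=\lim_{\varepsilon\to0}x_\varepsilon$, if this limit exists in $\mathbb R^n$. For $x=[x_\varepsilon]>0$, $x^{1/2}=[\sqrt{x_\varepsilon}]$. Generalized smooth functions (GSF). For open $\Omega_\varepsilon\subseteq\mathbb R^n$, $\langle\Omega_\varepsilon\rangle$ is the set of $[x_\varepsilon]\in\widetilde{\mathbb R}^n$ such that for every representative $x_\varepsilon\in\Omega_\varepsilon$ for $\varepsilon$ small. For $X\subseteq\widetilde{\mathbb R}^n$, $Y\subseteq\widetilde{\mathbb R}^k$, $\mathcal{GC}^\infty(X,Y)$ is the set of maps $f:X\to Y$ for which there are $f_\varepsilon\in C^\infty(\Omega_\varepsilon,\mathbb R^k)$ with $X\subseteq\langle\Omega_\varepsilon\rangle$, $f([x_\varepsilon])=[f_\varepsilon(x_\varepsilon)]$ and $(\partial^\alpha f_\varepsilon(x_\varepsilon))$ moderate for all $[x_\varepsilon]\in X$ and all multi-indices $\alpha$. Derivatives and integrals are computed $\varepsilon$-wise. Embedding and regularized metric. Fix $b=[b_\varepsilon]\in\widetilde{\mathbb R}$ with $b\ge d\rho^{-N}$ for some $N\in\mathbb R_{>0}$ and $\psi_\varepsilon\in C_c^\infty(\mathbb R^d)$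 with support in the unit ball, $\int\psi_\varepsilon=1$, $\sup|\partial^\alpha\psi_\varepsilon|=O(b_\varepsilon^{k})$ for some $k=k(\alpha)\in\mathbb N$, for each $j\in\mathbb N$ all moments of order $1,\ldots,j$ of $\psi_\varepsilon$ vanishing for $\varepsilon$ small, and for each $\eta\in\mathbb R_{>0}$, $\int|\psi_\varepsilon|\le1+\eta$ for $\varepsilon$ small; put $\psi^b_\varepsilon(x)=b_\varepsilon^d\psi_\varepsilon(b_\varepsilon x)$. The embedding $\iota$ of distributions into GSF is the unique sheaf morphism extending $T\mapsto[(T*\psi^b_\varepsilon)(-)]$ from compactly supported distributions. The net $(g^\varepsilon_{ij})$ is chosen so that $\tilde g_{ij}=\iota(g_{ij})=[g^\varepsilon_{ij}(-)]$, regarded as GSF on $\widetilde{\mathbb R}^d$, and each $g^\varepsilon$ is a smooth Riemannian metric on $\mathbb R^d$; $g^\varepsilon\to g$ and the Christoffel symbols of $g^\varepsilon$ converge to those of $g$, locally uniformly. Lengths. $\mathcal{GC}^\infty_{>0}(p,q)=\{\lambda\in\mathcal{GC}^\infty([0,1],\widetilde{\mathbb R}^d):\lambda(0)=p,\ \lambda(1)=q,\ |\dot\lambda(t)|>0\ \forall t\in[0,1]\}$. For such $\lambda$, $L_{\tilde g}(\lambda)=\int_0^1(\tilde g_{ij}(\lambda(t))\dot\lambda^i(t)\dot\lambda^j(t))^{1/2}dt\in\widetilde{\mathbb R}$ (summation over repeated indices). ''$L_{\tilde g}(\gamma)$ is minimal'' means $L_{\tilde g}(\gamma)\le L_{\tilde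 g}(\lambda)$ for all $\lambda\in\mathcal{GC}^\infty_{>0}(p,q)$. $C^1_{>0}(p,q)=\{w\in C^1([0,1]_{\mathbb R},\mathbb R^d):w(0)=p,\ w(1)=q,\ |\dot w(t)|>0\ \forall t\in[0,1]_{\mathbb R}\}$, where $[0,1]_{\mathbb R}$ is the real unit interval, and $L_g(w)=\int_0^1(g_{ij}(w)\dot w^i\dot w^j)^{1/2}dt$. $w$ is $g$-minimizing if $L_g(w)\le L_g(\sigma)$ for all Lipschitz curves $\sigma$ in $\mathbb R^d$ connecting $p$ and $q$. *)

(* Defs.v *)
From HB Require Import structures.
From mathcomp Require Import all_boot all_order all_algebra generic_quotient.
From mathcomp Require Import all_classical all_reals all_analysis.
Set Implicit Arguments.
Unset Strict Implicit.
Unset Printing Implicit Defensive.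
Import Order.TTheory GRing.Theory Num.Theory.
Import numFieldNormedType.Exports.
Local Open Scope classical_set_scope.
Local Open Scope ring_scope.
Local Open Scope quotient_scope.

Section Calculus.
Context {R : realType}.

Definition enorm (d : nat) (v : 'rV[R]_d) : R :=
  Num.sqrt (\sum_i v 0 i ^+ 2).

Definition basisR (_ : unit) : R := 1.
Definition basis_rV (d : nat) (i : 'I_d) : 'rV[R]_d := delta_mx 0 i.

(* The partial derivative of f for the multi-index listed, with repetitions,
   by s; e is the canonical basis of V. *)
Definition partial (V W : normedModType R) (I : Type) (e : I -> V)
    (s : seq I) (f : V -> W) : V -> W :=
  foldr (fun i h => 'D_(e i) h) f s.

(* Differentiability of every iterated partial derivative forces their
   continuity and makes their order irrelevant: this is C^oo on the open
   set Om. *)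
Definition smooth_on (V W : normedModType R) (I : Type) (e : I -> V)
    (Om : set V) (f : V -> W) : Prop :=
  forall s x, Om x -> differentiable (partial e s f) x.

Section Within.
Context {W : normedModType R}.
Implicit Types (A : set R) (c : R -> W).

(* Derivatives of maps of one variable relative to A, hence one-sided at the
   end points when A is a closed interval. *)
Definition diffq c (t s : R) : W := (s - t)^-1 *: (c s - c t).

Definition derivable_within A c t : Prop := cvg (diffq c t @ within A t^').

Definition velocity A c t : W := lim (diffq c t @ within A t^').

Definition C1_on A c : Prop :=
  (forall t, A t -> derivable_within A c t) /\
  {within A, continuous (velocity A c)}.

End Within.

(* Lebesgue integral over R^d, as an iterated integral; it is only applied to
   continuous functions of compact support. *)
Fixpoint integral_rV (d : nat) : ('rV[R]_d -> R) -> R :=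
  match d with
  | 0 => fun f => f 0
  | d'.+1 => fun f => Rintegral lebesgue_measure setT (fun x : R =>
      integral_rV (fun v : 'rV[R]_d' => f (row_mx (x%:M : 'rV_1) v)))
  end.

End Calculus.
Arguments basis_rV {R} d.

Section GeneralizedPoints.
Context {R : realType} (rho : R -> R).

(* Nets are indexed by (0, 1]; they are total functions on R whose values
   outside (0, 1] are irrelevant. *)
Definition I0 : set R := [set e | 0 < e <= 1].

Section Points.
Context {V : normedModType R}.
Implicit Types x y : R -> V.

(* For V = R^n the norm is the library's maximum norm, which is equivalent to
   the Euclidean one. *)
Definition moderate x : Prop :=
  exists2 N : R, 0 < N &
    exists C : R, \forall e \near 0^'+, `|x e| <= C * rho e `^ (- N).

Definition negligible_diff x y : Prop :=
  forall N : R, 0 < N ->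
    exists C : R, \forall e \near 0^'+, `|x e - y e| <= C * rho e `^ N.

Lemma negligible_diff_refl x : negligible_diff x x.
Proof. by move=> N _; exists 0; near=> e; rewrite subrr normr0 mul0r.
Unshelve. all: by end_near. Qed.

Lemma negligible_diff_sym x y : negligible_diff x y -> negligible_diff y x.
Proof.
by move=> xy N /xy[C xyC]; exists C; apply: filterS xyC => e; rewrite distrC.
Qed.

Lemma negligible_diff_trans y x z :
  negligible_diff x y -> negligible_diff y z -> negligible_diff x z.
Proof.
move=> xy yz N N0; have [C xyC] := xy N N0; have [D yzD] := yz N N0.
exists (C + D); apply: filterS2 xyC yzD => e xyC yzD.
by rewrite mulrDl (le_trans (ler_distD (y e) _ _))// lerD.
Qed.

Lemma moderate0 : moderate (fun=> 0).
Proof.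
by exists 1 => //; exists 0; near=> e; rewrite normr0 mul0r.
Unshelve. all: by end_near. Qed.

Record modnet := ModNet { net_of :> R -> V ; _ : moderate net_of }.

HB.instance Definition _ := gen_eqMixin modnet.
HB.instance Definition _ := gen_choiceMixin modnet.

Definition modnet_eqv (x y : modnet) : bool := `[< negligible_diff x y >].

Lemma modnet_eqv_refl : reflexive modnet_eqv.
Proof. by move=> x; apply/asboolP; exact: negligible_diff_refl. Qed.

Lemma modnet_eqv_sym : symmetric modnet_eqv.
Proof.
by move=> x y; apply/asboolP/asboolP; exact: negligible_diff_sym.
Qed.

Lemma modnet_eqv_trans : transitive modnet_eqv.
Proof.
move=> y x z /asboolP xy /asboolP yz; apply/asboolP.
exact: negligible_diff_trans xy yz.
Qed.

Canonical modnet_equiv := EquivRel modnet_eqv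
  modnet_eqv_refl modnet_eqv_sym modnet_eqv_trans.

Definition gen_quot := {eq_quot modnet_equiv}.

Definition modnet_of x : modnet :=
  if pselect (moderate x) is left mx then ModNet mx else ModNet moderate0.

End Points.

(* gen V is the space of generalized points of V: gen R is the ring of
   generalized numbers, gen 'rV[R]_n is its n-dimensional analogue. *)
Definition gen (V : normedModType R) : Type := @gen_quot V.

(* [x_e]; the value is only meaningful for moderate nets. *)
Definition gclass (V : normedModType R) (x : R -> V) : gen V :=
  \pi_(@gen_quot V) (modnet_of x).

Definition represents (V : normedModType R) (x : R -> V) (X : gen V) : Prop :=
  moderate x /\ gclass x = X.

Definition rep (V : normedModType R) (X : gen V) : R -> V :=
  net_of (repr (X : @gen_quot V)).

Definition gconst (V : normedModType R) (v : V) : gen V := gclass (fun=> v).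

Lemma gclass_eqP (V : normedModType R) (x y : R -> V) :
  moderate x -> moderate y -> gclass x = gclass y <-> negligible_diff x y.
Proof.
have E (z : R -> V) : moderate z -> net_of (modnet_of z) = z.
  by rewrite /modnet_of; case: pselect.
move=> mx my; rewrite -[in X in _ <-> X](E _ mx) -[in X in _ <-> X](E _ my).
by split=> [/eqmodP/asboolP //|xy]; apply/eqmodP/asboolP.
Qed.

Lemma rep_represents (V : normedModType R) (X : gen V) :
  represents (rep X) X.
Proof.
have mX : moderate (rep X) by rewrite /rep; case: (repr _).
split=> //; rewrite /gclass -[RHS](reprK (X : @gen_quot V)).
congr (\pi_(@gen_quot V) _); rewrite /modnet_of; case: pselect => // mX'.
rewrite /rep in mX' *; case: (repr _) mX' => x mx mx' /=.
by congr ModNet; exact: Prop_irrelevance.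
Qed.

(* Operations and relations are computed on representatives and do not depend
   on their choice. *)
Definition gsub (x y : gen R) : gen R := gclass (fun e => rep x e - rep y e).
Definition gmul (x y : gen R) : gen R := gclass (fun e => rep x e * rep y e).

Definition ginvertible (x : gen R) : Prop := exists y, gmul x y = gconst (1 : R).

Definition gle (x y : gen R) : Prop :=
  exists x' y' : R -> R,
    [/\ represents x' x, represents y' y &
        forall e, I0 e -> x' e <= y' e].

Definition glt (x y : gen R) : Prop :=
  gle (gconst (0 : R)) (gsub y x) /\ ginvertible (gsub y x).

Definition gabs (d : nat) (x : gen 'rV[R]_d) : gen R :=
  gclass (fun e => enorm (rep x e)).

Definition is_st (x : gen R) (s : R) : Prop :=
  exists2 x', represents x' x & x' e @[e --> 0^'+] --> s.

Definition gunit_itv : set (gen R) :=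
  [set x | gle (gconst (0 : R)) x /\ gle x (gconst (1 : R))].

(* <Om_e> *)
Definition internal_set (V : normedModType R) (Om : R -> set V) :
    set (gen V) :=
  [set x | forall x', represents x' x -> \forall e \near 0^'+, Om e (x' e)].

Definition compactly_supported (V : normedModType R) (U : set V) :
    set (gen V) :=
  [set x | internal_set (fun=> U) x /\
     exists K, [/\ compact K, K `<=` U &
       exists2 x', represents x' x & \forall e \near 0^'+, K (x' e)]].

Section GSF.
Context {V W : normedModType R} {I : Type}.
Implicit Types (B : I -> V) (X : set (gen V)) (f : gen V -> gen W)
  (Om : R -> set V) (fe : R -> V -> W).

(* The net fe of smooth maps on the open sets Om defines the generalized
   smooth function f on X. *)
Definition defines B X f Om fe : Prop :=
  [/\ forall e, I0 e -> open (Om e) /\ smooth_on B (Om e) (fe e),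
      X `<=` internal_set Om &
      forall x, moderate x -> X (gclass x) ->
        represents (fun e => fe e (x e)) (f (gclass x)) /\
        forall s, moderate (fun e => partial B s (fe e) (x e))].

Definition GSF B X (Y : set (gen W)) f : Prop :=
  (forall x, X x -> Y (f x)) /\ exists Om fe, defines B X f Om fe.

End GSF.

Section GeneralizedCurves.
Context {d : nat}.
Implicit Types (lam : gen R -> gen 'rV[R]_d).

(* dlam is the derivative of the generalized curve lam on [0, 1]; it does not
   depend on the net defining lam. *)
Definition is_gderive lam (dlam : gen R -> gen 'rV[R]_d) : Prop :=
  exists Om le, defines basisR gunit_itv lam Om le /\
    forall t, moderate t -> gunit_itv (gclass t) ->
      represents (fun e => 'D_1 (le e) (t e)) (dlam (gclass t)).

(* GC^oo_{>0}(p, q) *)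
Definition gcurves (p q : 'rV[R]_d) : set (gen R -> gen 'rV[R]_d) :=
  [set lam | [/\ GSF basisR gunit_itv setT lam,
     lam (gconst (0 : R)) = gconst p, lam (gconst (1 : R)) = gconst q &
     exists2 dlam, is_gderive lam dlam &
       forall t, gunit_itv t -> glt (gconst (0 : R)) (gabs (dlam t))]].

End GeneralizedCurves.

End GeneralizedPoints.
Arguments gconst {R} rho {V}.
Arguments gclass {R} rho {V}.

Section Metrics.
Context {R : realType} {d : nat}.
Implicit Types (g : 'rV[R]_d -> 'M[R]_d) (c w : R -> 'rV[R]_d).

Definition quadratic (A : 'M[R]_d) (v : 'rV[R]_d) : R :=
  \sum_i \sum_j A i j * v 0 i * v 0 j.

Definition riemannian g : Prop :=
  forall x, (g x)^T = g x /\ forall v, v != 0 -> 0 < quadratic (g x) v.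

Definition C11 (f : 'rV[R]_d -> R) : Prop :=
  (forall x, differentiable f x) /\
  forall (i : 'I_d) x, exists2 r : R, 0 < r &
    [lipschitz partial (basis_rV d) [:: i] f y | y in ball x r].

Definition christoffel g (k i j : 'I_d) (x : 'rV[R]_d) : R :=
  let D a i j := partial (basis_rV d) [:: a] (fun y => g y i j) x in
  2^-1 * \sum_l invmx (g x) k l * (D i j l + D j i l - D l i j).

(* c solves the geodesic equation on the nondegenerate interval A. *)
Definition geodesic_on g (A : set R) c : Prop :=
  forall t, A t ->
    let v := velocity A c in
    [/\ derivable_within A c t, derivable_within A v t &
        forall k, velocity A v t 0 k +
          \sum_i \sum_j christoffel g k i j (c t) * v t 0 i * v t 0 j = 0].

Definition geodesically_complete g : Prop :=
  forall (I : set R) c, open I -> is_interval I -> I !=set0 ->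
    geodesic_on g I c ->
    exists2 C, geodesic_on g setT C & forall t, I t -> C t = c t.

(* The integrand uses the derivative of c where it exists; this is almost
   everywhere on [0, 1] when c is Lipschitz. *)
Definition riem_length g c : R :=
  Rintegral lebesgue_measure `[0, 1]
    (fun t => Num.sqrt (quadratic (g (c t)) (velocity `[0, 1] c t))).

(* C^1_{>0}(p, q) *)
Definition C1curves (p q : 'rV[R]_d) : set (R -> 'rV[R]_d) :=
  [set w | [/\ C1_on `[0, 1] w, w 0 = p, w 1 = q &
     forall t, 0 <= t <= 1 -> 0 < enorm (velocity `[0, 1] w t)]].

Definition minimizing g (p q : 'rV[R]_d) w : Prop :=
  forall c, [lipschitz c t | t in `[0, 1]] -> c 0 = p -> c 1 = q ->
    riem_length g w <= riem_length g c.

(* The riem_length functional does not see the parametrization, so being a geodesic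
   is a property of w up to an orientation-preserving C^1 change of parameter
   with positive derivative. *)
Definition geodesic g w : Prop :=
  exists (phi : R -> R) c,
    [/\ C1_on `[0, 1] phi, phi 0 = 0, phi 1 = 1,
        forall t, 0 <= t <= 1 -> 0 < velocity `[0, 1] phi t &
        geodesic_on g `[0, 1] c /\
        forall t, 0 <= t <= 1 -> w t = c (phi t)].

End Metrics.

Section Embedding.
Context {R : realType} {d : nat}.
Implicit Types (rho b : R -> R) (psi : R -> 'rV[R]_d -> R)
  (f phi : 'rV[R]_d -> R) (T : ('rV[R]_d -> R) -> R) (U : set 'rV[R]_d).

Definition multi (s : seq 'I_d) f := partial (basis_rV d) s f.

Definition supported_in (K : set 'rV[R]_d) f : Prop :=
  forall x, ~ K x -> f x = 0.

Definition test_fun U phi : Prop :=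
  smooth_on (basis_rV d) setT phi /\
  exists K, [/\ compact K, K `<=` U & supported_in K phi].

(* A distribution on U is a functional of which only the values on test
   functions of U matter. *)
Definition distribution U T : Prop :=
  (forall a phi chi, test_fun U phi -> test_fun U chi ->
     T (fun x => a * phi x + chi x) = a * T phi + T chi) /\
  (forall K, compact K -> K `<=` U ->
     exists (C : R) (m : nat), forall phi (M : R),
       test_fun U phi -> supported_in K phi ->
       (forall s x, (size s <= m)%N -> `|multi s phi x| <= M) ->
       `|T phi| <= C * M).

Definition restricts U T T' : Prop :=
  forall phi, test_fun U phi -> T' phi = T phi.

Definition compact_support T : Prop :=
  exists2 K, compact K & forall phi, test_fun (~` K) phi -> T phi = 0.

Definition regular f : ('rV[R]_d -> R) -> R :=
  fun phi => integral_rV (fun x => f x * phi x).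

Definition monomial (a : {ffun 'I_d -> nat}) (x : 'rV[R]_d) : R :=
  \prod_i x 0 i ^+ a i.

Definition mollifier rho b psi : Prop :=
  [/\ moderate rho b /\
      (exists2 N : R, 0 < N &
         gle (gclass rho (fun e => rho e `^ (- N))) (gclass rho b)),
      forall e, I0 e ->
        [/\ smooth_on (basis_rV d) setT (psi e),
            supported_in [set x | enorm x <= 1] (psi e) &
            integral_rV (psi e) = 1],
      forall s : seq 'I_d, exists (k : nat) (C : R),
        \forall e \near 0^'+, forall x, `|multi s (psi e) x| <= C * b e ^+ k,
      forall j : nat, \forall e \near 0^'+, forall a : {ffun 'I_d -> nat},
        (0 < \sum_i a i <= j)%N ->
        integral_rV (fun x => monomial a x * psi e x) = 0 &
      forall eta : R, 0 < eta ->
        \forall e \near 0^'+, integral_rV (fun x => `|psi e x|) <= 1 + eta].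

Definition rescale b psi (e : R) (x : 'rV[R]_d) : R :=
  b e ^+ d * psi e (b e *: x).

Definition convolution T f (x : 'rV[R]_d) : R := T (fun y => f (x - y)).

(* iota U maps the distributions on U to generalized smooth functions on the
   compactly supported points of U, is compatible with restrictions, and is
   given by convolution on compactly supported distributions. *)
Definition embedding rho b psi
    (iota : set 'rV[R]_d -> (('rV[R]_d -> R) -> R) ->
            gen rho 'rV[R]_d -> gen rho R) : Prop :=
  [/\ forall U T, open U -> distribution U T ->
        GSF (basis_rV d) (compactly_supported (rho := rho) U) setT (iota U T),
      forall U U' T T', open U -> open U' -> U' `<=` U ->
        distribution U T -> distribution U' T' -> restricts U' T T' ->
        forall x, compactly_supported U' x -> iota U' T' x = iota U T x &
      forall T, distribution setT T -> compact_support T ->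
        forall x, moderate rho x -> compactly_supported setT (gclass rho x) ->
          represents (fun e => convolution T (rescale b psi e) (x e))
            (iota setT T (gclass rho x))].

(* gt_ij is iota g_ij, extended to all generalized points by the net ge_ij. *)
Definition regularization rho
    (iota : set 'rV[R]_d -> (('rV[R]_d -> R) -> R) ->
            gen rho 'rV[R]_d -> gen rho R)
    (g : 'rV[R]_d -> 'M[R]_d)
    (gt : 'I_d -> 'I_d -> gen rho 'rV[R]_d -> gen rho R)
    (ge : R -> 'rV[R]_d -> 'M[R]_d) : Prop :=
  [/\ forall i j, defines (basis_rV d) setT (gt i j) (fun=> setT)
        (fun e x => ge e x i j),
      forall i j x, compactly_supported setT x ->
        gt i j x = iota setT (regular (fun y => g y i j)) x,
      forall e, I0 e -> riemannian (ge e),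
      {family compact, ge e @[e --> 0^'+] --> g} &
      forall k i j, {family compact,
        christoffel (ge e) k i j @[e --> 0^'+] --> christoffel g k i j}].

(* Integrals are computed along nets; the value does not depend on the net
   defining lam. For small e the derivative of le e within [0, 1] is its
   derivative, since le e is smooth near [0, 1]. *)
Definition glength rho (ge : R -> 'rV[R]_d -> 'M[R]_d)
    (lam : gen rho R -> gen rho 'rV[R]_d) (L : gen rho R) : Prop :=
  exists Om le, defines basisR (gunit_itv (rho := rho)) lam Om le /\
    represents (fun e => riem_length (ge e) (le e)) L.

Definition gminimal rho (ge : R -> 'rV[R]_d -> 'M[R]_d) (p q : 'rV[R]_d)
    (L : gen rho R) : Prop :=
  forall lam, gcurves p q lam -> forall L', glength ge lam L' -> gle L L'.

End Embedding.

(* Main.v *)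
(** Minimality.  A Lipschitz curve from p to q is approximated by its Bernstein
    polynomials: they are uniformly Lipschitz, have the same end points, and their derivatives
    converge wherever the curve is differentiable, hence almost everywhere.  A small polynomial
    perturbation makes the approximating curves regular, so that they are generalized curves
    with constant nets and compete with gamma; minimality of L and locally uniform convergence of
    the metrics give st L <= L_g(P) for every regular polynomial curve P, and dominated convergence
    gives it for every Lipschitz curve.  For d = 1 no perturbation helps, but there L_g(w) is the
    distance of p and q for a primitive of sqrt g.

    The geodesic equation.  Parametrized with constant speed s, w minimizes among Lipschitz curves.
    Since sqrt a <= (a / s + s) / 2 with equality at a = s^2, it is also critical for the energy,
    which only needs g of class C^1; the lemma of du Bois-Reymond turns the vanishing first
    variation into the differentiability of g(c) c' and the Euler-Lagrange equation, and inverting g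
    gives the geodesic equation. *)

(* The hypothesis compares [gamma] only with generalized curves of nowhere vanishing velocity,
   whereas the conclusion speaks of all Lipschitz curves. Polynomials bridge the gap because a
   constant polynomial net is bounded, with all its derivatives, on a neighbourhood of [0, 1], so
   moderateness comes for free. Regularity can be restored in dimension at least 2 because two
   velocity components vanish together only by accident; on a line, a curve that turns back has to
   stop, whatever the perturbation. The second obstacle is that curves of class C^1 leave no second
   derivative for an integration by parts in the first variation; the momentum g(c) c' gains its
   derivative only a posteriori. Constant speed gives equality in the comparison of length and
   energy at the curve itself, so a minimizer of length also minimizes the energy, which contains no
   square root and can be differentiated under the integral. *)
From HB Require Import structures.
Require Import Defs.
From mathcomp Require Import all_boot all_order all_algebra.
From mathcomp Require Import all_classical all_reals all_analysis.
From mathcomp Require Import measurable_realfun.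
From mathcomp Require Import ring lra.
Import Order.TTheory GRing.Theory Num.Theory.
Import numFieldNormedType.Exports.
Local Open Scope classical_set_scope.
Local Open Scope ring_scope.

Set Implicit Arguments.
Unset Strict Implicit.

(** * Derivatives of real functions *)

Section derive_wrappers.
Context {R : realType}.
Implicit Types (f g : R -> R) (x a b : R).

(** The differentiation rules are restated for explicit functions [fun t => ...], so that they
    compose by unification. *)
Lemma isd_cst a x : is_derive x 1 (fun=> a : R) 0.
Proof. exact: is_derive_cst. Qed.

Lemma isd_id x : is_derive x 1 (fun t : R => t) 1.
Proof. exact: is_derive_id. Qed.

Lemma isdD f g x a b : is_derive x 1 f a -> is_derive x 1 g b ->
  is_derive x 1 (fun t => f t + g t) (a + b).
Proof. by move=> fa gb; exact: is_deriveD. Qed.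

Lemma isdB f g x a b : is_derive x 1 f a -> is_derive x 1 g b ->
  is_derive x 1 (fun t => f t - g t) (a - b).
Proof. by move=> fa gb; exact: is_deriveB. Qed.

Lemma isdM f g x a b : is_derive x 1 f a -> is_derive x 1 g b ->
  is_derive x 1 (fun t => f t * g t) (f x * b + g x * a).
Proof. by move=> fa gb; exact: is_deriveM. Qed.

Lemma isdZ k f x a : is_derive x 1 f a -> is_derive x 1 (fun t => k * f t) (k * a).
Proof. by move=> fa; exact: is_deriveZ. Qed.

Lemma isd_sum (I : Type) (r : seq I) (f : I -> R -> R) (df : I -> R) x :
  (forall i, is_derive x 1 (f i) (df i)) ->
  is_derive x 1 (fun t => \sum_(i <- r) f i t) (\sum_(i <- r) df i).
Proof.
move=> fd; elim: r => [|i r IH].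
  rewrite big_nil (_ : (fun=> _) = fun=> 0); first exact: isd_cst.
  by apply/funext => t; rewrite big_nil.
rewrite big_cons (_ : (fun=> _) = fun t => f i t + \sum_(i <- r) f i t).
  exact: isdD.
by apply/funext => t; rewrite big_cons.
Qed.

Lemma isd_comp f g x a b : is_derive x 1 g b -> is_derive (g x) 1 f a ->
  is_derive x 1 (fun t => f (g t)) (a * b).
Proof.
move=> [dg <-] [df <-]; split.
  apply/derivable1_diffP/differentiable_comp; exact/derivable1_diffP.
by rewrite -!derive1E derive1_comp.
Qed.

Lemma isd_near f g x a : {near x, f =1 g} -> is_derive x 1 f a ->
  is_derive x 1 g a.
Proof. by move=> fg; exact: near_eq_is_derive. Qed.

Lemma isd_cont f x a : is_derive x 1 f a -> {for x, continuous f}.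
Proof.
by move=> [df _]; apply: differentiable_continuous; exact/derivable1_diffP.
Qed.

End derive_wrappers.

(** * Almost everywhere differentiability of Lipschitz functions *)

Lemma lebesgue_stieltjes_measure_oc (R : realType) (f : cumulative R R)
    (a b : R) : a <= b ->
  lebesgue_stieltjes_measure f `]a, b]%classic = (f b - f a)%:E.
Proof.
move=> ab; rewrite /lebesgue_stieltjes_measure /measure_extension/=.
by rewrite measurable_mu_extE/= ?wlength_itv_bnd//; exact: is_ocitv.
Qed.

Section ae_derivable.
Context {R : realType}.
Local Notation mu := (@lebesgue_measure R).

(* Writing x = u + v with u = (x + f)/2 and v = (x - f)/2 both nondecreasing,
   the Stieltjes measures of u and v add up to the Lebesgue measure, so that of
   u has a density and u is a.e. derivable. *)
Lemma ae_derivable_1lipschitz (f : R -> R) :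
  (forall x y, `|f x - f y| <= `|x - y|) ->
  {ae mu, forall x, 0 < x < 1 -> derivable f x 1}.
Proof.
move=> f1.
pose u x := 2^-1 * (x + f x); pose v x := 2^-1 * (x - f x).
have f1' x y : x <= y -> - (y - x) <= f y - f x <= y - x.
  by move=> xy; rewrite -ler_norml (le_trans (f1 _ _))// ger0_norm ?subr_ge0.
have nu : nondecreasing u.
  by move=> x y xy; have := f1' _ _ xy; rewrite /u; lra.
have nv : nondecreasing v.
  by move=> x y xy; have := f1' _ _ xy; rewrite /v; lra.
have cf : continuous f.
  move=> x; apply/cvgrPdist_le => e e0; near=> y.
  rewrite (le_trans (f1 _ _))//; near: y; apply: cvgr_dist_le => //; exact: cvg_id.
have cu : continuous u.
  by move=> x; apply: cvgM; [exact: cvg_cst|apply: cvgD => //; exact: cf].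
have cv : continuous v.
  by move=> x; apply: cvgM; [exact: cvg_cst|apply: cvgB => //; exact: cf].
pose U : cumulative R R := HB.pack u (isCumulative.Build R _ R u nu (right_continuousW cu)).
pose V : cumulative R R := HB.pack v (isCumulative.Build R _ R v nv (right_continuousW cv)).
pose lu := lebesgue_stieltjes_measure U; pose lv := lebesgue_stieltjes_measure V.
(* Since u x + v x = x, both sides agree on half-open intervals, and these determine the measure. *)
have luv A : measurable A -> mu A = (lu A + lv A)%E.
  move=> mA; rewrite -measure_addE.
  have := @lebesgue_stieltjes_measure_unique R idfun (measure_add lu lv).
  apply => // X /ocitvP[->|[[a b]/=]]; first by rewrite !measure0.
  move=> ab ->; rewrite /= /msum !big_ord_recl big_ord0 adde0/= !lebesgue_stieltjes_measure_oc ?ltW//=.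
  by rewrite -EFinD; congr EFin; rewrite /u /v; lra.
(* Restricting to a bounded interval makes the measure of [u] finite, hence its density
   integrable. *)
pose D : set R := `]0, 1]%classic.
have mD : measurable (D : set (measurableTypeR R)) by exact: measurable_itv.
have lD : (lu D < +oo)%E.
  by rewrite /lu /D lebesgue_stieltjes_measure_oc ?ltry.
pose n : {finite_measure set (measurableTypeR R) -> \bar R} := mfrestr mD lD.
have nE A : n A = lu (A `&` D) by [].
have nmu : n `<< mu.
  apply/null_content_dominatesP => A mA A0.
  have := luv _ mA; rewrite [mu A]A0 => /esym lA0.
  have : (lu A <= 0)%E by rewrite -lA0 leeDl.
  rewrite nE => lA; apply/eqP; rewrite eq_le measure_ge0 andbT.
  by apply: le_trans lA; apply: le_measure; rewrite ?inE//; exact: measurableI.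
have [h [h0 hfin hint hE]] := radon_nikodym_sigma_finite nmu.
pose hr x := fine (h x).
have hrE : EFin \o hr = h by apply/funext => x; rewrite /= fineK.
have loc : locally_integrable setT hr.
  by apply: open_integrable_locally; [exact: openT|rewrite hrE].
have int0 y : mu.-integrable [set` Interval (BRight 0) (BRight y)] (EFin \o hr).
  by rewrite hrE; apply: integrableS hint.
(* Lebesgue's differentiation theorem for the primitive of the density, which equals [u] up to a
   constant on ]0, 1[. *)
have /= := @FTC1 R hr (BRight 0) int0 loc.
pose F (x : R) : R := Rintegral mu `]0, x]%classic hr.
have FE x : 0 < x -> x < 1 -> F x = u x - u 0.
  move=> x0 x1; rewrite /F /Rintegral.
  rewrite (eq_integral h) => [|t _]; last by rewrite /= fineK.
  rewrite -hE// nE setIidl.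
    by rewrite /lu lebesgue_stieltjes_measure_oc ?ltW.
  by apply: subset_itvl; rewrite bnd_simp ltW.
apply: filterS; first exact: (ae_filter_ringOfSetsType mu).
move=> x Fx /andP[x0 x1].
have [/derivableP dF _] := Fx x0.
(* Solving u t = (t + f t) / 2 and F t = u t - u 0 for f gives f t = 2 F t + 2 u 0 - t. *)
have dfE := isdD (isdZ 2 dF) (isdB (isd_cst (2 * u 0) x) (isd_id x)).
apply: (@ex_derive _ _ _ _ _ _ _ (isd_near _ dfE)).
near=> t; change (2 * F t + (2 * u 0 - t) = f t); rewrite FE.
- by rewrite /u; lra.
- by near: t; exact: lt_nbhsr.
- by near: t; exact: lt_nbhsl.
Unshelve. all: by end_near. Qed.
End ae_derivable.

(** * Bernstein polynomials *)

Section bernstein.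
Context {R : realType}.
Implicit Types (h g : nat -> R) (x a : R) (n : nat).

Let hE := (hornerD, hornerN, hornerM, hornerC, hornerX).

(* De Casteljau's recursion for \sum_k h k * 'C(n, k) * 'X^k * (1 - 'X)^(n - k). *)
Fixpoint bernstein n h : {poly R} :=
  if n is m.+1
  then 'X * bernstein m (fun k => h k.+1) + (1%:P - 'X) * bernstein m h
  else (h 0%N)%:P.

Lemma bernsteinS n h x : (bernstein n.+1 h).[x] =
  x * (bernstein n (fun k => h k.+1)).[x] + (1 - x) * (bernstein n h).[x].
Proof. by rewrite /= !hE. Qed.

Lemma bernstein0 n h x : n = 0%N -> (bernstein n h).[x] = h 0%N.
Proof. by move=> -> /=; rewrite hE. Qed.

Lemma bernstein_linear n h g x a :
  (bernstein n (fun k => a * h k + g k)).[x] =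
  a * (bernstein n h).[x] + (bernstein n g).[x].
Proof.
elim: n h g => [|n IH] h g; first by rewrite !bernstein0.
by rewrite !bernsteinS !IH; ring.
Qed.

Lemma bernstein_cst n x a : (bernstein n (fun=> a)).[x] = a.
Proof.
elim: n => [|n IH]; first by rewrite bernstein0.
by rewrite bernsteinS IH; ring.
Qed.

Lemma bernsteinZ n h x a :
  (bernstein n (fun k => a * h k)).[x] = a * (bernstein n h).[x].
Proof.
elim: n h => [|n IH] h; first by rewrite !bernstein0.
by rewrite !bernsteinS !IH; ring.
Qed.

Lemma bernstein_subC n h x a :
  (bernstein n (fun k => h k - a)).[x] = (bernstein n h).[x] - a.
Proof.
rewrite -[in RHS](mul1r _.[x]) -[X in _ + X](bernstein_cst n x) -bernstein_linear.
by congr (horner (bernstein _ _) _); apply/funext => k; rewrite mul1r.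
Qed.

Lemma bernstein_le n h g x : 0 <= x <= 1 ->
  (forall k, (k <= n)%N -> h k <= g k) ->
  (bernstein n h).[x] <= (bernstein n g).[x].
Proof.
move=> /andP[x0 x1]; elim: n h g => [|n IH] h g hg.
  by rewrite !bernstein0// hg.
rewrite !bernsteinS lerD// ler_wpM2l ?subr_ge0// IH// => k kn; apply: hg => //.
exact: leqW.
Qed.

Lemma bernstein_norm_le n h g x : 0 <= x <= 1 ->
  (forall k, (k <= n)%N -> `|h k| <= g k) ->
  `|(bernstein n h).[x]| <= (bernstein n g).[x].
Proof.
move=> x01 hg; rewrite ler_norml -mulN1r -bernsteinZ; apply/andP; split.
  by apply: bernstein_le => // k /hg; rewrite ler_norml mulN1r => /andP[].
by apply: bernstein_le => // k /hg; rewrite ler_norml => /andP[].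
Qed.

Lemma bernstein_at0 n h : (bernstein n h).[0] = h 0%N.
Proof.
elim: n h => [|n IH] h; first by rewrite bernstein0.
by rewrite bernsteinS !IH; ring.
Qed.

Lemma bernstein_at1 n h : (bernstein n h).[1] = h n.
Proof.
elim: n h => [|n IH] h; first by rewrite bernstein0.
by rewrite bernsteinS !IH; ring.
Qed.

Let decasteljau_deriv (p q : {poly R}) x :
  ('X * p + (1%:P - 'X) * q)^`().[x] =
  p.[x] - q.[x] + x * p^`().[x] + (1 - x) * q^`().[x].
Proof. by rewrite derivD !derivM derivB derivX derivC !hE; ring. Qed.

(** Differentiating De Casteljau's recursion gives the recursion for the derivatives plus the
    difference of its two halves, and this difference is the one extra summand that the induction
    needs. A Lipschitz bound on the node values thus bounds the derivative. *)
Lemma bernstein_deriv n h x : (bernstein n.+1 h)^`().[x] =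
  n.+1%:R * (bernstein n (fun k => h k.+1 - h k)).[x].
Proof.
elim: n h => [|n IH] h.
  rewrite /= derivD !derivM derivB derivX !derivC !hE; ring.
have -> : bernstein n.+2 h = 'X * bernstein n.+1 (fun k => h k.+1)
   + (1%:P - 'X) * bernstein n.+1 h by [].
rewrite decasteljau_deriv !IH.
rewrite (bernsteinS n (fun k => h k.+1 - h k)).
have -> : (bernstein n.+1 (fun k => h k.+1)).[x] =
    (bernstein n.+1 (fun k => h k.+1 - h k)).[x] + (bernstein n.+1 h).[x].
  rewrite -[in X in _ + X](mul1r (bernstein n.+1 h).[x]) addrC -bernstein_linear.
  by congr horner; congr bernstein; apply/funext => k; ring.
by rewrite bernsteinS [n.+2%:R]mulrS; ring.
Qed.

(** Here the derivative at x is a mean of the values of h, weighted by the centred variable, instead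
    of a mean of differences. At a point where a function is merely derivable, values can be
    compared with the tangent line, while differences of neighbouring nodes cannot. *)
Lemma bernstein_mulC n h x :
  (bernstein n.+1 (fun k => (k%:R - n.+1%:R * x) * h k)).[x] =
  x * (1 - x) * (bernstein n.+1 h)^`().[x].
Proof.
rewrite bernstein_deriv; elim: n h => [|n IH] h.
  by rewrite bernsteinS !bernstein0//; ring.
rewrite bernsteinS.
have -> : (fun k => (k.+1%:R - n.+2%:R * x) * h k.+1) =
    fun k => (1 - x) * h k.+1 + (k%:R - n.+1%:R * x) * h k.+1 :> R.
  by apply/funext => k; rewrite [n.+2%:R]mulrS [k.+1%:R]mulrS; ring.
have -> : (fun k => (k%:R - n.+2%:R * x) * h k) =
    fun k => - x * h k + (k%:R - n.+1%:R * x) * h k :> R.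
  by apply/funext => k; rewrite [n.+2%:R]mulrS; ring.
rewrite !bernstein_linear !(IH) (bernsteinS n (fun k => _ - _)).
have -> : (bernstein n.+1 (fun k => h k.+1)).[x] =
    (bernstein n.+1 (fun k => h k.+1 - h k)).[x] + (bernstein n.+1 h).[x].
  rewrite -[in X in _ + X](mul1r (bernstein n.+1 h).[x]) addrC -bernstein_linear.
  by congr horner; congr bernstein; apply/funext => k; ring.
by rewrite (bernsteinS n (fun k => _ - _)) [n.+2%:R]mulrS; ring.
Qed.

(** The nested form is the one that [bernstein_linear] splits summand by summand. *)
Lemma bernstein_polynomial4 n h x a0 a1 a2 a3 a4
    (m := fun j => (bernstein n (fun k => h k ^+ j)).[x]) :
  (bernstein n (fun k => a4 * h k ^+ 4 + (a3 * h k ^+ 3 +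
     (a2 * h k ^+ 2 + (a1 * h k + a0))))).[x] =
  a4 * m 4 + (a3 * m 3 + (a2 * m 2 + (a1 * m 1 + a0))).
Proof. by rewrite !bernstein_linear bernstein_cst. Qed.

(** These are the centred moments of the binomial distribution with n trials and success probability
    x. One more trial shifts the centred variable by 1 - x on success and by -x on failure, whence
    the induction. The second moment controls the values and the fourth the derivatives; the third
    serves the induction. *)
Lemma bernstein_moments n x
    (m := fun n j => (bernstein n (fun k => (k%:R - n%:R * x) ^+ j)).[x])
    (X := x * (1 - x)) :
  [/\ m n 1 = 0, m n 2 = n%:R * X, m n 3 = n%:R * X * (1 - 2 * x) &
      m n 4 = 3 * n%:R ^+ 2 * X ^+ 2 + n%:R * X * (1 - 6 * X)].
Proof.
rewrite /X {X}; elim: n => [|n [m1 m2 m3 m4]].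
  by rewrite /m !bernstein0//; split; ring.
have mS j : m n.+1 j =
    x * (bernstein n (fun k => (k%:R - n%:R * x + (1 - x)) ^+ j)).[x] +
    (1 - x) * (bernstein n (fun k => (k%:R - n%:R * x - x) ^+ j)).[x].
  rewrite /m bernsteinS; congr (_ * horner (bernstein _ _) _ + _ * horner (bernstein _ _) _).
    by apply/funext => k; congr (_ ^+ _); rewrite [k.+1%:R]mulrS [n.+1%:R]mulrS; ring.
  by apply/funext => k; congr (_ ^+ _); rewrite [n.+1%:R]mulrS; ring.
have P a j b4 b3 b2 b1 b0 :
    (forall u : R, (u + a) ^+ j = b4 * u ^+ 4 + (b3 * u ^+ 3 + (b2 * u ^+ 2 + (b1 * u + b0)))) ->
    (bernstein n (fun k => (k%:R - n%:R * x + a) ^+ j)).[x] =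
    b4 * m n 4 + (b3 * m n 3 + (b2 * m n 2 + (b1 * m n 1 + b0))).
  move=> uE; rewrite /m -bernstein_polynomial4; congr (horner (bernstein _ _) _).
  by apply/funext => k; exact: uE.
have P1 a := P a 1 0 0 0 1 a (fun u => ltac:(ring)).
have P2 a := P a 2 0 0 1 (2 * a) (a ^+ 2) (fun u => ltac:(ring)).
have P3 a := P a 3 0 1 (3 * a) (3 * a ^+ 2) (a ^+ 3) (fun u => ltac:(ring)).
have P4 a := P a 4 1 (4 * a) (6 * a ^+ 2) (4 * a ^+ 3) (a ^+ 4) (fun u => ltac:(ring)).
by rewrite !mS !(P1, P2, P3, P4) m1 m2 m3 m4 [n.+1%:R]mulrS; split; ring.
Qed.

Section approximation.
Context (f : R -> R) (K : R).
Context (f_lip : forall s t, 0 <= s <= 1 -> 0 <= t <= 1 ->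
  `|f s - f t| <= K * `|s - t|).

(** Degree n + 1 keeps the denominator of the nodes nonzero and fits [bernstein_deriv] for every
    n. *)
Definition bernstein_of n := bernstein n.+1 (fun k => f (k%:R / n.+1%:R)).

Lemma bernstein_of0 n : (bernstein_of n).[0] = f 0.
Proof. by rewrite bernstein_at0 mul0r. Qed.

Lemma bernstein_of1 n : (bernstein_of n).[1] = f 1.
Proof. by rewrite bernstein_at1 divff. Qed.

Let K0 : 0 <= K.
Proof.
have := @f_lip 0 1; rewrite !lexx ler01/= => /(_ isT isT).
by rewrite sub0r normrN normr1 mulr1; exact: le_trans.
Qed.

Let node n k : (k <= n.+1)%N -> 0 <= (k%:R / n.+1%:R : R) <= 1.
Proof.
move=> kn; rewrite divr_ge0//= ler_pdivrMr ?ltr0n// mul1r.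
by rewrite ler_nat.
Qed.

Lemma bernstein_of_deriv_le n x : 0 <= x <= 1 -> `|(bernstein_of n)^`().[x]| <= K.
Proof.
move=> x01; rewrite bernstein_deriv -bernsteinZ.
rewrite -[K](bernstein_cst n x); apply: bernstein_norm_le => // k kn.
rewrite normrM normr_nat -ler_pdivlMl ?ltr0n// [leRHS]mulrC.
rewrite (le_trans (@f_lip _ _ (node _) (node (leqW kn))))// -mulrBl.
by rewrite -natrB// subSnn mul1r ger0_norm// invr_ge0.
Qed.

(** The error is at most K times the mean distance from the nodes to x. The bound |u| <= eta + u^2 /
    eta reduces this to the variance, of order 1 / (n + 1). With this [eta], K eta is below e / 2,
    also when K = 0. *)
Lemma bernstein_of_cvg x : 0 <= x <= 1 ->
  (bernstein_of n).[x] @[n --> \oo] --> f x.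
Proof.
move=> x01; apply/cvgrPdist_le => e e0.
pose eta := e / (2 * (K + 1)).
have eta0 : 0 < eta by rewrite divr_gt0// mulr_gt0// ltr_wpDl.
have le2 u : `|u| <= eta + eta^-1 * u ^+ 2.
  rewrite -[u ^+ 2]real_normK ?num_real// -subr_ge0.
  have -> : eta + eta^-1 * `|u| ^+ 2 - `|u| =
      eta^-1 * ((`|u| - eta) ^+ 2 + eta * `|u|) by field; rewrite gt_eqF.
  apply: mulr_ge0; first by rewrite invr_ge0 ltW.
  by apply: addr_ge0; [exact: sqr_ge0|rewrite mulr_ge0// ltW].
have : (K * eta^-1 / (n.+1%:R : R)) @[n --> \oo] --> K * eta^-1 * 0.
  apply: cvgMr; exact: cvg_harmonic.
rewrite mulr0 => /cvgrPdist_le/(_ (e / 2)); rewrite divr_gt0// => /(_ isT).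
apply: filterS => n; rewrite sub0r normrN => en.
rewrite distrC -bernstein_subC.
have le3 : `|(bernstein n.+1 (fun k => f (k%:R / n.+1%:R) - f x)).[x]| <=
    (bernstein n.+1 (fun k => K * eta^-1 * n.+1%:R ^- 2 * (k%:R - n.+1%:R * x) ^+ 2
      + K * eta)).[x].
  apply: bernstein_norm_le => // k kn.
  rewrite (le_trans (@f_lip _ _ (node kn) x01))//.
  rewrite (le_trans (ler_wpM2l K0 (le2 _)))//.
  rewrite le_eqVlt; apply/orP; left; apply/eqP.
  by field; rewrite nat1r pnatr_eq0 (gt_eqF eta0).
rewrite (le_trans le3)// bernstein_linear bernstein_cst.
have [_ -> _ _] := bernstein_moments n.+1 x.
have N0 : n.+1%:R != 0 :> R by rewrite pnatr_eq0.
have x1 : x * (1 - x) <= 1 by case/andP: x01; nra.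
have -> : K * eta^-1 * n.+1%:R ^- 2 * (n.+1%:R * (x * (1 - x))) =
   K * eta^-1 / n.+1%:R * (x * (1 - x)).
  by field; rewrite nat1r N0 gt_eqF.
rewrite [e]splitr lerD//.
  have pos : 0 <= K * eta^-1 / n.+1%:R.
    by rewrite !mulr_ge0 ?invr_ge0 ?(ltW eta0) ?ler0n.
  by rewrite (le_trans _ (le_trans (ler_norm _) en))// ler_piMr.
have K1 : 0 < K + 1 by rewrite ltr_wpDl.
have -> : K * eta = e / 2 * (K / (K + 1)) by rewrite /eta; field; rewrite gt_eqF.
rewrite ler_piMr ?divr_ge0 ?(ltW e0)//.
by rewrite ler_pdivrMr// mul1r lerDl.
Qed.

(** By [bernstein_mulC], x (1 - x) times the error is the mean of the centred variable times the
    remainder [r] of the first-order expansion of f at x: the first moment removes f x and the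
    second one accounts for the slope. The remainder is small relative to |y - x| near x, and the
    fourth moment controls the nodes far from x. *)
Lemma bernstein_of_deriv_cvg x l : 0 < x < 1 -> is_derive x 1 f l ->
  (bernstein_of n)^`().[x] @[n --> \oo] --> l.
Proof.
move=> /andP[x0 x1] fl; apply/cvgrPdist_le => e e0.
have x01 : 0 <= x <= 1 by rewrite !ltW.
pose X := x * (1 - x); have X0 : 0 < X by rewrite mulr_gt0 ?subr_gt0.
have X1 : X <= 1 by rewrite /X; nra.
pose r y := f y - f x - l * (y - x).
have [del del0 rdel] : exists2 del, 0 < del &
    forall y, `|y - x| < del -> `|r y| <= e / 2 * `|y - x|.
  have /is_derive1_caratheodory[h [hfE hc hx]] := fl.
  have /cvgrPdist_le/(_ (e / 2)) := hc; rewrite divr_gt0// => /(_ isT).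
  move=> /nbhs_ballP[del /= del0 hdel]; exists del => // y yx.
  rewrite /r hfE -mulrBl normrM ler_wpM2r// -hx distrC; apply: hdel.
  by rewrite /ball/= distrC.
pose C := K + `|l|.
have rC y : 0 <= y <= 1 -> `|r y| <= C * `|y - x|.
  move=> y01; rewrite /C mulrDl (le_trans (ler_normB _ _))// lerD ?normrM//.
  exact: f_lip.
have C0 : 0 <= C by rewrite addr_ge0.
(* If |y - x| >= del, the factor ((y - x) / del)^2 >= 1 raises the Lipschitz bound to a fourth
   power. *)
have rle y : 0 <= y <= 1 ->
    `|y - x| * `|r y| <= e / 2 * (y - x) ^+ 2 + C / del ^+ 2 * (y - x) ^+ 4.
  move=> y01; rewrite -[(y - x) ^+ 4]/((y - x) ^+ (2 * 2)) exprM.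
  rewrite -[(y - x) ^+ 2]real_normK ?num_real//.
  have u0 := normr_ge0 (y - x).
  have [yx|yx] := ltP `|y - x| del.
    rewrite (le_trans (ler_wpM2l u0 (rdel _ yx)))// mulrCA -expr2 lerDl.
    by rewrite mulr_ge0 ?divr_ge0 ?exprn_ge0// ltW.
  rewrite (le_trans (ler_wpM2l u0 (rC _ y01)))// mulrCA -expr2.
  rewrite (@le_trans _ _ (C / del ^+ 2 * (`|y - x| ^+ 2) ^+ 2))//; last first.
    by rewrite lerDr mulr_ge0 ?divr_ge0 ?exprn_ge0// ltW.
  rewrite -mulrA ler_wpM2l// expr2 mulrA ler_peMl ?exprn_ge0// mulrC.
  by rewrite ler_pdivlMr ?exprn_gt0// mul1r lerXn2r ?nnegrE// ltW.
(* The fourth moment is at most 4 (n + 1)^2 X; times the coefficient [B] used below, this is X times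
   the present null sequence. *)
have : (4 * C / del ^+ 2 / (n.+1%:R : R)) @[n --> \oo] --> 4 * C / del ^+ 2 * 0.
  by apply: cvgMr; exact: cvg_harmonic.
rewrite mulr0 => /cvgrPdist_le/(_ (e / 2)); rewrite divr_gt0// => /(_ isT).
apply: filterS => n; rewrite sub0r normrN => en.
have N0 : 0 < n.+1%:R :> R by rewrite ltr0n.
have N1 : 1 <= n.+1%:R :> R by rewrite ler1n.
rewrite distrC.
have [m1 m2 m3 m4] := bernstein_moments n.+1 x.
have XE : X * ((bernstein_of n)^`().[x] - l) =
    (bernstein n.+1 (fun k => (k%:R - n.+1%:R * x) * r (k%:R / n.+1%:R))).[x].
  have -> : (fun k => (k%:R - n.+1%:R * x) * r (k%:R / n.+1%:R)) =
      fun k => - l / n.+1%:R * (k%:R - n.+1%:R * x) ^+ 2 + (- f x *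
       (k%:R - n.+1%:R * x) ^+ 1 + (k%:R - n.+1%:R * x) * f (k%:R / n.+1%:R)).
    by apply/funext => k; rewrite /r; field; rewrite nat1r gt_eqF.
  rewrite !bernstein_linear m1 m2 bernstein_mulC -/(bernstein_of n) /X.
  by field; rewrite nat1r gt_eqF.
rewrite -(ler_pM2l X0) -{1}(gtr0_norm X0) -normrM XE.
pose A := e / 2 / n.+1%:R; pose B := C / del ^+ 2 / n.+1%:R ^+ 3.
rewrite (le_trans (@bernstein_norm_le _ _ (fun k => A * (k%:R - n.+1%:R * x) ^+ 2 +
   B * (k%:R - n.+1%:R * x) ^+ 4) _ x01 _))//.
  move=> k kn; have kE : k%:R - n.+1%:R * x = n.+1%:R * (k%:R / n.+1%:R - x).
    by field; rewrite nat1r gt_eqF.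
  rewrite kE normrM normrM gtr0_norm// -mulrA.
  rewrite (le_trans (ler_wpM2l (ltW N0) (rle _ (node kn))))//.
  rewrite le_eqVlt; apply/orP; left; apply/eqP; rewrite /A /B.
  by field; rewrite nat1r !gt_eqF.
rewrite bernstein_linear bernsteinZ m2 m4 -/X.
rewrite (@le_trans _ _ (e / 2 * X + B * (4 * n.+1%:R ^+ 2 * X)))//.
  apply: lerD.
    rewrite le_eqVlt; apply/orP; left; apply/eqP; rewrite /A /X.
    by field; rewrite nat1r gt_eqF.
  apply: ler_wpM2l; first by rewrite /B !divr_ge0 ?exprn_ge0// ltW.
  have : n.+1%:R * X * (1 - 6 * X) <= n.+1%:R * X.
    by rewrite ler_piMr ?mulr_ge0 ?ltW//; lra.
  have : n.+1%:R * X <= n.+1%:R ^+ 2 * X.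
    by rewrite ler_pM2r// expr2 ler_peMl// ltW.
  have : 3 * n.+1%:R ^+ 2 * X ^+ 2 <= 3 * n.+1%:R ^+ 2 * X.
    by rewrite ler_wpM2l ?mulr_ge0 ?exprn_ge0 ?ler_piMr// ltW.
  by lra.
have -> : B * (4 * n.+1%:R ^+ 2 * X) = X * (4 * C / del ^+ 2 / n.+1%:R).
  by rewrite /B; field; rewrite nat1r !gt_eqF.
rewrite [e / 2 * X]mulrC -mulrDr ler_pM2l// [leRHS]splitr lerD2l.
by rewrite (le_trans _ en)// ler_norm.
Qed.

End approximation.
End bernstein.

(** * Velocities relative to the unit interval *)

Section velocity.
Context {R : realType}.
Local Notation I01 := (`[0, 1]%classic : set R).

Section normed.
Context {W : normedModType R}.
Implicit Types (c : R -> W) (t : R).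

(** Properness makes one-sided limits at 0 and 1 unique, so that [velocity] has a meaning there. The
    witness steps from t towards the farther end point, by at most 1/2. *)
Lemma unit_within_proper t : 0 <= t <= 1 -> ProperFilter (within I01 t^').
Proof.
move=> /andP[t0 t1]; apply: Build_ProperFilter_ex => B [e /= e0 eB].
pose d := Num.min (e / 2) (1 / 2).
have d0 : 0 < d by rewrite lt_min !divr_gt0.
have de : d < e by rewrite gt_min; apply/orP; left; lra.
have d1 : d <= 1 / 2 by rewrite ge_min lexx orbT.
have [t2|t2] := leP t (1 / 2).
- exists (t + d); apply: eB => /=.
  + by rewrite opprD addNKr normrN gtr0_norm.
  + by rewrite gt_eqF// ltrDl.
  + by rewrite in_itv/=; lra.
- exists (t - d); apply: eB => /=.
  + by rewrite opprB addrC subrK gtr0_norm.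
  + by rewrite lt_eqF// ltrBlDr ltrDl.
  + by rewrite in_itv/=; lra.
Qed.

Lemma is_derive_diffq c t v : is_derive t 1 c v <-> diffq c t s @[s --> t^'] --> v.
Proof.
have E : (fun s => diffq c t s) =
    (fun h => h^-1 *: (c (h *: 1 + t) - c t)) \o (fun s => s - t).
  by apply/funext => s; rewrite /diffq /= -[_ *: 1]/(_ * _) mulr1 subrK.
have E' : (fun h : R => h^-1 *: (c (h *: 1 + t) - c t)) =
    (fun s => diffq c t s) \o (fun h => h + t).
  by apply/funext => s; rewrite /diffq /= -[_ *: 1]/(_ * _) mulr1 addrK.
have sh : (fun s => s - t) @ t^' `=>` 0^'.
  move=> B [e /= e0 eB]; exists e => //= s se st; apply: eB => /=.
    by rewrite sub0r normrN distrC.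
  by rewrite subr_eq0.
have sh' : (fun h => h + t) @ 0^' `=>` t^'.
  move=> B [e /= e0 eB]; exists e => //= s se st; apply: eB => /=.
    by rewrite opprD addrCA subrr addr0 normrN; move: se => /=; rewrite sub0r normrN.
  by rewrite -subr_eq0 addrK.
split=> [[dc <-]|cv].
  have dc' : (fun h : R => h^-1 *: (c (h *: 1 + t) - c t)) @ 0^' --> 'D_1 c t by exact: dc.
  by rewrite E; apply: (cvg_trans _ dc') => B /= hB; exact: (sh _ hB).
have h0 : (fun h => h^-1 *: (c (h *: 1 + t) - c t)) @ 0^' --> v.
  by rewrite E'; apply: (cvg_trans _ cv) => B /= hB; exact: (sh' _ hB).
split; first by apply/cvg_ex; exists v; exact: h0.
exact: (cvg_lim (@norm_hausdorff _ _) h0).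
Qed.

Lemma velocity_cvg c t v : 0 <= t <= 1 ->
  diffq c t s @[s --> within I01 t^'] --> v ->
  derivable_within I01 c t /\ velocity I01 c t = v.
Proof.
move=> t01 cv; have := unit_within_proper t01 => PF.
by split; [apply/cvg_ex; exists v; exact: cv|exact: (cvg_lim (@norm_hausdorff _ _) cv)].
Qed.

Lemma velocity_is_derive c t v : 0 <= t <= 1 -> is_derive t 1 c v ->
  derivable_within I01 c t /\ velocity I01 c t = v.
Proof.
move=> t01 /is_derive_diffq cv; apply: velocity_cvg => //.
exact: cvg_trans (cvg_app _ (cvg_within _)) cv.
Qed.

Lemma diffq_eq_on (c c' : R -> W) t : {in I01, c =1 c'} -> 0 <= t <= 1 ->
  {near within I01 t^', diffq c t =1 diffq c' t}.
Proof.
move=> cc' t01; apply: filterS (@withinT _ _ I01 _) => s Is.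
by rewrite /diffq !cc' ?inE//= in_itv.
Qed.

Lemma velocity_eq_on (c c' : R -> W) t : {in I01, c =1 c'} -> 0 <= t <= 1 ->
  velocity I01 c t = velocity I01 c' t /\
  (derivable_within I01 c t <-> derivable_within I01 c' t).
Proof.
move=> cc' t01.
suff E : (diffq c t s @[s --> within I01 t^']) = (diffq c' t s @[s --> within I01 t^']).
  by rewrite /velocity /derivable_within E.
have h1 := diffq_eq_on cc' t01.
have h2 := @diffq_eq_on c' c t (fun s Is => esym (cc' s Is)) t01.
by apply/seteqP; split; apply: near_eq_cvg.
Qed.

Lemma derivable_within_interior c t : 0 < t < 1 -> derivable_within I01 c t ->
  is_derive t 1 c (velocity I01 c t).
Proof.
move=> t01 dc; apply/is_derive_diffq.
apply: cvg_trans dc; apply: cvg_app => B [e /= e0 eB].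
exists (Num.min e (Num.min t (1 - t))) => /=.
  by rewrite !lt_min e0 subr_gt0.
move=> s /=; rewrite !lt_min => /and3P[se + +] st.
rewrite !ltr_norml => /andP[? ?] /andP[? ?].
apply: eB => //=; rewrite in_itv/=; lra.
Qed.

Lemma derivable_within_cont c t : 0 <= t <= 1 -> derivable_within I01 c t ->
  c s @[s --> within I01 (nbhs t)] --> c t.
Proof.
move=> t01 /cvg_ex[v cv]; have PF := unit_within_proper t01.
have cl : c t + (s - t) *: diffq c t s @[s --> within I01 t^'] --> c t + 0 *: v.
  apply: cvgD; first exact: cvg_cst.
  apply: cvgZ => //; apply/cvgrPdist_lt => e e0; exists e => //= s se _ _.
  by rewrite sub0r normrN distrC.
rewrite scale0r addr0 in cl.
apply/cvgrPdist_lt => e e0.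
have /cvgrPdist_lt/(_ _ e0)[r /= r0 rB] := cl.
exists r => //= s ts Is; have [->|st] := eqVneq s t; first by rewrite subrr normr0.
have := rB s ts st Is; rewrite /diffq scalerA divff ?subr_eq0// scale1r.
by have -> : c t + (c s - c t) = c s by rewrite addrC subrK.
Qed.

End normed.

Section coordinates.
Context {d : nat}.
Implicit Types (c : R -> 'rV[R]_d) (t : R).

Lemma is_derive_rV c t v :
  is_derive t 1 c v <-> forall i, is_derive t 1 (fun s => c s 0 i) (v 0 i).
Proof.
split=> [[dc <-] i|dc].
  rewrite (derive_mx dc) mxE; apply: DeriveDef => //.
  by move/derivable_mxP : dc; exact.
have dc' : derivable c t 1.
  by apply/derivable_mxP => i j; rewrite (ord1 i); exact: (@ex_derive _ _ _ _ _ _ _ (dc j)).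
apply: DeriveDef => //; rewrite (derive_mx dc'); apply/matrixP => i j.
by rewrite mxE (ord1 i); exact: (@derive_val _ _ _ _ _ _ _ (dc j)).
Qed.

Lemma continuous_rV c : continuous c <-> forall i, continuous (fun s => c s 0 i).
Proof.
split=> [cc i s|cc s].
  apply: (@continuous_comp _ _ _ c (fun v : 'rV[R]_d => v 0 i)); first exact: cc.
  exact: coord_continuous.
apply/cvgrPdist_le => e e0.
have : \forall y \near s, forall i, `|c s 0 i - c y 0 i| <= e.
  near=> y; move=> i; move: i; near: y; apply: filter_forall => i.
  by have /cvgrPdist_le/(_ _ e0) := cc i s.
apply: filterS => y yc; rewrite /Num.Def.normr/= mx_normrE.
by rewrite bigmax_le ?ltW// => -[i j] _; rewrite !mxE (ord1 i).
Unshelve. all: by end_near. Qed.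

Lemma coord_norm_le (v : 'rV[R]_d) i : `|v 0 i| <= `|v|.
Proof.
by rewrite [leRHS]/Num.Def.normr/= mx_normrE; exact: (le_bigmax _ _ (0, i)).
Qed.

Lemma rV_norm_le (v : 'rV[R]_d) (K : R) : 0 <= K ->
  (forall i, `|v 0 i| <= K) -> `|v| <= K.
Proof.
move=> K0 vK; rewrite [leLHS]/Num.Def.normr/= mx_normrE.
by apply: bigmax_le => // -[i0 i] _; rewrite (ord1 i0); exact: vK.
Qed.

Lemma velocity_coord c t i : 0 <= t <= 1 -> derivable_within I01 c t ->
  derivable_within I01 (fun s => c s 0 i : R) t /\
  velocity I01 (fun s => c s 0 i : R) t = velocity I01 c t 0 i.
Proof.
move=> t01 /cvg_ex[v cv].
have [_ ->] := velocity_cvg t01 cv; apply: velocity_cvg => //.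
apply/cvgrPdist_lt => e e0; have PF := unit_within_proper t01.
have /cvgrPdist_lt/(_ _ e0) := cv; apply: filterS => s; apply: le_lt_trans.
by have := coord_norm_le (v - diffq c t s) i; rewrite /diffq !mxE.
Qed.

End coordinates.
End velocity.

(** * Clamping to the unit interval, and primitives of continuous functions *)

Section unit_interval.
Context {R : realType}.
Local Notation I01 := (`[0, 1]%classic : set R).
Local Notation mu := (@lebesgue_measure R).

(** Composition with this retraction extends continuous functions from [0, 1] to the line, where
    differentiation has no end-point cases. *)
Definition clamp (t : R) : R := Num.max 0 (Num.min 1 t).

Lemma clampP t : [\/ clamp t = 0 /\ t <= 0, clamp t = t /\ 0 <= t <= 1 |
  clamp t = 1 /\ 1 <= t].
Proof.
rewrite /clamp; have [t1|t1] := leP 1 t.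
  by apply: Or33; rewrite (max_idPr ler01).
by have [t0|t0] := leP 0 t; [apply: Or32|apply: Or31]; split=> //; lra.
Qed.

Lemma clamp_itv t : 0 <= clamp t <= 1.
Proof.
by case: (clampP t) => -[-> ?] //; rewrite lexx ler01.
Qed.

Lemma clamp_id t : 0 <= t <= 1 -> clamp t = t.
Proof.
by move=> /andP[t0 t1]; rewrite /clamp (min_idPr t1) (max_idPr t0).
Qed.

Lemma clamp_lipschitz s t : `|clamp s - clamp t| <= `|s - t|.
Proof.
have h1 := ler_norm (s - t); have h2 := ler_norm (- (s - t)).
rewrite normrN in h2; rewrite ler_norml.
by case: (clampP s) => -[-> ?]; case: (clampP t) => -[-> ?]; lra.
Qed.

Lemma clamp_continuous : continuous clamp.
Proof.
move=> x; apply/cvgrPdist_lt => e e0; exists e => //= y xy.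
exact: le_lt_trans (clamp_lipschitz _ _) xy.
Qed.

Lemma within_clamp_continuous (W : normedModType R) (f : R -> W) :
  {within I01, continuous f} -> continuous (fun t => f (clamp t)).
Proof.
move=> /subspace_continuousP cf t.
have It : I01 (clamp t) by rewrite /= in_itv/= clamp_itv.
apply/cvgrPdist_lt => e e0; have /cvgrPdist_lt/(_ _ e0)[r /= r0 rB] := cf _ It.
exists r => //= s ts; apply: rB => /=; last by rewrite in_itv/= clamp_itv.
by apply: (le_lt_trans (clamp_lipschitz _ _)).
Qed.

Lemma continuous_integrable a b (f : R -> R) : continuous f ->
  mu.-integrable `[a, b] (EFin \o f).
Proof.
move=> cf; apply: continuous_compact_integrable; first exact: segment_compact.
exact: continuous_subspaceT.
Qed.

Lemma continuous_antiderivative (f : R -> R) : continuous f ->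
  exists2 F : R -> R, F 0 = 0 & forall t : R, is_derive t 1 F (f t).
Proof.
move=> cf.
pose G (a t : R) : R := \int[mu]_(x in `[a, t]) f x.
pose F t := if 0 <= t then G 0 t else - G t 0.
have GD a t u : a <= t -> t <= u -> G a u = G a t + G t u.
  move=> at_ tu; rewrite /G.
  have := @Rintegral_itvB _ f (BLeft a) (BRight u) t (continuous_integrable _ _ cf).
  rewrite !bnd_simp => /(_ at_ tu)/eqP; rewrite subr_eq addrC => /eqP ->.
  congr (_ + _); rewrite -(@Rintegral_itv_obnd_cbnd _ t (BRight u))//.
  apply: integrableS (continuous_integrable t u cf) => //.
  exact: subset_itv_oc_cc.
have FE a t : a <= 0 -> a <= t -> F t = G a t - G a 0.
  move=> a0 at_; rewrite /F; case: leP => t0.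
    by rewrite (GD a 0 t) //; lra.
  rewrite (GD a t 0)//; last exact: ltW. lra.
exists F => [|t]; first by rewrite /F lexx /G set_itv1 Rintegral_set1.
(* Starting the integral to the left of both 0 and t makes t interior and changes [F] only by a
   constant. *)
pose a := Num.min 0 t - 1.
have m0 : Num.min 0 t <= 0 by rewrite ge_min lexx.
have mt : Num.min 0 t <= t by rewrite ge_min lexx orbT.
have a0 : a <= 0 by rewrite /a; lra.
have at_ : a < t by rewrite /a; lra.
have t1 : t < t + 1 by lra.
have [dG GE] := @continuous_FTC1_closed _ f a t (t + 1) t1
  (continuous_integrable _ _ cf) at_ (cf t).
have dGa : is_derive t 1 (G a) (f t).
  by apply: DeriveDef => //; rewrite -derive1E.
have := isdB dGa (isd_cst (G a 0) t); rewrite subr0.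
apply: isd_near; near=> s; rewrite (FE a)// ltW//; near: s.
exact: lt_nbhsr.
Unshelve. all: by end_near. Qed.

Lemma Rintegral_derive (f F : R -> R) : continuous f ->
  (forall t : R, is_derive t 1 F (f t)) ->
  \int[mu]_(t in `[0, 1]) f t = F 1 - F 0.
Proof.
move=> cf dF; rewrite /Rintegral (@continuous_FTC2 _ f F 0 1)//.
- exact: continuous_subspaceT.
- split => [t _||]; first exact: (@ex_derive _ _ _ _ _ _ _ (dF t)).
  + by apply: cvg_at_right_filter; exact: (isd_cont (dF 0)).
  + by apply: cvg_at_left_filter; exact: (isd_cont (dF 1)).
- by move=> t _; rewrite derive1E; exact: (@derive_val _ _ _ _ _ _ _ (dF t)).
Qed.

End unit_interval.

(** * Extension of C^1 curves to the whole line *)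

Section extension.
Context {R : realType}.
Local Notation I01 := (`[0, 1]%classic : set R).

Lemma eq_of_eq_derive (f g : R -> R) :
  (forall t : R, 0 < t < 1 -> exists l, is_derive t 1 f l /\ is_derive t 1 g l) ->
  {within I01, continuous f} -> {within I01, continuous g} -> f 0 = g 0 ->
  forall t, 0 <= t <= 1 -> f t = g t.
Proof.
move=> fg cf cg fg0 t /andP[t0 t1].
have sub : `[0, t] `<=` I01 by apply: subset_itvl; rewrite bnd_simp.
have [x||c _] := @MVT_segment R (fun x => f x - g x) (fun=> 0) 0 t t0.
- rewrite in_itv/= => /andP[x0 xt].
  have [|l [fl gl]] := fg x; first by rewrite x0 (lt_le_trans xt).
  by have := isdB fl gl; rewrite subrr.
- apply: (continuous_subspaceW sub) => x.
  by apply: continuousB; [exact: cf|exact: cg].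
- by rewrite fg0 subrr subr0 mul0r => /eqP; rewrite subr_eq0 => /eqP.
Qed.

(** Integrating the clamped velocity gives a C^1 curve on the line; it agrees with [w] on [0, 1],
    both having the same derivative inside and the same value at 0. Ordinary derivatives can then
    replace one-sided ones. *)
Lemma C1_extension (d : nat) (w : R -> 'rV[R]_d) : C1_on I01 w ->
  exists W V : R -> 'rV[R]_d, [/\ forall t : R, is_derive t 1 W (V t), continuous V,
    forall t, 0 <= t <= 1 -> W t = w t &
    forall t, V t = velocity I01 w (clamp t)].
Proof.
move=> [dw cv]; pose V t := velocity I01 w (clamp t).
have cV : continuous V by exact: within_clamp_continuous cv.
have /choice[P PE] : forall i, exists P : R -> R, P 0 = w 0 0 i /\
    forall t : R, is_derive t 1 P (V t 0 i).
  move=> i; have /continuous_rV/(_ i)/continuous_antiderivative[P P0 dP] := cV.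
  exists (fun t => w 0 0 i + P t); rewrite P0 addr0; split => // t.
  by have := isdD (isd_cst (w 0 0 i) t) (dP t); rewrite add0r.
pose W t := \row_i P i t.
have dW t : is_derive t (1 : R) W (V t).
  apply/is_derive_rV => i; have [_ /(_ t)] := PE i.
  by congr is_derive; apply/funext => s; rewrite mxE.
exists W, V; split => // t t01; apply/rowP => i.
rewrite mxE; have [Pi0 dP] := PE i.
have I t' : 0 <= t' <= 1 -> I01 t' by rewrite /= in_itv.
have dwi t' : 0 <= t' <= 1 -> derivable_within I01 (fun s => w s 0 i : R) t' /\
    velocity I01 (fun s => w s 0 i : R) t' = velocity I01 w t' 0 i.
  by move=> t'01; apply: velocity_coord => //; exact/dw/I.
apply/(@eq_of_eq_derive (P i) (fun s => w s 0 i)) => //.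
- move=> x x01; exists (V x 0 i); split; first exact: dP.
  have x01' : 0 <= x <= 1 by case/andP: x01 => *; rewrite !ltW.
  have [h1 h2] := dwi _ x01'; rewrite /V clamp_id// -h2.
  exact: derivable_within_interior.
- by apply: continuous_subspaceT => x; exact: (isd_cont (dP x)).
- apply/subspace_continuousP => x; rewrite /= in_itv/= => x01.
  by have [h1 _] := dwi _ x01; exact: derivable_within_cont.
Qed.

End extension.

(** * Convergence of lengths *)

Section integral_null.
Local Open Scope ereal_scope.
Context d (T : measurableType d) (R : realType) (mu : {measure set T -> \bar R}).
Import HBNNSimple.

(* Unlike in the library's version, f need not be measurable on the whole of D. *)
Lemma ge0_integral_setD_null (D N : set T) (f : T -> \bar R) :
  measurable D -> measurable N -> mu N = 0 ->
  (forall x, D x -> 0 <= f x) -> measurable_fun (D `\` N) f ->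
  \int[mu]_(x in D) f x = \int[mu]_(x in D `\` N) f x.
Proof.
move=> mD mN N0 f0 mf; apply/eqP; rewrite eq_le; apply/andP; split; last first.
  rewrite !ge0_integralE//; last by move=> x [Dx _]; exact: f0.
  apply: le_ereal_sup => _ [h /= hf <-]; exists h => // x.
  rewrite (le_trans (hf x))// !patchE in_setD; case: ifPn => [/andP[-> _]//|_].
  by case: ifPn => // /set_mem/f0.
rewrite [leLHS]ge0_integralE//; apply: ge_ereal_sup => _ [h /= hf <-].
rewrite -integralT_nnsfun (@ge0_negligible_integral _ _ _ mu setT N)//; last 2 first.
  exact/measurable_EFinP.
  by move=> x _; rewrite lee_fin.
rewrite setTD.
have -> : D `\` N = ~` N `&` (D `\` N).
  by apply/seteqP; split => x /= [] => [Dx Nx|_ []].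
rewrite integral_mkcondr; apply: ge0_le_integral.
- exact: measurableC.
- by move=> x _; rewrite lee_fin.
- by apply: measurable_funTS; exact/measurable_EFinP.
- apply/measurable_restrict; [exact: measurableD|exact: measurableC|].
  by apply: measurable_funS mf; [exact: measurableD|move=> x []].
- move=> x Nx; rewrite (le_trans (hf x))// !patchE in_setD.
  by rewrite [x \in N]memNset// andbT.
Qed.

End integral_null.

Section length.
Context {R : realType} {d : nat}.
Local Notation I01 := (`[0, 1]%classic : set R).
Local Notation mu := (@lebesgue_measure R).
Implicit Types (g : 'rV[R]_d -> 'M[R]_d) (c v : R -> 'rV[R]_d).

Lemma cvg_bigsum (T I : Type) (F : set_system T) {FF : Filter F} (r : seq I)
    (f : I -> T -> R) (l : I -> R) :
  (forall i, f i x @[x --> F] --> l i) ->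
  \sum_(i <- r) f i x @[x --> F] --> \sum_(i <- r) l i.
Proof.
move=> fl; elim: r => [|i r IH].
  by rewrite big_nil; under eq_fun do rewrite big_nil; exact: cvg_cst.
by rewrite big_cons; under eq_fun do rewrite big_cons; exact: cvgD.
Qed.

Lemma cvg_quadratic (T : Type) (F : set_system T) {FF : Filter F}
    (A : T -> 'M[R]_d) (a : 'M[R]_d) (v : T -> 'rV[R]_d) (b : 'rV[R]_d) :
  (forall i j, A x i j @[x --> F] --> a i j) ->
  (forall i, v x 0 i @[x --> F] --> b 0 i) ->
  quadratic (A x) (v x) @[x --> F] --> quadratic a b.
Proof.
move=> Aa vb; apply: cvg_bigsum => i; apply: cvg_bigsum => j.
by apply: cvgM; [apply: cvgM|].
Qed.

Lemma quadratic_ge0 g x u : riemannian g -> 0 <= quadratic (g x) u.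
Proof.
move=> /(_ x)[_ pos]; have [->|/pos/ltW//] := eqVneq u 0.
by rewrite /quadratic big1// => i _; rewrite big1// => j _; rewrite !mxE mulr0.
Qed.

Lemma quadratic_le (A : 'M[R]_d) (u : 'rV[R]_d) (C K : R) :
  (forall i j, `|A i j| <= C) -> (forall i, `|u 0 i| <= K) ->
  `|quadratic A u| <= (d ^ 2)%:R * (C * K * K).
Proof.
move=> AC uK; rewrite /quadratic (le_trans (ler_norm_sum _ _ _))//.
rewrite (@le_trans _ _ (\sum_(i < d) \sum_(j < d) C * K * K))//; last first.
  by rewrite !sumr_const !card_ord -mulrnA mulr_natl mulnn.
apply: ler_sum => i _; rewrite (le_trans (ler_norm_sum _ _ _))//.
apply: ler_sum => j _; rewrite !normrM.
by rewrite ler_pM ?mulr_ge0// ler_pM.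
Qed.

Lemma bounded_on_ball (f : 'rV[R]_d -> R) (K : R) : continuous f ->
  exists C, forall x, `|x| <= K -> `|f x| <= C.
Proof.
move=> cf; have cK : compact [set x : 'rV[R]_d | `|x| <= K].
  apply: bounded_closed_compact.
    by exists K; split; rewrite ?num_real// => M KM x /= xK; rewrite (le_trans xK)// ltW.
  rewrite (_ : [set x | _] = closed_ball_ Num.norm 0 K); last first.
    by apply/seteqP; split => x; rewrite /closed_ball_/= sub0r normrN.
  exact: closed_closed_ball_.
have [|M [_ CM]] := @compact_bounded _ _ (f @` [set x : 'rV[R]_d | `|x| <= K]).
  by apply: continuous_compact => //; exact: continuous_subspaceT.
exists (M + 1) => x xK; apply: (CM (M + 1)); first by rewrite ltrDl.
by exists x.
Qed.

Lemma riem_length_eq g c (C V : R -> 'rV[R]_d) :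
  (forall t, 0 <= t <= 1 -> c t = C t) ->
  (forall t : R, 0 <= t <= 1 -> is_derive t 1 C (V t)) ->
  riem_length g c = \int[mu]_(t in `[0, 1]) Num.sqrt (quadratic (g (C t)) (V t)).
Proof.
move=> cC dC; apply: eq_Rintegral => t /set_mem; rewrite /= in_itv/= => t01.
have cC' : {in I01, c =1 C} by move=> s /set_mem; rewrite /= in_itv/=; exact: cC.
have [-> _] := velocity_eq_on cC' t01.
by have [_ ->] := velocity_is_derive t01 (dC _ t01); rewrite cC.
Qed.

Lemma speed_continuous g (C V : R -> 'rV[R]_d) :
  (forall i j, continuous (fun x => g x i j)) -> continuous C -> continuous V ->
  continuous (fun t => quadratic (g (C t)) (V t)) /\
  continuous (fun t => Num.sqrt (quadratic (g (C t)) (V t))).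
Proof.
move=> cg cC cV.
have cq : continuous (fun t => quadratic (g (C t)) (V t)).
  move=> t; apply: cvg_quadratic => [i j|i].
    by apply: (@continuous_cvg _ _ _ _ _ _ (fun x => g x i j)); [exact: cg|exact: cC].
  by have /continuous_rV := cV; exact.
split=> // t; apply: (@continuous_cvg _ _ _ _ _ _ Num.sqrt) (cq t).
exact: sqrt_continuous.
Qed.

(** Dominated convergence of the speeds: the common bound K keeps the points in a ball where the
    coefficients of g are bounded. The limit speed is a pointwise limit, hence measurable, only off
    the null set [N]; the integrals are therefore computed on its complement and carried back. *)
Lemma cvg_riem_length g c (K : R) (s v : nat -> R -> 'rV[R]_d) :
  riemannian g -> (forall i j, continuous (fun x => g x i j)) ->
  (forall n (t : R), is_derive t 1 (s n) (v n t)) ->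
  (forall n, continuous (v n)) ->
  (forall n t, 0 <= t <= 1 -> `|s n t| <= K /\ `|v n t| <= K) ->
  {ae mu, forall t, 0 <= t <= 1 -> (forall i, s n t 0 i @[n --> \oo] --> c t 0 i) /\
    (forall i, v n t 0 i @[n --> \oo] --> velocity I01 c t 0 i)} ->
  riem_length g (s n) @[n --> \oo] --> riem_length g c.
Proof.
move=> rg cg ds cv bd [N [mN N0 cvN]].
have cs n : continuous (s n).
  apply/continuous_rV => i t; have /is_derive_rV/(_ i) := ds n t.
  exact: isd_cont.
pose f t := Num.sqrt (quadratic (g (c t)) (velocity I01 c t)).
pose F n t := Num.sqrt (quadratic (g (s n t)) (v n t)).
have cF n : continuous (F n) by have [] := speed_continuous cg (cs n) (cv n).
have LF n : riem_length g (s n) = \int[mu]_(t in `[0, 1]) F n t.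
  by apply: riem_length_eq.
have Ff t : (I01 `\` N) t -> F n t @[n --> \oo] --> f t.
  move=> [It Nt]; have t01 : 0 <= t <= 1 by move: It; rewrite /= in_itv.
  have [sc vc] : (forall i, s n t 0 i @[n --> \oo] --> c t 0 i) /\
    (forall i, v n t 0 i @[n --> \oo] --> velocity I01 c t 0 i).
    by apply: contrapT => h; apply: Nt; apply: cvN => /= /(_ t01).
  apply: (@continuous_cvg _ _ _ _ _ _ Num.sqrt); first exact: sqrt_continuous.
  apply: cvg_quadratic => // i j.
  apply: (@continuous_cvg _ _ _ _ _ _ (fun x => g x i j)); first exact: cg.
  apply/cvgrPdist_le => e e0; near=> n.
  rewrite /Num.Def.normr/= mx_normrE bigmax_le ?ltW// => -[k l] _.
  rewrite !mxE (ord1 k) /=; move: l {k}; near: n; apply: filter_forall => l.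
  by have /cvgrPdist_le/(_ _ e0) := sc l.
have [M0 HM0] : exists M, forall n t, 0 <= t <= 1 -> `|F n t| <= M.
  have /choice[B HB] : forall ij : 'I_d * 'I_d, exists C, forall x : 'rV[R]_d,
      `|x| <= K -> `|g x ij.1 ij.2| <= C.
    by move=> ij; exact: bounded_on_ball.
  pose C := \sum_ij `|B ij|.
  exists (Num.sqrt ((d ^ 2)%:R * (C * K * K))) => n t /(bd n)[sK vK].
  rewrite ger0_norm ?sqrtr_ge0// ler_wsqrtr//.
  rewrite (le_trans (ler_norm _))// quadratic_le// => [i j|i].
    rewrite (le_trans (HB (i, j) _ sK))// (le_trans (ler_norm _))// /C.
    by rewrite (bigD1 (i, j))//= lerDl sumr_ge0.
  by rewrite (le_trans (coord_norm_le _ _)).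
have mI : measurable (I01 : set (measurableTypeR R)) by exact: measurable_itv.
have mD : measurable (I01 `\` N : set (measurableTypeR R)) by exact: measurableD.
have mF n : measurable_fun setT (EFin \o F n).
  by apply/measurable_EFinP; exact: continuous_measurable_fun.
have Ff' t : (I01 `\` N) t -> (EFin \o F n) t @[n --> \oo] --> (EFin \o f) t.
  by move=> Dt; apply: cvg_EFin; [exact: nearW|exact: Ff].
have mf : measurable_fun (I01 `\` N) (EFin \o f).
  apply: (@emeasurable_fun_cvg _ _ _ _ (fun n => EFin \o F n)) => // n.
  exact: measurable_funTS.
have ccM : continuous (cst M0 : R -> R) by move=> ?; exact: cvg_cst.
have iM : mu.-integrable (I01 `\` N) (cst M0%:E).
  apply: (@integrableS _ _ _ mu I01) => //.
  exact: (continuous_integrable 0 1 ccM).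
have [||if_ _] := @dominated_convergence _ _ _ mu (I01 `\` N) mD (fun n => EFin \o F n)
  (EFin \o f) (cst M0%:E) (fun n => measurable_funTS (mF n)) mf _ iM.
- by apply: aeW => t Dt; exact: Ff'.
- apply: aeW => t n [It _]; rewrite lee_fin; apply: HM0.
  by move: It; rewrite /= in_itv.
have fin : (\int[mu]_(t in I01 `\` N) (EFin \o f) t \is a fin_num)%E.
  exact: integrable_fin_num.
rewrite -(fineK fin) => /fine_cvg.
have -> : (\int[mu]_(t in I01 `\` N) (EFin \o f) t =
    \int[mu]_(t in I01) (EFin \o f) t)%E.
  apply/esym/ge0_integral_setD_null => //.
  by move=> t _; rewrite lee_fin sqrtr_ge0.
have EN n : (\int[mu]_(t in I01 `\` N) (EFin \o F n) t =
    \int[mu]_(t in I01) (EFin \o F n) t)%E.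
  apply/esym/ge0_negligible_integral => //.
    exact: (measurable_funTS (mF n)).
  by move=> t _; rewrite lee_fin sqrtr_ge0.
by under eq_fun do rewrite /= EN; under [in X in _ -> X]eq_fun do rewrite LF.
Unshelve. all: by end_near. Qed.

End length.

(** * Generalized points and generalized curves *)

Section generalized.
Context {R : realType} (rho : R -> R).
Context (rho_cvg : rho e @[e --> 0^'+] --> 0^'+).

Lemma rho_near (del : R) : 0 < del -> \forall e \near 0^'+, 0 < rho e <= del.
Proof.
move=> del0.
have h : \forall x \near (0 : R)^'+, 0 < x <= del.
  by near=> x; apply/andP; split; near: x; [exact: nbhs_right_gt|exact: nbhs_right_le].
exact: rho_cvg h.
Unshelve. all: by end_near. Qed.

Lemma near_I0 : \forall e \near (0 : R)^'+, I0 e.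
Proof.
near=> e; rewrite /I0 /=; apply/andP; split; near: e.
  exact: nbhs_right_gt.
exact: nbhs_right_le.
Unshelve. all: by end_near. Qed.

Section points.
Context {V : normedModType R}.
Implicit Types x y : R -> V.

Lemma bounded_moderate x (C : R) : (\forall e \near 0^'+, `|x e| <= C) -> moderate rho x.
Proof.
move=> xC; exists 1 => //; exists C.
apply: filterS2 xC (rho_near ltr01) => e xC /andP[r0 r1].
have C0 : 0 <= C by apply: le_trans xC.
by rewrite (le_trans xC)// ler_peMr// powRN powRr1 ?(ltW r0)// invf_ge1.
Qed.

Lemma negligible_small x y (del : R) : negligible_diff rho x y -> 0 < del ->
  \forall e \near 0^'+, `|x e - y e| <= del.
Proof.
move=> /(_ 1 ltr01)[C xyC] del0.
have D0 : 0 < del / (`|C| + 1) by rewrite divr_gt0// ltr_wpDl.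
apply: filterS2 xyC (rho_near D0) => e xyC /andP[r0 r1].
rewrite (le_trans xyC)// powRr1 ?(ltW r0)//.
rewrite (@le_trans _ _ ((`|C| + 1) * rho e))//.
  by rewrite ler_wpM2r ?(ltW r0)// (le_trans (ler_norm _))// lerDl.
by rewrite mulrC -ler_pdivlMr// ltr_wpDl.
Qed.

Lemma represents_negligible x y (X : gen rho V) :
  represents x X -> represents y X -> negligible_diff rho x y.
Proof. by move=> [mx <-] [my] /esym/gclass_eqP; apply. Qed.

Lemma represents_gclass x : moderate rho x -> represents x (gclass rho x).
Proof. by []. Qed.

Lemma moderate_cst (v : V) : moderate rho (fun=> v).
Proof. by apply: (@bounded_moderate _ `|v|); apply: nearW. Qed.

End points.

(** The inequalities hold for special representatives of t, 0 and 1. An arbitrary representative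
    differs from these by negligible nets, so it may leave [0, 1], but eventually by at most any
    given real [del]. *)
Lemma gunit_itv_near (t : R -> R) (del : R) : moderate rho t ->
  gunit_itv (gclass rho t) -> 0 < del ->
  \forall e \near 0^'+, - del <= t e <= 1 + del.
Proof.
move=> mt [[x0 [t0 [rx0 rt0 le0]]] [t1 [x1 [rt1 rx1 le1]]]] del0.
have d2 : 0 < del / 2 by rewrite divr_gt0.
have rt := represents_gclass mt.
have n1 := negligible_small (represents_negligible rt rt0) d2.
have n2 := negligible_small (represents_negligible rt rt1) d2.
have n3 := negligible_small (represents_negligible rx0 (represents_gclass (moderate_cst (0 : R)))) d2.
have n4 := negligible_small (represents_negligible rx1 (represents_gclass (moderate_cst (1 : R)))) d2.
have [I n5] := (near_I0, filterI n1 (filterI n2 (filterI n3 n4))).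
apply: filterS2 I n5 => e Ie [m1 [m2 [m3 m4]]].
move: m1 m2 m3 m4; rewrite !ler_norml => /andP[? ?] /andP[? ?] /andP[? ?] /andP[? ?].
by have := le0 _ Ie; have := le1 _ Ie; lra.
Qed.

Lemma gunit_itv_cst (a : R) : 0 <= a <= 1 -> gunit_itv (gconst rho a).
Proof.
move=> /andP[a0 a1]; split.
  by exists (fun=> 0), (fun=> a); split=> //; exact/represents_gclass/moderate_cst.
by exists (fun=> a), (fun=> 1); split=> //; exact/represents_gclass/moderate_cst.
Qed.

Lemma lipschitz_negligible (V : normedModType R) (f : R -> V) (K : R) (x y : R -> R) :
  (forall a b, -1 <= a <= 2 -> -1 <= b <= 2 -> `|f a - f b| <= K * `|a - b|) ->
  (\forall e \near 0^'+, -1 <= x e <= 2) -> (\forall e \near 0^'+, -1 <= y e <= 2) ->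
  negligible_diff rho x y ->
  negligible_diff rho (fun e => f (x e)) (fun e => f (y e)).
Proof.
move=> fK xb yb xy N N0; have [C xyC] := xy N N0.
exists (`|K| * C); apply: filterS2 (filterI xb yb) xyC => e [xe ye] xyC.
rewrite (le_trans (fK _ _ xe ye))// -mulrA.
by rewrite (le_trans (ler_wpM2r _ (ler_norm K)))// ler_wpM2l.
Qed.

(** The product is defined through chosen representatives. These are eventually bounded by C + 1, so
    a' b' - a b = a' (b' - b) + b (a' - a) is negligible. *)
Lemma gmul_gclass (a b : R -> R) (C : R) :
  (\forall e \near 0^'+, `|a e| <= C) -> (\forall e \near 0^'+, `|b e| <= C) ->
  gmul (gclass rho a) (gclass rho b) = gclass rho (fun e => a e * b e).
Proof.
move=> aC bC; have ma := bounded_moderate aC; have mb := bounded_moderate bC.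
have na := represents_negligible (rep_represents (gclass rho a)) (represents_gclass ma).
have nb := represents_negligible (rep_represents (gclass rho b)) (represents_gclass mb).
have a1 := negligible_small na ltr01; have b1 := negligible_small nb ltr01.
set a' := rep (gclass rho a) in na a1 *; set b' := rep (gclass rho b) in nb b1 *.
have a'C : \forall e \near 0^'+, `|a' e| <= C + 1.
  by apply: filterS2 aC a1 => e ? ?; rewrite -(subrK (a e) (a' e)) (le_trans (ler_normD _ _))// addrC lerD.
have b'C : \forall e \near 0^'+, `|b' e| <= C + 1.
  by apply: filterS2 bC b1 => e ? ?; rewrite -(subrK (b e) (b' e)) (le_trans (ler_normD _ _))// addrC lerD.
apply/gclass_eqP.
- apply: (@bounded_moderate _ _ ((C + 1) * (C + 1))).
  by apply: filterS2 a'C b'C => e ? ?; rewrite normrM ler_pM.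
- apply: (@bounded_moderate _ _ (C * C)).
  by apply: filterS2 aC bC => e ? ?; rewrite normrM ler_pM.
- move=> N N0; have [A aA] := na N N0; have [B bB] := nb N N0.
  exists ((C + 1) * B + C * A).
  apply: filterS2 (filterI a'C bC) (filterI aA bB) => e [? ?] [? ?].
  have -> : a' e * b' e - a e * b e = a' e * (b' e - b e) + b e * (a' e - a e) by ring.
  rewrite (le_trans (ler_normD _ _))// !normrM mulrDl -!mulrA lerD//; exact: ler_pM.
Qed.

Lemma gsub0_gclass (a : R -> R) (C : R) : (\forall e \near 0^'+, `|a e| <= C) ->
  gsub (gclass rho a) (gconst rho 0) = gclass rho a.
Proof.
move=> aC; have ma := bounded_moderate aC.
have na := represents_negligible (rep_represents (gclass rho a)) (represents_gclass ma).
have n0 := represents_negligible (rep_represents (gconst rho (0 : R)))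
  (represents_gclass (moderate_cst (0 : R))).
have a1 := negligible_small na ltr01; have b1 := negligible_small n0 ltr01.
set a' := rep (gclass rho a) in na a1 *; set z := rep (gconst rho 0) in n0 b1 *.
have E e : a' e - z e - a e = (a' e - a e) - (z e - 0) by ring.
apply/gclass_eqP => //.
- apply: (@bounded_moderate _ _ (C + (1 + 1))); apply: filterS2 aC (filterI a1 b1) => e ? [? ?].
  rewrite -(subrK (a e) (a' e - z e)) E addrC (le_trans (ler_normD _ _))// lerD//.
  by rewrite (le_trans (ler_normB _ _))// lerD.
- move=> N N0; have [A aA] := na N N0; have [B bB] := n0 N N0; exists (A + B).
  by apply: filterS2 aA bB => e ? ?; rewrite E mulrDl (le_trans (ler_normB _ _))// lerD.
Qed.

End generalized.

(** * Polynomial curves as generalized curves *)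

Section polynomial_curves.
Context {R : realType} {d : nat}.
Implicit Types (P : 'I_d -> {poly R}).

Definition poly_curve P (t : R) : 'rV[R]_d := \row_i (P i).[t].
Definition dpoly P (i : 'I_d) : {poly R} := (P i)^`().

Lemma is_derive_poly_curve P (t : R) :
  is_derive t 1 (poly_curve P) (poly_curve (dpoly P) t).
Proof.
apply/is_derive_rV => i; rewrite mxE (_ : (fun _ => _) = horner (P i)).
  exact: is_derive_poly.
by apply/funext => s; rewrite mxE.
Qed.

Lemma continuous_poly_curve P : continuous (poly_curve P).
Proof.
apply/continuous_rV => i; rewrite (_ : (fun _ => _) = horner (P i)).
  exact: continuous_horner.
by apply/funext => s; rewrite mxE.
Qed.

Lemma partial_poly_curve P (s : seq unit) :
  partial basisR s (poly_curve P) = poly_curve (iter (size s) dpoly P).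
Proof.
elim: s => [//|u s /= ->]; apply/funext => t.
exact: (@derive_val _ _ _ _ _ _ _ (is_derive_poly_curve _ t)).
Qed.

(** The interval [-1, 2] is [0, 1] with a margin of 1, into which all representatives of points of
    the generalized interval eventually fall. *)
Lemma poly_curve_bounded P : exists2 C, 0 <= C & forall t, -1 <= t <= 2 -> `|poly_curve P t| <= C.
Proof.
have cP : {within `[-1, 2], continuous (fun t => `|poly_curve P t|)}.
  apply: continuous_subspaceT => t; apply: continuous_comp.
    exact: continuous_poly_curve.
  exact: norm_continuous.
have [|c _ cmax] := EVT_max _ cP; first by lra.
by exists `|poly_curve P c| => // t t01; apply: cmax; rewrite in_itv.
Qed.

Lemma poly_curve_lipschitz P : exists2 K, 0 <= K & forall a b, -1 <= a <= 2 -> -1 <= b <= 2 ->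
  `|poly_curve P a - poly_curve P b| <= K * `|a - b|.
Proof.
have [K K0 KP] := poly_curve_bounded (dpoly P); exists K => // a b.
wlog ab : a b / a <= b.
  move=> h a12 b12; have [ab|/ltW ba] := leP a b; first exact: h.
  by rewrite distrC (distrC a); exact: h.
move=> a12 b12; apply: rV_norm_le => [|i]; first by rewrite mulr_ge0.
rewrite !mxE /= distrC [in leRHS]distrC.
have [|c] := @MVT_segment R (horner (P i)) (fun x => (P i)^`().[x]) a b ab.
  by apply: continuous_subspaceT; exact: continuous_horner.
rewrite in_itv/= => /andP[ac cb] ->; rewrite normrM ler_wpM2r//.
have := coord_norm_le (poly_curve (dpoly P) c) i; rewrite mxE => /le_trans; apply.
by apply: KP; lra.
Qed.

Lemma enorm_ge (v : 'rV[R]_d) : `|v| <= enorm v.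
Proof.
apply: rV_norm_le => [|i]; first exact: sqrtr_ge0.
rewrite -sqrtr_sqr ler_wsqrtr// (bigD1 i)//= lerDl.
by apply: sumr_ge0 => j _; exact: sqr_ge0.
Qed.

Lemma enorm_le (v : 'rV[R]_d) : enorm v <= Num.sqrt d%:R * `|v|.
Proof.
rewrite /enorm -[`|v|](ger0_norm (normr_ge0 v)) -(sqrtr_sqr `|v|) -sqrtrM//.
rewrite ler_wsqrtr// (@le_trans _ _ (\sum_(i < d) `|v| ^+ 2))//.
  apply: ler_sum => i _; rewrite -[leLHS]real_normK ?num_real//.
  by apply: lerXn2r; rewrite ?nnegrE//; exact: coord_norm_le.
by rewrite sumr_const card_ord mulr_natl.
Qed.

Context (rho : R -> R) (rho_cvg : rho e @[e --> 0^'+] --> 0^'+).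

Definition gcurve_of P (X : gen rho R) : gen rho 'rV[R]_d :=
  gclass rho (fun e => poly_curve P (rep X e)).

Let near12 (t : R -> R) : moderate rho t -> gunit_itv (gclass rho t) ->
  \forall e \near 0^'+, -1 <= t e <= 2.
Proof.
move=> mt gt; have := gunit_itv_near rho_cvg mt gt ltr01.
by apply: filterS => e /andP[? ?]; lra.
Qed.

(** A polynomial is Lipschitz on [-1, 2], so negligible changes of the parameter change its value
    negligibly. *)
Lemma gcurve_of_represents P (t : R -> R) : moderate rho t ->
  gunit_itv (gclass rho t) ->
  represents (fun e => poly_curve P (t e)) (gcurve_of P (gclass rho t)).
Proof.
move=> mt gt.
have [C _ CP] := poly_curve_bounded P; have [K _ KP] := poly_curve_lipschitz P.
have [mr rr] := rep_represents (gclass rho t).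
have bd x : moderate rho x -> gunit_itv (gclass rho x) ->
    moderate rho (fun e => poly_curve P (x e)).
  move=> mx gx; apply: (@bounded_moderate _ _ rho_cvg _ _ C).
  by apply: filterS (near12 mx gx) => e; exact: CP.
have gr : gunit_itv (gclass rho (rep (gclass rho t))) by rewrite rr.
split; first exact: bd.
apply/gclass_eqP; [exact: bd|exact: bd|].
apply: (lipschitz_negligible KP); [exact: near12|exact: near12|].
exact: represents_negligible (represents_gclass mt) (conj mr rr).
Qed.

Lemma gcurve_of_defines P :
  defines basisR (gunit_itv (rho := rho)) (gcurve_of P) (fun=> setT) (fun=> poly_curve P).
Proof.
split=> [e _|X _ x _|t mt gt].
- split; first exact: openT.
  move=> s t _; rewrite partial_poly_curve; apply/derivable1_diffP.
  exact: (@ex_derive _ _ _ _ _ _ _ (is_derive_poly_curve _ t)).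
- exact: nearW.
- split; first exact: gcurve_of_represents.
  move=> s; rewrite partial_poly_curve.
  by have [] := gcurve_of_represents (iter (size s) dpoly P) mt gt.
Qed.

(** The speed has a positive minimum on the real interval. Continuity preserves a fixed fraction of
    it at parameters slightly outside and under a change of representative; a net bounded away from
    0 and from infinity is invertible. *)
Lemma gcurve_of_gcurves P : (0 < d)%N ->
  (forall t, 0 <= t <= 1 -> poly_curve (dpoly P) t != 0) ->
  gcurves (poly_curve P 0) (poly_curve P 1) (gcurve_of P).
Proof.
move=> d0 reg.
have gcst (a : R) : 0 <= a <= 1 ->
    gcurve_of P (gconst rho a) = gconst rho (poly_curve P a).
  move=> a01; have [_ <- //] := gcurve_of_represents P (moderate_cst rho_cvg a) (gunit_itv_cst rho_cvg a01).
split.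
- split=> //; exists (fun=> setT), (fun=> poly_curve P); exact: gcurve_of_defines.
- by apply: gcst; rewrite lexx ler01.
- by apply: gcst; rewrite lexx ler01.
exists (gcurve_of (dpoly P)).
  exists (fun=> setT), (fun=> poly_curve P); split; first exact: gcurve_of_defines.
  move=> t mt gt; rewrite (_ : (fun e => _) = fun e => poly_curve (dpoly P) (t e)).
    exact: gcurve_of_represents.
  apply/funext => e.
  exact: (@derive_val _ _ _ _ _ _ _ (is_derive_poly_curve _ (t e))).
move=> X gX; have [mt tX] := rep_represents X; set t := rep X in mt tX.
have gt : gunit_itv (gclass rho t) by rewrite tX.
have := gcurve_of_represents (dpoly P) mt gt; rewrite tX.
set D := gcurve_of (dpoly P) X => rD; have [mv rv] := rep_represents D.
set v := rep D in mv rv; pose n e := enorm (v e).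
have [m m0 mP] : exists2 m, 0 < m & forall t, 0 <= t <= 1 -> m <= `|poly_curve (dpoly P) t|.
  have cP : {within `[0, 1], continuous (fun t => `|poly_curve (dpoly P) t|)}.
    apply: continuous_subspaceT => s; apply: continuous_comp.
      exact: continuous_poly_curve.
    exact: norm_continuous.
  have [|c] := EVT_min _ cP; first by lra.
  rewrite in_itv/= => c01 cmin; exists `|poly_curve (dpoly P) c|.
    by rewrite normr_gt0 reg.
  by move=> s s01; apply: cmin; rewrite in_itv.
have [C C0 CP] := poly_curve_bounded (dpoly P).
have [K K0 KP] := poly_curve_lipschitz (dpoly P).
have m4 : 0 < m / 4 by rewrite divr_gt0.
(* Within this margin of [0, 1] the velocity changes by at most m / 4. As much is granted to the
   change of representative, and m / 2 remains. *)
have del0 : 0 < m / 4 / (K + 1) by rewrite divr_gt0// ltr_wpDl.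
have vn := represents_negligible (conj mv rv) rD.
have near_t := gunit_itv_near rho_cvg mt gt del0.
have near_v := negligible_small rho_cvg vn m4.
have t12 := near12 mt gt.
have v_ge : \forall e \near 0^'+, m / 2 <= `|v e|.
  apply: filterS2 (filterI near_t t12) near_v => e [te te12] ve.
  pose c := clamp (t e).
  have c01 : 0 <= c <= 1 by exact: clamp_itv.
  have tc : `|t e - c| <= m / 4 / (K + 1).
    rewrite ler_norml /c; case: (clampP (t e)) => -[-> ?]; lra.
  have : `|poly_curve (dpoly P) (t e) - poly_curve (dpoly P) c| <= m / 4.
    rewrite (le_trans (KP _ _ te12 _))//; first by move: c01; lra.
    rewrite (le_trans (ler_wpM2l K0 tc))//.
    have -> : K * (m / 4 / (K + 1)) = m / 4 * (K / (K + 1)) by ring.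
    by rewrite ler_piMr ?(ltW m4)// ler_pdivrMr ?ltr_wpDl// mul1r lerDl.
  have := mP _ c01; set a := poly_curve _ c; set b' := poly_curve _ (t e) in ve *.
  have h1 := ler_normD (a - b') (b' - v e); have h2 := ler_normD (a - v e) (v e).
  rewrite !subrK in h1 h2; rewrite distrC in ve; rewrite distrC => h3 h4.
  have h5 : a - b' + (b' - v e) = a - v e by rewrite addrA subrK.
  by rewrite h5 in h1; lra.
have n_ge : \forall e \near 0^'+, m / 2 <= n e.
  by apply: filterS v_ge => e /le_trans; apply; exact: enorm_ge.
have n_le : \forall e \near 0^'+, `|n e| <= Num.sqrt d%:R * (C + m).
  apply: filterS2 t12 near_v => e te ve; rewrite ger0_norm ?sqrtr_ge0//.
  rewrite (le_trans (enorm_le _))// ler_wpM2l ?sqrtr_ge0//.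
  rewrite -[v e](subrK (poly_curve (dpoly P) (t e))) (le_trans (ler_normD _ _))//.
  by rewrite addrC lerD ?CP// (le_trans ve)// ler_pdivrMr// ler_pMr// ler1n.
have mn := bounded_moderate rho_cvg n_le.
have gabsE : gsub (gabs D) (gconst rho 0) = gclass rho n.
  exact: (gsub0_gclass rho_cvg n_le).
rewrite /glt gabsE; split.
  exists (fun=> 0), n; split=> //; last by move=> e _; exact: sqrtr_ge0.
  exact/represents_gclass/moderate_cst.
(* One constant that bounds both the speed net and its inverse, as [gmul_gclass] demands. *)
pose B := Num.sqrt d%:R * (C + m) + (m / 2)^-1.
exists (gclass rho (fun e => (n e)^-1)); rewrite (@gmul_gclass _ _ rho_cvg _ _ B).
- apply/gclass_eqP.
  + apply: (@bounded_moderate _ _ rho_cvg _ _ 1); apply: filterS n_ge => e ne.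
    by rewrite divff ?normr1// gt_eqF// (lt_le_trans _ ne)// divr_gt0.
  + exact: moderate_cst.
  + move=> N N0; exists 0; apply: filterS n_ge => e ne.
    by rewrite divff ?subrr ?normr0 ?mul0r// gt_eqF// (lt_le_trans _ ne)// divr_gt0.
- by apply: filterS n_le => e /le_trans; apply; rewrite /B lerDl invr_ge0 divr_ge0// ltW.
- apply: filterS n_ge => e ne; rewrite /B.
  have n0 : 0 < n e by rewrite (lt_le_trans _ ne)// divr_gt0.
  have h : (n e)^-1 <= (m / 2)^-1 by rewrite lef_pV2// posrE divr_gt0.
  have h2 : 0 <= Num.sqrt d%:R * (C + m) by rewrite mulr_ge0 ?sqrtr_ge0// addr_ge0// ltW.
  by rewrite gtr0_norm ?invr_gt0//; lra.
Qed.

End polynomial_curves.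

(** * Integrals of continuous functions over the unit interval *)

Section unit_integral.
Context {R : realType}.
Local Notation mu := (@lebesgue_measure R).
Implicit Types (f h : R -> R).

Lemma measurable_unit : measurable (`[0, 1]%classic : set (measurableTypeR R)).
Proof. exact: measurable_itv. Qed.

Lemma unit_integral_le f h : continuous f -> continuous h ->
  (forall t, 0 <= t <= 1 -> f t <= h t) ->
  \int[mu]_(t in `[0, 1]) f t <= \int[mu]_(t in `[0, 1]) h t.
Proof.
move=> cf ch fh; apply: le_Rintegral; [exact: measurable_unit| | |].
- exact: continuous_integrable.
- exact: continuous_integrable.
- by move=> t; rewrite /= in_itv/=; exact: fh.
Qed.

Lemma unit_integralD f h : continuous f -> continuous h ->
  \int[mu]_(t in `[0, 1]) (f t + h t) =
  \int[mu]_(t in `[0, 1]) f t + \int[mu]_(t in `[0, 1]) h t.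
Proof.
move=> cf ch; apply: RintegralD; first exact: measurable_unit.
- exact: continuous_integrable.
- exact: continuous_integrable.
Qed.

Lemma unit_integralZ f (k : R) : continuous f ->
  \int[mu]_(t in `[0, 1]) (k * f t) = k * \int[mu]_(t in `[0, 1]) f t.
Proof.
move=> cf; apply: RintegralZl; first exact: measurable_unit.
exact: continuous_integrable.
Qed.

Lemma unit_integral_cst (k : R) : \int[mu]_(t in `[0, 1]) k = k.
Proof.
have ck : continuous (fun _ : R => k) by move=> x; exact: cvg_cst.
have dk (t : R) : is_derive t 1 (fun t => k * t) k.
  by have := isdZ k (isd_id t); rewrite mulr1.
by rewrite (Rintegral_derive ck dk) mulr1 mulr0 subr0.
Qed.

End unit_integral.

(** * The standard part of the minimal length against regular polynomial curves *)

Section minimal.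
Context {R : realType} {d : nat} (rho : R -> R).
Context (rho_cvg : rho e @[e --> 0^'+] --> 0^'+).
Local Notation mu := (@lebesgue_measure R).

Lemma sqrtr_leD (a b eta : R) : 0 <= b -> 0 <= eta ->
  a <= b + eta ^+ 2 -> Num.sqrt a <= Num.sqrt b + eta.
Proof.
move=> b0 eta0 ab.
have s0 : 0 <= Num.sqrt b + eta by rewrite addr_ge0// sqrtr_ge0.
rewrite -(ger0_norm s0) -sqrtr_sqr ler_wsqrtr// (le_trans ab)// sqrrD sqr_sqrtr//.
by rewrite lerD2r lerDl mulrn_wge0// mulr_ge0// sqrtr_ge0.
Qed.

Lemma family_compact_near (g : 'rV[R]_d -> 'M[R]_d) (ge : R -> 'rV[R]_d -> 'M[R]_d)
    (K : set 'rV[R]_d) (eta : R) :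
  {family compact, ge e @[e --> 0^'+] --> g} -> compact K -> 0 < eta ->
  \forall e \near 0^'+, forall x, K x -> forall i j, `|ge e x i j - g x i j| <= eta.
Proof.
move=> gc cK eta0.
have /fam_cvgP/(_ K cK) := gc.
move=> h.
pose B : set ('rV[R]_d -> 'M[R]_d) := [set h | forall x, K x -> ball (g x) eta (h x)].
have : nbhs (g : {uniform` K -> 'M[R]_d}) B.
  apply/uniform_nbhs; exists [set xy | ball xy.1 eta xy.2]; split => //.
  exact: (entourage_ball _ (PosNum eta0)).
move=> /h /=; rewrite nbhs_simpl/=; apply: filterS => e eB x Kx i j.
have := eB x Kx; rewrite /ball/= /mx_ball => -[_ /(_ i j)].
by rewrite /ball/= distrC => /ltW.
Qed.

(** The square root is not Lipschitz at 0, so an error [del] in the speed is bought with an error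
    del^2 in its square. Uniform convergence of the metrics on the compact image of [C] provides the
    latter. *)
Lemma riem_length_near (g : 'rV[R]_d -> 'M[R]_d) (ge : R -> 'rV[R]_d -> 'M[R]_d)
    (C V : R -> 'rV[R]_d) (del : R) :
  riemannian g -> (forall i j, continuous (fun x => g x i j)) ->
  (forall e, I0 e -> forall i j, continuous (fun x => ge e x i j)) ->
  {family compact, ge e @[e --> 0^'+] --> g} ->
  (forall t : R, is_derive t 1 C (V t)) -> continuous V -> 0 < del ->
  \forall e \near 0^'+, riem_length (ge e) C <= riem_length g C + del.
Proof.
move=> rg cg cge gcvg dC cV del0.
have cC : continuous C.
  by apply/continuous_rV => i t; have /is_derive_rV/(_ i) := dC t; exact: isd_cont.
have cK : compact (C @` `[0, 1]%classic).
  apply: continuous_compact; first exact: continuous_subspaceT.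
  exact: segment_compact.
have [M M0 HM] : exists2 M, 0 <= M & forall t, 0 <= t <= 1 -> `|V t| <= M.
  have cN : {within `[0, 1], continuous (fun t => `|V t|)}.
    apply: continuous_subspaceT => t; apply: continuous_comp; first exact: cV.
    exact: norm_continuous.
  have [|c _ cmax] := EVT_max _ cN; first by lra.
  by exists `|V c| => // t t01; apply: cmax; rewrite in_itv.
(* The squared speeds differ by at most eta d^2 M^2, which is below eta Q = del^2; the summand 1
   keeps [Q] positive. *)
pose Q := (d ^ 2)%:R * (M * M) + 1.
have Q0 : 0 < Q by rewrite /Q ltr_wpDl// mulr_ge0// mulr_ge0.
pose eta := del ^+ 2 / Q; have eta0 : 0 < eta by rewrite divr_gt0// exprn_gt0.
apply: filterS2 near_I0 (family_compact_near gcvg cK eta0) => e Ie eK.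
have dC' (t : R) : 0 <= t <= 1 -> is_derive t (1 : R) C (V t) by move=> _.
rewrite !(fun G => riem_length_eq G (fun t _ => erefl (C t)) dC').
have [_ c1] := speed_continuous (cge _ Ie) cC cV.
have [_ c2] := speed_continuous cg cC cV.
have ck : continuous (fun _ : R => del) by move=> x; exact: cvg_cst.
rewrite -[X in _ <= _ + X]unit_integral_cst -unit_integralD//.
apply: unit_integral_le => //; first by move=> t; apply: cvgD; [exact: c2|exact: ck].
move=> t t01; apply: sqrtr_leD; [exact: quadratic_ge0|exact: ltW|].
rewrite -lerBlDl.
have -> : quadratic (ge e (C t)) (V t) - quadratic (g (C t)) (V t) =
    quadratic (ge e (C t) - g (C t)) (V t).
  rewrite /quadratic -sumrB; apply: eq_bigr => i _; rewrite -sumrB.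
  by apply: eq_bigr => j _; rewrite !mxE !mulrBl.
rewrite (le_trans (ler_norm _))// (le_trans (@quadratic_le _ _ _ _ eta M _ _))//.
- move=> i j; rewrite !mxE; apply: eK; exists t => //=.
- by move=> i; rewrite (le_trans (coord_norm_le _ _))// HM.
have -> : del ^+ 2 = eta * Q by rewrite /eta divfK// gt_eqF.
have -> : (d ^ 2)%:R * (eta * M * M) = eta * ((d ^ 2)%:R * (M * M)) by ring.
by rewrite /Q mulrDr mulr1 lerDl ltW.
Qed.

Lemma minimal_le_poly_curve (g : 'rV[R]_d -> 'M[R]_d) (ge : R -> 'rV[R]_d -> 'M[R]_d)
    (L : gen rho R) (s : R) (P : 'I_d -> {poly R}) :
  (0 < d)%N -> riemannian g -> (forall i j, continuous (fun x => g x i j)) ->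
  (forall e, I0 e -> forall i j, continuous (fun x => ge e x i j)) ->
  {family compact, ge e @[e --> 0^'+] --> g} ->
  gminimal ge (poly_curve P 0) (poly_curve P 1) L -> is_st L s ->
  (forall t, 0 <= t <= 1 -> poly_curve (dpoly P) t != 0) ->
  s <= riem_length g (poly_curve P).
Proof.
move=> d0 rg cg cge gcvg Lmin [x rx xs] reg.
pose S := poly_curve P; pose l := riem_length g S.
have near_le del : 0 < del -> \forall e \near 0^'+, riem_length (ge e) S <= l + del.
  move=> del0; apply: riem_length_near => //.
  - exact: is_derive_poly_curve.
  - exact: continuous_poly_curve.
have mL : moderate rho (fun e => riem_length (ge e) S).
  apply: (@bounded_moderate _ _ rho_cvg _ _ (l + 1)).
  apply: filterS (near_le _ ltr01) => e; rewrite ger0_norm//.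
  by apply: Rintegral_ge0 => t _; exact: sqrtr_ge0.
have [||x' [y' [rx' ry' xy]]] := Lmin (gcurve_of P) _ (gclass rho (fun e => riem_length (ge e) S)).
- exact: gcurve_of_gcurves.
- by exists (fun=> setT), (fun=> S); split; [exact: gcurve_of_defines|].
apply/ler_addgt0Pr => del del0.
(* One quarter each for the limit s, the two changes of representative and the convergence of the
   metrics. *)
have d4 : 0 < del / 4 by rewrite divr_gt0.
have nx := negligible_small rho_cvg (represents_negligible rx rx') d4.
have ny := negligible_small rho_cvg (represents_negligible ry' (represents_gclass mL)) d4.
have ns : \forall e \near 0^'+, `|s - x e| <= del / 4.
  by have /cvgrPdist_le := xs; apply.
have nl := near_le _ d4.
near (0 : R)^'+ => e.
have Ie : I0 e by near: e; exact: near_I0.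
have := xy _ Ie.
have : `|x e - x' e| <= del / 4 by near: e.
have : `|y' e - riem_length (ge e) S| <= del / 4 by near: e.
have : `|s - x e| <= del / 4 by near: e.
have : riem_length (ge e) S <= l + del / 4 by near: e.
rewrite !ler_norml => ? /andP[? ?] /andP[? ?] /andP[? ?] ?.
by rewrite -/S -/l; lra.
Unshelve. all: by end_near. Qed.

End minimal.

(** * Lipschitz curves as limits of regular polynomial curves *)

Section approximation.
Context {R : realType} {d : nat}.
Local Notation I01 := (`[0, 1]%classic : set R).
Local Notation mu := (@lebesgue_measure R).
Implicit Types (c : R -> 'rV[R]_d).

Lemma lipschitz_const c : [lipschitz c t | t in `[0, 1]] ->
  exists2 K, 0 < K & forall s t, 0 <= s <= 1 -> 0 <= t <= 1 ->
    `|c s - c t| <= K * `|s - t|.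
Proof.
move=> [M [_ cM]]; pose K := Num.max M 0 + 1.
have MK : M < K by rewrite /K ltr_pwDr// le_max lexx.
exists K; first by rewrite /K ltr_pwDr// le_max lexx orbT.
move=> s t s01 t01; have := cM K MK (s, t); apply.
by split; rewrite /= in_itv.
Qed.

(** Clamping makes f Lipschitz on the whole line, and division by K reduces its constant to 1. *)
Lemma ae_derivable_clamp (f : R -> R) (K : R) : 0 < K ->
  (forall s t, 0 <= s <= 1 -> 0 <= t <= 1 -> `|f s - f t| <= K * `|s - t|) ->
  {ae mu, forall t, 0 < t < 1 -> derivable (f \o clamp) t 1}.
Proof.
move=> K0 fK.
have := @ae_derivable_1lipschitz _ (fun t => K^-1 * f (clamp t)).
move=> /(_ _)/wrap[x y|].
  rewrite -mulrBr normrM gtr0_norm ?invr_gt0// ler_pdivrMl//.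
  rewrite (le_trans (fK _ _ (clamp_itv _) (clamp_itv _)))// ler_wpM2l ?(ltW K0)//.
  exact: clamp_lipschitz.
apply: filterS; first exact: (ae_filter_ringOfSetsType mu).
move=> t /[apply] /derivableP dt.
have -> : f \o clamp = fun t => K * (K^-1 * f (clamp t)).
  by apply/funext => u /=; rewrite mulrA divff ?mul1r// gt_eqF.
by case: (isdZ K dt).
Qed.

(* The curve is approximated by its Bernstein polynomials, whose derivatives
   converge wherever the curve is derivable; the perturbations E leave room to
   make the approximating curves regular. *)
Lemma cvg_length_bernstein (g : 'rV[R]_d -> 'M[R]_d) c (E : nat -> 'I_d -> {poly R}) :
  riemannian g -> (forall i j, continuous (fun x => g x i j)) ->
  [lipschitz c t | t in `[0, 1]] ->
  (forall n i t, 0 <= t <= 1 ->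
    `|(E n i).[t]| <= n.+1%:R^-1 /\ `|(E n i)^`().[t]| <= n.+1%:R^-1) ->
  riem_length g (poly_curve (fun i => bernstein_of (fun t => c (clamp t) 0 i) n + E n i))
    @[n --> \oo] --> riem_length g c.
Proof.
move=> rg cg /lipschitz_const[K K0 cK] EE.
pose f i t := c (clamp t) 0 i.
have fK i s t : 0 <= s <= 1 -> 0 <= t <= 1 -> `|f i s - f i t| <= K * `|s - t|.
  move=> s01 t01; rewrite /f !clamp_id//; apply: le_trans (cK _ _ s01 t01).
  by have := coord_norm_le (c s - c t) i; rewrite !mxE.
pose P n i := bernstein_of (f i) n + E n i.
have n1 n : n.+1%:R^-1 <= 1 :> R by rewrite invf_le1 ?ler1n ?ltr0n.
have hE : (n.+1%:R^-1 : R) @[n --> \oo] --> 0 by exact: cvg_harmonic.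
have small (u : nat -> R) : (forall n, `|u n| <= n.+1%:R^-1) -> u n @[n --> \oo] --> 0.
  move=> uh; apply/cvgrPdist_le => e e0.
  have /cvgrPdist_le/(_ _ e0) := hE; apply: filterS => n.
  rewrite !sub0r !normrN => en; rewrite (le_trans (uh n))// (le_trans _ en)//.
  exact: ler_norm.
(* The points are bounded by |c 0| + K and the velocities by K, with 1 to spare for the
   perturbation. *)
apply: (@cvg_riem_length _ _ _ _ (`|c 0| + K + 1) (fun n => poly_curve (P n))
  (fun n => poly_curve (dpoly (P n)))) => //.
- by move=> n t; exact: is_derive_poly_curve.
- by move=> n; exact: continuous_poly_curve.
- move=> n t t01; have [t0 t1] := andP t01.
  have c0 := normr_ge0 (c 0).
  have nn : 0 <= `|c 0| + K + 1 by rewrite !addr_ge0// ltW.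
  split; apply: rV_norm_le => // i; rewrite mxE.
    rewrite hornerD (le_trans (ler_normD _ _))// lerD//; last first.
      by rewrite (le_trans (EE n i t t01).1).
    rewrite -[leRHS](bernstein_cst n.+1 t); apply: bernstein_norm_le => // k kn.
    have k01 : 0 <= (k%:R / n.+1%:R : R) <= 1.
      by rewrite divr_ge0//= ler_pdivrMr ?ltr0n// mul1r ler_nat.
    rewrite -(subrK (f i 0) (f i _)) (le_trans (ler_normD _ _))// addrC lerD//.
      by rewrite /f clamp_id ?lexx ?ler01// coord_norm_le.
    rewrite (le_trans (fK _ _ _ k01 _)) ?lexx ?ler01// subr0.
    rewrite ler_piMr ?(ltW K0)// ger0_norm; first by case/andP: k01.
    by case/andP: k01.
  rewrite /dpoly derivD hornerD (le_trans (ler_normD _ _))// lerD//; last first.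
    by rewrite (le_trans (EE n i t t01).2).
  rewrite (le_trans (bernstein_of_deriv_le (fK i) _ t01))// lerDr//.
(* The derivatives of Bernstein polynomials are controlled only at interior points; the end points
   form a null set. *)
have ae0 : {ae mu, forall t : R, t != 0 /\ t != 1}.
  exists ([set 0] `|` [set 1]); split.
  - by apply: measurableU; exact: measurable_set1.
  - by apply: null_set_setU; first [exact: measurable_set1|exact: lebesgue_measure_set1].
  - move=> t /= /not_andP[] /negP; rewrite negbK => /eqP ->; [by left|by right].
have aeD : {ae mu, forall t, forall i, 0 < t < 1 -> derivable (f i) t 1}.
  apply: (@filter_forall _ _ _ _ (ae_filter_ringOfSetsType mu)) => i.
  apply: (@ae_derivable_clamp (fun t => c t 0 i) K K0) => s t s01 t01.
  apply: le_trans (cK _ _ s01 t01).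
  by have := coord_norm_le (c s - c t) i; rewrite !mxE.
move: ae0 aeD; apply: filterS2; first exact: (ae_filter_ringOfSetsType mu).
move=> t [tn0 tn1] dt t01.
have t01' : 0 < t < 1.
  by case/andP: t01 => t0 t1; rewrite lt_def tn0 t0 lt_def eq_sym tn1.
have dC : is_derive t 1 (fun s => c (clamp s)) (\row_i 'D_1 (f i) t).
  by apply/is_derive_rV => i; rewrite mxE; exact/derivableP/dt.
have cC : {in I01, c =1 (fun s => c (clamp s))}.
  by move=> s /set_mem; rewrite /= in_itv/= => s01; rewrite clamp_id.
have [velE _] := velocity_eq_on cC t01.
have [_ vel] := velocity_is_derive t01 dC.
rewrite velE vel; split=> i.
  have -> : c t 0 i = f i t + 0 by rewrite /f clamp_id// addr0.
  under eq_fun do rewrite mxE hornerD.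
  apply: cvgD; first exact: (bernstein_of_cvg (fK i)).
  by apply: small => n; exact: (EE n i t t01).1.
rewrite mxE -[X in _ --> X]addr0.
under eq_fun do rewrite mxE /dpoly derivD hornerD.
apply: cvgD; last by apply: small => n; exact: (EE n i t t01).2.
by apply: (bernstein_of_deriv_cvg (fK i)) => //; exact/derivableP/dt.
Qed.

End approximation.

Section perturbation.
Context {R : realType}.

(* b is chosen so that the second polynomial does not vanish at 1/2, hence has
   finitely many roots t <> 1/2; each of them excludes a single value of a. *)
Lemma avoid_common_roots (p1 p2 : {poly R}) (del : R) : 0 < del ->
  exists a b, [/\ `|a| <= del, `|b| <= del & forall t,
    p1.[t] + a * (1 - 2 * t) != 0 \/ p2.[t] + b * (1 - 6 * t + 6 * t ^+ 2) != 0].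
Proof.
move=> del0; have del2 : 0 < del / 2 by rewrite divr_gt0.
have [b [bdel bP]] : exists b, `|b| <= del /\ p2.[2^-1] + b * (1 - 6 * 2^-1 + 6 * 2^-1 ^+ 2) != 0.
  (* At 1/2 the factor of b is -1/2, so the choices del and del / 2 cannot both give 0. *)
  have [h|h] := eqVneq (p2.[2^-1] + del * (1 - 6 * 2^-1 + 6 * 2^-1 ^+ 2)) 0.
    exists (del / 2); split; first by rewrite gtr0_norm// ler_pdivrMr// ler_pMr// ler1n.
    apply/eqP => h'; move/eqP: (congr2 (fun x y => x - y) h h').
    rewrite subrr (_ : _ - _ = - del / 4); last by field.
    by rewrite mulf_eq0 invr_eq0 oppr_eq0 gt_eqF// pnatr_eq0.
  by exists del; rewrite gtr0_norm.
pose r := p2 + b%:P * (1%:P - 6%:P * 'X + 6%:P * 'X ^+ 2).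
have rE t : r.[t] = p2.[t] + b * (1 - 6 * t + 6 * t ^+ 2).
  by rewrite /r !(hornerD, hornerN, hornerM, hornerC, hornerX, horner_exp).
have r0 : r != 0 by apply/eqP => r0; move: bP; rewrite -rE r0 horner0 eqxx.
have [[k kP]|none] := pselect (exists k : nat, forall t, r.[t] = 0 ->
    p1.[t] + del / k.+1%:R * (1 - 2 * t) != 0).
  exists (del / k.+1%:R), b; split=> // [|t].
    rewrite ger0_norm ?divr_ge0 ?(ltW del0)// ler_pdivrMr ?ltr0n//.
    by rewrite ler_pMr// ler1n.
  by rewrite -rE; have [/kP|] := eqVneq r.[t] 0; [left|right].
(* If every candidate del / (k + 1) for a fails at some root of [r], different k fail at different
   roots because 1 - 2 t is nonzero there. Then [r] would have at least as many roots as its size,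
   which is one more than its degree. *)
have /choice[u uP] : forall k : nat, exists t, r.[t] = 0 /\
    p1.[t] + del / k.+1%:R * (1 - 2 * t) = 0.
  move=> k; apply: contrapT => nk; apply: none; exists k => t rt.
  by apply/eqP => h; apply: nk; exists t.
have inj : injective u.
  move=> k l kl; have [rk pk] := uP k; have [rl pl] := uP l; rewrite kl in pk rk.
  have ul : 1 - 2 * u l != 0.
    apply/eqP => h; have ul2 : u l = 2^-1 by lra.
    by move: bP; rewrite -rE -ul2 rl eqxx.
  have /(mulIf ul) : del / k.+1%:R * (1 - 2 * u l) = del / l.+1%:R * (1 - 2 * u l).
    by apply: (addrI p1.[u l]); rewrite pk pl.
  move=> /(mulfI (lt0r_neq0 del0))/invr_inj/eqP.
  by rewrite eqr_nat eqSS => /eqP.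
have := @max_poly_roots _ r [seq u k | k <- iota 0 (size r)] r0.
rewrite size_map size_iota ltnn => /(_ _ _)/wrap[||//].
  by apply/allP => _ /mapP[k _ ->]; apply/rootP; case: (uP k).
by rewrite map_inj_uniq ?iota_uniq.
Qed.

End perturbation.

(** * Regular polynomial approximation in dimension at least two *)

Section minimizing.
Context {R : realType}.
Local Notation mu := (@lebesgue_measure R).
Local Notation I01 := (`[0, 1]%classic : set R).

(** Two perturbed coordinates suffice, since the velocity is nonzero as soon as one of their
    derivatives is; the dimension [d.+2] supplies them. Perturbations of size 1 / (n + 1) disappear
    in the limit of the lengths. *)
Lemma regular_approximation (d : nat) (g : 'rV[R]_d.+2 -> 'M[R]_d.+2)
    (c : R -> 'rV[R]_d.+2) :
  riemannian g -> (forall i j, continuous (fun x => g x i j)) ->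
  [lipschitz c t | t in `[0, 1]] ->
  exists P : nat -> 'I_d.+2 -> {poly R},
    [/\ riem_length g (poly_curve (P n)) @[n --> \oo] --> riem_length g c,
        forall n, poly_curve (P n) 0 = c 0, forall n, poly_curve (P n) 1 = c 1 &
        forall n t, poly_curve (dpoly (P n)) t != 0].
Proof.
move=> rg cg cL.
pose i0 : 'I_d.+2 := ord0; pose i1 : 'I_d.+2 := lift ord0 ord0.
pose f n i := bernstein_of (fun t => c (clamp t) 0 i) n.
have h0 n : 0 < n.+1%:R^-1 :> R by rewrite invr_gt0 ltr0n.
have /choice[ab abP] : forall n : nat, exists ab : R * R,
    [/\ `|ab.1| <= n.+1%:R^-1, `|ab.2| <= n.+1%:R^-1 & forall t,
    (f n i0)^`().[t] + ab.1 * (1 - 2 * t) != 0 \/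
    (f n i1)^`().[t] + ab.2 * (1 - 6 * t + 6 * t ^+ 2) != 0].
  move=> n; have [a [b h]] := avoid_common_roots (f n i0)^`() (f n i1)^`() (h0 n).
  by exists (a, b).
pose hE := (hornerD, hornerN, hornerM, hornerC, hornerX).
(* [H1] and [H2] vanish at 0 and 1, which preserves the end points. Their derivatives have no common
   zero, which is why [avoid_common_roots] uses precisely these two. *)
have [H1 [H1E H1'E]] : exists H1 : {poly R}, (forall t, H1.[t] = t * (1 - t)) /\
    (forall t, H1^`().[t] = 1 - 2 * t).
  exists ('X * (1%:P - 'X)); split=> t; first by rewrite !hE.
  by rewrite derivM derivB derivX derivC !hE; ring.
have [H2 [H2E H2'E]] : exists H2 : {poly R},
    (forall t, H2.[t] = t * (1 - t) * (1 - 2 * t)) /\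
    (forall t, H2^`().[t] = 1 - 6 * t + 6 * t ^+ 2).
  exists ('X * (1%:P - 'X) * (1%:P - 2%:P * 'X)); split=> t; first by rewrite !hE.
  by rewrite !derivM !derivB !derivM derivX !derivC !hE; ring.
pose E n i : {poly R} := if i == i0 then (ab n).1%:P * H1 else
  if i == i1 then (ab n).2%:P * H2 else 0.
exists (fun n i => f n i + E n i); split.
- apply: cvg_length_bernstein => // n i t /andP[t0 t1].
  have [a1 b1 _] := abP n; have hn := ltW (h0 n).
  have le1 (x y : R) : `|x| <= n.+1%:R^-1 -> `|y| <= 1 -> `|x * y| <= n.+1%:R^-1.
    by move=> x1 y1; rewrite normrM -[leRHS]mulr1 ler_pM.
  have q1 : `|t * (1 - t)| <= 1 by rewrite ler_norml; apply/andP; split; nra.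
  have q2 : `|1 - 2 * t| <= 1 by rewrite ler_norml; apply/andP; split; lra.
  rewrite /E; case: eqP => _; last case: eqP => _.
  + by rewrite derivM derivC !hE H1E H1'E mul0r add0r; split; apply: le1.
  + rewrite derivM derivC !hE H2E H2'E mul0r add0r; split; apply: le1 => //.
      by rewrite normrM -[leRHS]mulr1 ler_pM.
    by rewrite ler_norml; apply/andP; split; nra.
  + by rewrite deriv0 !horner0 normr0.
- move=> n; apply/rowP => i; rewrite mxE hornerD bernstein_of0 clamp_id ?lexx ?ler01//.
  rewrite /E; case: eqP => _; last case: eqP => _.
  + by rewrite hornerM hornerC H1E !mul0r mulr0 addr0.
  + by rewrite hornerM hornerC H2E !mul0r mulr0 addr0.
  + by rewrite horner0 addr0.
- move=> n; apply/rowP => i; rewrite mxE hornerD bernstein_of1 clamp_id ?lexx ?ler01//.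
  rewrite /E; case: eqP => _; last case: eqP => _.
  + by rewrite hornerM hornerC H1E subrr !mulr0 addr0.
  + by rewrite hornerM hornerC H2E subrr !mulr0 mul0r mulr0 addr0.
  + by rewrite horner0 addr0.
- move=> n t; have [_ _ /(_ t) reg] := abP n; apply/eqP => /rowP v0.
  have E0 : (E n i0)^`().[t] = (ab n).1 * (1 - 2 * t).
    by rewrite /E eqxx derivM derivC mul0r add0r hornerM hornerC H1'E.
  have E1 : (E n i1)^`().[t] = (ab n).2 * (1 - 6 * t + 6 * t ^+ 2).
    by rewrite /E /= derivM derivC mul0r add0r hornerM hornerC H2'E.
  have v i : (f n i)^`().[t] + (E n i)^`().[t] = 0.
    by rewrite -hornerD -derivD; have := v0 i; rewrite !mxE.
  by case: reg => /eqP; apply; rewrite -?E0 -?E1 v.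
Qed.

End minimizing.

(** * Minimality *)

Section one_dimensional.
Context {R : realType}.
Local Notation mu := (@lebesgue_measure R).

Lemma sign_constant (u : R -> R) : continuous u ->
  (forall t, 0 <= t <= 1 -> u t != 0) ->
  exists e : R, (e = 1 \/ e = -1) /\ forall t, 0 <= t <= 1 -> `|u t| = e * u t.
Proof.
move=> cu u0.
have zero s t : 0 <= s <= 1 -> 0 <= t <= 1 -> u s < 0 -> 0 < u t -> False.
  wlog st : s t u cu u0 / s <= t.
    move=> H s01 t01 us ut; have [st|/ltW ts] := leP s t; first exact: (H s t u).
    apply: (H t s (fun x => - u x)) => //; rewrite ?oppr_lt0 ?oppr_gt0//.
      by move=> x; apply: continuousN; exact: cu.
    by move=> x x01; rewrite oppr_eq0 u0.
  move=> s01 t01 us ut.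
  have [|c] := @IVT _ u s t 0 st (continuous_subspaceT cu).
    by rewrite ge_min le_max (ltW us) (ltW ut) orbT.
  rewrite in_itv/= => /andP[sc ct] uc.
  by have := u0 c; rewrite uc eqxx; apply: contraPP => _ /(_ _)/wrap[|//]; lra.
have [u00|u00] := ltP 0 (u 0).
  exists 1; split; [by left|move=> t t01]; rewrite mul1r ger0_norm//.
  rewrite leNgt; apply/negP => ut; apply: (zero t 0) => //.
  by rewrite lexx ler01.
exists (-1); split; [by right|move=> t t01]; rewrite mulN1r ler0_norm//.
rewrite leNgt; apply/negP => ut; apply: (zero 0 t) => //.
  by rewrite lexx ler01.
by rewrite lt_neqAle u00 u0// lexx ler01.
Qed.

(** The length of a curve C is the integral of the absolute value of (H o C)', where [H] is a
    primitive of sqrt g. Since [U] keeps its sign, the absolute value leaves the integral for W, and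
    only the difference of H at the end points remains; for S, the length is at least that
    difference in absolute value. *)
Lemma one_dim_minimizing (g : 'rV[R]_1 -> 'M[R]_1) (S V W U : R -> 'rV[R]_1) :
  riemannian g -> (forall i j, continuous (fun x => g x i j)) ->
  (forall t : R, is_derive t 1 S (V t)) -> continuous V ->
  (forall t : R, is_derive t 1 W (U t)) -> continuous U ->
  S 0 = W 0 -> S 1 = W 1 -> (forall t, 0 <= t <= 1 -> U t != 0) ->
  riem_length g W <= riem_length g S.
Proof.
move=> rg cg dS cV dW cU S0 S1 U0.
have xE (x : 'rV[R]_1) : x = const_mx (x 0 0).
  by apply/matrixP => i j; rewrite mxE !ord1.
pose h y := Num.sqrt (g (const_mx y) 0 0).
have cc : continuous (fun y : R => const_mx y : 'rV[R]_1).
  apply/continuous_rV => i z; rewrite (_ : (fun _ => _) = id); first exact: cvg_id.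
  by apply/funext => a; rewrite mxE.
have ch : continuous h.
  move=> y; apply: (@continuous_comp _ _ _ _ Num.sqrt); last exact: sqrt_continuous.
  apply: (@continuous_comp _ _ _ (fun y : R => const_mx y : 'rV[R]_1) (fun x => g x 0 0)).
    exact: cc.
  exact: cg.
have speedE x v : Num.sqrt (quadratic (g x) v) = h (x 0 0) * `|v 0 0|.
  have qE u : quadratic (g x) u = g x 0 0 * u 0 0 ^+ 2.
    by rewrite /quadratic !big_ord1 -mulrA -expr2.
  have g0 : 0 <= g x 0 0.
    by have := quadratic_ge0 x (const_mx 1) rg; rewrite qE mxE expr1n mulr1.
  by rewrite qE sqrtrM// sqrtr_sqr /h -xE.
have [H _ dH] := continuous_antiderivative ch.
have curve (C D : R -> 'rV[R]_1) : (forall t : R, is_derive t 1 C (D t)) -> continuous D ->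
    [/\ continuous (fun t => h (C t 0 0) * D t 0 0),
        riem_length g C = \int[mu]_(t in `[0, 1]) (h (C t 0 0) * `|D t 0 0|),
        continuous (fun t => h (C t 0 0) * `|D t 0 0|) &
        \int[mu]_(t in `[0, 1]) (h (C t 0 0) * D t 0 0) = H (C 1 0 0) - H (C 0 0 0)].
  move=> dC cD.
  have dC0 t : is_derive t (1 : R) (fun s => C s 0 0) (D t 0 0).
    by have /is_derive_rV := dC t; exact.
  have cD0 : continuous (fun t => D t 0 0) by exact: (continuous_rV D).1.
  have chC : continuous (fun t => h (C t 0 0)).
    move=> t; apply: (@continuous_comp _ _ _ (fun t => C t 0 0) h); last exact: ch.
    exact: isd_cont (dC0 t).
  have c1 : continuous (fun t => h (C t 0 0) * D t 0 0).
    by move=> t; apply: cvgM; [exact: chC|exact: cD0].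
  have dHC t := isd_comp (dC0 t) (dH (C t 0 0)).
  split=> //.
  - rewrite (riem_length_eq g (fun t _ => erefl (C t)) (fun t _ => dC t)).
    by apply: eq_Rintegral => t _; rewrite speedE.
  - move=> t; apply: cvgM; first exact: chC.
    by apply: (@continuous_comp _ _ _ (fun t => D t 0 0) Num.norm); [exact: cD0|exact: norm_continuous].
  - exact: (Rintegral_derive c1 dHC).
have [cW1 -> cW2 IW] := curve W U dW cU; have [cS1 -> cS2 IS] := curve S V dS cV.
have [|e [e1 eU]] := @sign_constant (fun t => U t 0 0) ((continuous_rV U).1 cU 0).
  move=> t t01; apply: contra (U0 t t01) => /eqP u0; apply/eqP.
  by rewrite (xE (U t)) u0; apply/matrixP => i j; rewrite !mxE.
have -> : \int[mu]_(t in `[0, 1]) (h (W t 0 0) * `|U t 0 0|) =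
    e * \int[mu]_(t in `[0, 1]) (h (S t 0 0) * V t 0 0).
  rewrite IS S0 S1 -IW -unit_integralZ//; apply: eq_Rintegral => t /set_mem.
  by rewrite /= in_itv/= => /eU ->; rewrite mulrCA.
rewrite -unit_integralZ//; apply: unit_integral_le => //.
  by move=> t; apply: cvgM; [exact: cvg_cst|exact: cS1].
move=> t _; rewrite mulrCA ler_wpM2l ?sqrtr_ge0//.
by rewrite (le_trans (ler_norm _))// normrM; case: e1 => ->; rewrite ?normrN normr1 mul1r.
Qed.

End one_dimensional.

(** * Comparison with all Lipschitz curves *)

Section minimizing_theorem.
Context {R : realType} {d : nat} (rho : R -> R).
Context (rho_cvg : rho e @[e --> 0^'+] --> 0^'+).

Lemma minimal_minimizing (g : 'rV[R]_d -> 'M[R]_d) (ge : R -> 'rV[R]_d -> 'M[R]_d)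
    (p q : 'rV[R]_d) (L : gen rho R) (w : R -> 'rV[R]_d) :
  riemannian g -> (forall i j, continuous (fun x => g x i j)) ->
  (forall e, I0 e -> forall i j, continuous (fun x => ge e x i j)) ->
  {family compact, ge e @[e --> 0^'+] --> g} ->
  gminimal ge p q L -> is_st L (riem_length g w) -> C1curves p q w ->
  minimizing g p q w.
Proof.
move=> rg cg cge gcvg Lmin Lst [C1w w0 w1 reg] c cL c0 c1.
have [W [U [dW cU Ww UE]]] := C1_extension C1w.
have U0 t : 0 <= t <= 1 -> U t != 0.
  move=> t01; apply/eqP => Ut0; have := reg t t01.
  rewrite -[t in velocity _ _ t](clamp_id t01) -UE Ut0.
  by rewrite /enorm big1 ?sqrtr0 ?ltxx// => i _; rewrite mxE expr0n.
have t0 : 0 <= (0 : R) <= 1 by rewrite lexx ler01.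
have t1 : 0 <= (1 : R) <= 1 by rewrite lexx ler01.
(* In dimension 0 every velocity vanishes, against regularity of [w]; in dimension 1 regular
   approximation is replaced by a direct comparison. *)
destruct d as [|[|d']].
- have E : U 0 = 0 by apply/rowP; case.
  by case/eqP: (U0 _ t0); exact: E.
(* The direct comparison accepts competitors that stop or turn back, so the Bernstein polynomials
   are used unperturbed. *)
- pose P n i := bernstein_of (fun t => c (clamp t) 0 i) n.
  have := @cvg_length_bernstein _ _ g c (fun _ _ => 0) rg cg cL.
  move=> /(_ _)/wrap[n i t _|]; first by rewrite deriv0 !horner0 normr0.
  move=> cvL; apply: (cvgr_to_ge cvL); apply: nearW => n.
  have EW : riem_length g w = riem_length g W.
    have dW' (t : R) : 0 <= t <= 1 -> is_derive t 1 W (U t) by move=> _.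
    rewrite (riem_length_eq g (fun t _ => erefl (W t)) dW').
    by rewrite (riem_length_eq g (fun t t01 => esym (Ww t t01)) dW').
  rewrite EW; apply: (one_dim_minimizing rg cg _ _ dW cU _ _ U0).
  - by move=> t; exact: is_derive_poly_curve.
  - exact: continuous_poly_curve.
  - rewrite (Ww _ t0) w0 -c0; apply/rowP => i.
    by rewrite mxE addr0 bernstein_of0 (clamp_id t0).
  - rewrite (Ww _ t1) w1 -c1; apply/rowP => i.
    by rewrite mxE addr0 bernstein_of1 (clamp_id t1).
have [P [cvP P0 P1 Preg]] := regular_approximation rg cg cL.
apply: (cvgr_to_ge cvP); apply: nearW => n.
apply: (minimal_le_poly_curve rho_cvg _ rg cg cge gcvg _ Lst) => //.
by rewrite P0 P1 c0 c1.
Qed.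

End minimizing_theorem.

(** * Parametrization with constant speed *)

Section arclength.
Context {R : realType}.
Local Notation mu := (@lebesgue_measure R).
Local Notation I01 := (`[0, 1]%classic : set R).

Lemma C1_on_unit (W : normedModType R) (c v : R -> W) :
  (forall t : R, is_derive t 1 c (v t)) -> continuous v -> C1_on I01 c.
Proof.
move=> dc cv; split=> [t|].
  by rewrite /= in_itv/= => t01; have [] := velocity_is_derive t01 (dc t).
apply/subspace_continuousP => t; rewrite /= in_itv/= => t01.
have vE s : 0 <= s <= 1 -> velocity I01 c s = v s.
  by move=> s01; have [] := velocity_is_derive s01 (dc s).
apply/cvgrPdist_lt => e e0; have /cvgrPdist_lt/(_ _ e0)[r /= r0 rB] := cv t.
exists r => //= s ts; rewrite in_itv/= => s01.
by rewrite /from_subspace (vE t)// (vE s)//; exact: rB.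
Qed.

Lemma derive_ge_increment (F f : R -> R) (m : R) :
  (forall t : R, is_derive t 1 F (f t)) -> (forall t, m <= f t) ->
  forall a b, a <= b -> m * (b - a) <= F b - F a.
Proof.
move=> dF fm a b ab.
have [|c _ ->] := @MVT_segment R F f a b ab (fun x _ => dF x).
  by apply: continuous_subspaceT => x; exact: (isd_cont (dF x)).
by rewrite ler_wpM2r ?subr_ge0.
Qed.

(** A derivative of at least m > 0 on the whole line makes F injective, and F reaches the value y
    within distance |y - F 0| / m of 0. The inverse is thus defined everywhere, free of end-point
    cases. *)
Lemma inverse_derive (F f : R -> R) (m : R) :
  (forall t : R, is_derive t 1 F (f t)) -> 0 < m -> (forall t, m <= f t) ->
  exists G : R -> R, [/\ cancel F G, cancel G F &
    forall y : R, is_derive y 1 G (f (G y))^-1].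
Proof.
move=> dF m0 fm; have inc := derive_ge_increment dF fm.
have cF : continuous F by move=> x; exact: (isd_cont (dF x)).
have inj : injective F.
  move=> a b; wlog ab : a b / a <= b.
    by move=> H; have [/H|/ltW/H h /esym/h] := leP a b.
  move=> Fab; have := inc _ _ ab; rewrite Fab subrr => h.
  by apply/eqP; rewrite eq_le ab/= -subr_le0 -(pmulr_rle0 _ m0).
have /choice[G GP] : forall y, exists x, F x = y.
  move=> y; pose T := `|y - F 0| / m.
  have T0 : 0 <= T by rewrite divr_ge0// ltW.
  have mT : m * T = `|y - F 0| by rewrite /T mulrCA divff ?mulr1// gt_eqF.
  have h1 := inc _ _ T0; have NT0 : - T <= 0 by rewrite oppr_le0.
  have h2 := inc _ _ NT0.
  rewrite subr0 mT in h1; rewrite sub0r opprK mT in h2.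
  have h3 := ler_norm (y - F 0); have h4 := ler_norm (- (y - F 0)).
  rewrite normrN in h4.
  have [|||x _ Fx] := @IVT _ F (- T) T y.
  - by lra.
  - exact: continuous_subspaceT.
  - by rewrite ge_min le_max; apply/andP; split; apply/orP; [left|right]; lra.
  by exists x.
have FG : cancel F G by move=> x; apply: inj; rewrite GP.
exists G; split=> // y.
have fy0 : f (G y) != 0 by rewrite gt_eqF// (lt_le_trans m0).
have nFG : {near G y, cancel F G} by near=> x; exact: FG.
have ncF : {near G y, continuous F} by near=> x; exact: cF.
by have := is_derive_inverse nFG ncF (dF (G y)) fy0; rewrite GP.
Unshelve. all: by end_near. Qed.

(** [phi] is arc length divided by the total length s; composing with its inverse divides the
    velocity by f / s, which leaves the speed s. *)
Lemma constant_speed (d : nat) (g : 'rV[R]_d -> 'M[R]_d) (p q : 'rV[R]_d)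
    (w : R -> 'rV[R]_d) :
  riemannian g -> (forall i j, continuous (fun x => g x i j)) -> C1curves p q w ->
  exists (phi : R -> R) (c v : R -> 'rV[R]_d) (s : R),
    [/\ 0 < s /\ riem_length g w = s,
        (forall u : R, is_derive u 1 c (v u)) /\ continuous v,
        forall u, 0 <= u <= 1 -> quadratic (g (c u)) (v u) = s ^+ 2,
        forall t, 0 <= t <= 1 -> w t = c (phi t) &
        [/\ C1_on I01 phi, phi 0 = 0, phi 1 = 1 &
          forall t, 0 <= t <= 1 -> 0 < velocity I01 phi t]].
Proof.
move=> rg cg [C1w w0 w1 reg].
have [W [U [dW cU Ww UE]]] := C1_extension C1w.
(* With the base point clamped like the velocity, the speed [f] depends only on [clamp t], so its
   minimum on [0, 1] is a positive lower bound on the line. *)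
pose W' t := W (clamp t).
have cW : continuous W.
  by apply/continuous_rV => i t; have /is_derive_rV/(_ i) := dW t; exact: isd_cont.
have cW' : continuous W'.
  by move=> t; apply: (@continuous_comp _ _ _ clamp W); [exact: clamp_continuous|exact: cW].
pose f t := Num.sqrt (quadratic (g (W' t)) (U t)).
have [cqf cf] := speed_continuous cg cW' cU; rewrite -/f in cf.
have clampK t : clamp (clamp t) = clamp t by rewrite clamp_id// clamp_itv.
have fclamp t : f t = f (clamp t) by rewrite /f /W' clampK [U (clamp t)]UE clampK -UE.
have f0 t : 0 < f t.
  rewrite sqrtr_gt0; have [_ pos] := rg (W' t); apply: pos; apply/eqP => Ut0.
  have := reg _ (clamp_itv t); rewrite -UE Ut0.
  by rewrite /enorm big1 ?sqrtr0 ?ltxx// => i _; rewrite mxE expr0n.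
have [m m0 fm] : exists2 m, 0 < m & forall t, m <= f t.
  have [|z _ zmin] := @EVT_min _ f 0 1 ler01; first exact: continuous_subspaceT.
  exists (f z); first exact: f0.
  by move=> t; rewrite (fclamp t); apply: zmin; rewrite in_itv/= clamp_itv.
have [A A0 dA] := continuous_antiderivative cf.
have lenE : riem_length g w = A 1.
  have dW' (t : R) : 0 <= t <= 1 -> is_derive t 1 W (U t) by move=> _.
  rewrite (riem_length_eq g (fun t t01 => esym (Ww t t01)) dW').
  have -> : A 1 = \int[mu]_(t in `[0, 1]) f t by rewrite (Rintegral_derive cf dA) A0 subr0.
  by apply: eq_Rintegral => t /set_mem; rewrite /= in_itv/= => t01; rewrite /f /W' clamp_id.
set s := A 1 in lenE.
have s0 : 0 < s.
  have := derive_ge_increment dA fm ler01; rewrite A0 !subr0 mulr1.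
  exact: lt_le_trans.
have s0' : s != 0 by rewrite gt_eqF.
pose phi t := s^-1 * A t.
have dphi t : is_derive t (1 : R) phi (s^-1 * f t) by exact: isdZ.
have phim t : s^-1 * m <= s^-1 * f t by rewrite ler_pM2l ?invr_gt0.
have [|G [phiK GK dG]] := inverse_derive dphi _ phim; first by rewrite mulr_gt0 ?invr_gt0.
have cG : continuous G by move=> x; exact: (isd_cont (dG x)).
pose r u := (s^-1 * f (G u))^-1.
pose c u := W (G u); pose v u := r u *: U (G u).
have phi_le a b : a <= b -> phi a <= phi b.
  move=> ab; rewrite -subr_ge0; apply: le_trans (derive_ge_increment dphi phim ab).
  by rewrite !mulr_ge0 ?subr_ge0 ?invr_ge0// ltW.
have phi0 : phi 0 = 0 by rewrite /phi A0 mulr0.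
have phi1 : phi 1 = 1 by rewrite /phi -/s mulVf.
have G01 u : 0 <= u <= 1 -> 0 <= G u <= 1.
  move=> /andP[u0 u1]; apply/andP; split; rewrite leNgt; apply/negP => h.
    have := derive_ge_increment dphi phim (ltW h); rewrite GK phi0 => h'.
    have : 0 < s^-1 * m * (0 - G u) by rewrite !mulr_gt0 ?invr_gt0// subr_gt0.
    by lra.
  have := derive_ge_increment dphi phim (ltW h); rewrite GK phi1 => h'.
  have : 0 < s^-1 * m * (G u - 1) by rewrite !mulr_gt0 ?invr_gt0// subr_gt0.
  by lra.
exists phi, c, v, s; split=> //.
- split=> [u|].
    apply/is_derive_rV => i; rewrite !mxE mulrC.
    have /is_derive_rV/(_ i) h := dW (G u).
    exact: (isd_comp (dG u) h).
  apply/continuous_rV => i; rewrite (_ : (fun _ => _) = fun u => r u * U (G u) 0 i).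
    move=> u; apply: cvgM.
      apply: cvgV; first by rewrite mulf_neq0 ?invr_eq0// gt_eqF.
      apply: cvgM; first exact: cvg_cst.
      by apply: (@continuous_comp _ _ _ G f); [exact: cG|exact: cf].
    apply: (@continuous_comp _ _ _ G (fun t => U t 0 i)); first exact: cG.
    exact: (continuous_rV U).1.
  by apply/funext => u; rewrite mxE.
- move=> u /G01 Gu; rewrite /c /v /r.
  have fE : f (G u) ^+ 2 = quadratic (g (W (G u))) (U (G u)).
    by rewrite /f /W' clamp_id// sqr_sqrtr// quadratic_ge0.
  have -> : quadratic (g (W (G u))) ((s^-1 * f (G u))^-1 *: U (G u)) =
      (s^-1 * f (G u)) ^- 2 * quadratic (g (W (G u))) (U (G u)).
    rewrite /quadratic mulr_sumr; apply: eq_bigr => i _.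
    rewrite mulr_sumr; apply: eq_bigr => j _; rewrite !mxE.
    by rewrite -exprVn; ring.
  by rewrite -fE; field; rewrite s0' gt_eqF.
- by move=> t t01; rewrite /c phiK Ww.
- split=> //.
    apply: (C1_on_unit dphi) => t; apply: cvgM; [exact: cvg_cst|exact: cf].
  move=> t t01; have [_ ->] := velocity_is_derive t01 (dphi t).
  by rewrite mulr_gt0 ?invr_gt0.
Qed.

End arclength.

(** * First variation of the energy *)

Section calculus_of_variations.
Context {R : realType}.
Local Notation mu := (@lebesgue_measure R).
Local Notation I01 := (`[0, 1]%classic : set R).

(** A primitive of f^2 is nondecreasing and has equal values at 0 and 1, so it is constant on [0, 1]
    and its velocity vanishes there, end points included. *)
Lemma unit_integral_sqr_eq0 (f : R -> R) : continuous f ->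
  \int[mu]_(t in `[0, 1]) (f t ^+ 2) = 0 -> forall t, 0 <= t <= 1 -> f t = 0.
Proof.
move=> cf int0 t t01.
have cf2 : continuous (fun t => f t ^+ 2).
  by move=> x; apply: (@continuous_comp _ _ _ f (fun y => y ^+ 2)); [exact: cf|exact: exprn_continuous].
have [F F0 dF] := continuous_antiderivative cf2.
have F1 : F 1 = 0 by move: int0; rewrite (Rintegral_derive cf2 dF) F0 subr0.
have inc := @derive_ge_increment _ F _ 0 dF (fun x => sqr_ge0 (f x)).
have FE : {in I01, F =1 (fun=> 0)}.
  move=> x /set_mem; rewrite /= in_itv/= => /andP[x0 x1].
  have := inc _ _ x0; have := inc _ _ x1; rewrite F0 F1 !mul0r => h1 h2.
  by apply/eqP; rewrite eq_le; apply/andP; split; lra.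
have [vE _] := velocity_eq_on FE t01.
have [_ v1] := velocity_is_derive t01 (dF t).
have [_ v2] := velocity_is_derive t01 (isd_cst 0 t).
by move: vE; rewrite v1 v2 => /eqP; rewrite sqrf_eq0 => /eqP.
Qed.

(** With F a primitive of A, integration by parts makes B - F orthogonal to every admissible h'.
    Taking for h' the function B - F minus its mean m is allowed, since its primitive vanishes at
    both ends; the integral of its square is then 0, so B = m + F. *)
Lemma du_bois_reymond (A B : R -> R) : continuous A -> continuous B ->
  (forall h h' : R -> R, (forall t : R, is_derive t 1 h (h' t)) -> continuous h' ->
    h 0 = 0 -> h 1 = 0 ->
    \int[mu]_(t in `[0, 1]) (A t * h t + B t * h' t) = 0) ->
  exists F : R -> R, (forall t : R, is_derive t 1 F (A t)) /\
    forall t, 0 <= t <= 1 -> B t = F t.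
Proof.
move=> cA cB var; have [F F0 dF] := continuous_antiderivative cA.
have cF : continuous F by move=> x; exact: (isd_cont (dF x)).
have cBF : continuous (fun t => B t - F t) by move=> x; apply: cvgB; [exact: cB|exact: cF].
pose m := \int[mu]_(t in `[0, 1]) (B t - F t).
pose h' t := B t - F t + - m.
have ccst (k : R) : continuous (fun _ : R => k) by move=> x; exact: cvg_cst.
have ch' : continuous h' by move=> x; apply: cvgD; [exact: cBF|exact: ccst].
have inth' : \int[mu]_(t in `[0, 1]) h' t = 0.
  by rewrite unit_integralD// unit_integral_cst subrr.
have [h h0 dh] := continuous_antiderivative ch'.
have h1 : h 1 = 0 by move: inth'; rewrite (Rintegral_derive ch' dh) h0 subr0.
have chh : continuous h by move=> x; exact: (isd_cont (dh x)).
have cM (a b : R -> R) : continuous a -> continuous b -> continuous (fun t => a t * b t).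
  by move=> ca cb x; apply: cvgM; [exact: ca|exact: cb].
have cD (a b : R -> R) : continuous a -> continuous b -> continuous (fun t => a t + b t).
  by move=> ca cb x; apply: cvgD; [exact: ca|exact: cb].
have e1 := var h h' dh ch' h0 h1.
have dFh t : is_derive t (1 : R) (fun t => F t * h t) (F t * h' t + h t * A t).
  exact: isdM.
have e2 : \int[mu]_(t in `[0, 1]) (F t * h' t + h t * A t) = 0.
  rewrite (Rintegral_derive _ dFh); last by apply: (cD); exact: cM.
  by rewrite h0 h1 !mulr0 subrr.
have e3 : \int[mu]_(t in `[0, 1]) (h' t ^+ 2) = 0.
  have -> : \int[mu]_(t in `[0, 1]) (h' t ^+ 2) = \int[mu]_(t in `[0, 1])
      ((A t * h t + B t * h' t) + (-1 * (F t * h' t + h t * A t) + - m * h' t)).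
    by apply: eq_Rintegral => t _; rewrite /h'; ring.
  have c1 := cD _ _ (cM _ _ cA chh) (cM _ _ cB ch').
  have c2 := cD _ _ (cM _ _ cF ch') (cM _ _ chh cA).
  have c3 := cM _ _ (ccst (-1)) c2; have c4 := cM _ _ (ccst (- m)) ch'.
  rewrite (unit_integralD c1 (cD _ _ c3 c4)) e1 (unit_integralD c3 c4).
  by rewrite (unit_integralZ _ c2) (unit_integralZ _ ch') e2 inth' !mulr0 !addr0.
exists (fun t => m + F t); split=> [t|t t01].
  by have := isdD (isd_cst m t) (dF t); rewrite add0r.
by have := unit_integral_sqr_eq0 ch' e3 t01; rewrite /h'; lra.
Qed.

Lemma cvg_unit_integral (f : nat -> R -> R) (F : R -> R) (M : R) :
  (forall n, continuous (f n)) -> continuous F ->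
  (forall t, 0 <= t <= 1 -> f n t @[n --> \oo] --> F t) ->
  (forall n t, 0 <= t <= 1 -> `|f n t| <= M) ->
  \int[mu]_(t in `[0, 1]) f n t @[n --> \oo] --> \int[mu]_(t in `[0, 1]) F t.
Proof.
move=> cf cF fF fM.
have mf (k : R -> R) : continuous k ->
    measurable_fun (I01 : set (measurableTypeR R)) (EFin \o k).
  by move=> ck; apply: measurable_funTS; apply/measurable_EFinP; exact: continuous_measurable_fun.
have ccM : continuous (fun _ : R => M) by move=> x; exact: cvg_cst.
have [||iF _] := @dominated_convergence _ _ _ mu I01 measurable_unit (fun n => EFin \o f n)
  (EFin \o F) (cst M%:E) (fun n => mf _ (cf n)) (mf _ cF) _ (continuous_integrable 0 1 ccM).
- apply: aeW => t; rewrite /= in_itv/= => t01; apply: cvg_EFin; first exact: nearW.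
  exact: fF.
- by apply: aeW => t n; rewrite /= in_itv/= lee_fin; exact: fM.
have fin : (\int[mu]_(t in I01) (EFin \o F) t \is a fin_num)%E.
  by apply: integrable_fin_num => //; exact: measurable_unit.
by rewrite -(fineK fin) => /fine_cvg.
Qed.

End calculus_of_variations.

(** * The energy along one-parameter variations *)

Section first_variation.
Context {R : realType} {d : nat}.
Local Notation mu := (@lebesgue_measure R).
Local Notation I01 := (`[0, 1]%classic : set R).

Lemma derive_lipschitz (F f : R -> R) (lo hi M : R) :
  (forall t : R, is_derive t 1 F (f t)) ->
  (forall t, lo <= t <= hi -> `|f t| <= M) ->
  forall a b, lo <= a <= hi -> lo <= b <= hi -> `|F a - F b| <= M * `|a - b|.
Proof.
move=> dF fM a b; wlog ab : a b / a <= b.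
  move=> H a1 b1; have [ab|/ltW ba] := leP a b; first exact: H.
  by rewrite distrC (distrC a); exact: H.
move=> /andP[la ah] /andP[lb bh]; rewrite distrC (distrC a).
have [|c] := @MVT_segment R F f a b ab (fun x _ => dF x).
  by apply: continuous_subspaceT => x; exact: (isd_cont (dF x)).
rewrite in_itv/= => /andP[ac cb] ->; rewrite normrM ler_wpM2r//; apply: fM; lra.
Qed.

Lemma continuous_bounded (I : finType) (f : I -> R -> R) : (forall i, continuous (f i)) ->
  exists2 C, 0 <= C & forall i t, 0 <= t <= 1 -> `|f i t| <= C.
Proof.
move=> cf; have /choice[B BP] : forall i, exists C, forall t, 0 <= t <= 1 -> `|f i t| <= C.
  move=> i; have cN : {within `[0, 1], continuous (fun t => `|f i t|)}.
    apply: continuous_subspaceT => t.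
    by apply: (@continuous_comp _ _ _ (f i) Num.norm); [exact: cf|exact: norm_continuous].
  have [|z _ zmax] := EVT_max _ cN; first exact: ler01.
  by exists `|f i z| => t t01; apply: zmax; rewrite in_itv.
exists (\sum_i `|B i|) => [|i t t01]; first by apply: sumr_ge0.
rewrite (le_trans (BP i _ t01))// (le_trans (ler_norm _))//.
by rewrite (bigD1 i)//= lerDl sumr_ge0.
Qed.

Lemma family_bounded_on_ball (I : finType) (f : I -> 'rV[R]_d -> R) (K : R) :
  (forall i, continuous (f i)) ->
  exists2 C, 0 <= C & forall i x, `|x| <= K -> `|f i x| <= C.
Proof.
move=> cf; have /choice[B BP] : forall i, exists C, forall x : 'rV[R]_d, `|x| <= K -> `|f i x| <= C.
  by move=> i; exact: bounded_on_ball.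
exists (\sum_i `|B i|) => [|i x xK]; first by apply: sumr_ge0.
rewrite (le_trans (BP i _ xK))// (le_trans (ler_norm _))//.
by rewrite (bigD1 i)//= lerDl sumr_ge0.
Qed.

Lemma C1_lipschitz (c v : R -> 'rV[R]_d) :
  (forall t : R, is_derive t 1 c (v t)) -> continuous v ->
  [lipschitz c t | t in `[0, 1]].
Proof.
move=> dc cv.
have [C C0 CP] := @continuous_bounded _ (fun i t => v t 0 i) ((continuous_rV v).1 cv).
exists C; split; first exact: num_real.
move=> M CM [a b] /= [] /=; rewrite !in_itv/= => a01 b01.
apply: rV_norm_le => [|i]; first by rewrite mulr_ge0// (le_trans C0)// ltW.
rewrite !mxE (le_trans (@derive_lipschitz (fun t => c t 0 i) (fun t => v t 0 i) 0 1 C _ _ _ _ a01 b01))//.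
- by move=> t; have /is_derive_rV := dc t; exact.
- by move=> t t01; exact: CP.
by rewrite ler_wpM2r// ltW.
Qed.

Definition dmetric (g : 'rV[R]_d -> 'M[R]_d) (k i j : 'I_d) : 'rV[R]_d -> R :=
  partial (basis_rV d) [:: k] (fun y => g y i j).

Lemma C11_partial_continuous (f : 'rV[R]_d -> R) (k : 'I_d) :
  C11 f -> continuous (partial (basis_rV d) [:: k] f).
Proof.
move=> [_ /(_ k)] lip x; have [r r0 [M [_ MP]]] := lip x.
pose K := Num.max M 0 + 1.
have MK : M < K by rewrite /K ltr_pwDr// le_max lexx.
have K0 : 0 < K by rewrite /K ltr_pwDr// le_max lexx orbT.
apply/(@cvgrPdist_le _ _ _ _ (nbhs_filter x)) => e e0.
have m0 : 0 < Num.min r (e / K) by rewrite lt_min r0 divr_gt0.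
apply: (@filterS _ _ (nbhs_filter x) _ _ _ (nbhsx_ballx x _ m0)) => y xy.
have yr : ball x r y by apply: le_ball xy; rewrite ge_min lexx.
have xK : `|x - y| < e / K.
  by move: xy; rewrite -ball_normE => /lt_le_trans; apply; rewrite ge_min lexx orbT.
have := MP K MK (x, y); rewrite /= => /(_ _)/wrap[|/le_trans].
  by split=> //; exact: ballxx.
by apply; rewrite mulrC -ler_pdivlMr// ltW.
Qed.

Lemma is_derive_line (f : 'rV[R]_d -> R) (k : 'I_d) (x : 'rV[R]_d) (y : R) :
  differentiable f (x + y *: basis_rV d k) ->
  is_derive y 1 (fun y : R => f (x + y *: basis_rV d k))
    (partial (basis_rV d) [:: k] f (x + y *: basis_rV d k)).
Proof.
move=> df; have /derivableP dk := @diff_derivable _ _ _ f _ (basis_rV d k) df.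
have E : (fun h : R => h^-1 *: ((fun y : R => f (x + y *: basis_rV d k)) (h *: 1 + y) -
      f (x + y *: basis_rV d k))) =
    (fun h : R => h^-1 *: (f (h *: basis_rV d k + (x + y *: basis_rV d k)) -
      f (x + y *: basis_rV d k))).
  apply/funext => h; congr (_ *: (f _ - _)).
  by rewrite -[h *: 1]/(h * 1) mulr1 scalerDl addrCA.
case: dk => dk dkE; split.
  by rewrite /derivable E.
by rewrite /derive E.
Qed.

Lemma sum_delta (f : 'I_d -> R) (k : 'I_d) : \sum_j f j * (j == k)%:R = f k.
Proof.
rewrite (bigD1 k)//= eqxx mulr1 big1 ?addr0// => j jk.
by rewrite (negbTE jk) mulr0.
Qed.

Section variation.
Context (g : 'rV[R]_d -> 'M[R]_d) (c v : R -> 'rV[R]_d) (s : R).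
Context (gC11 : forall i j, C11 (fun x => g x i j)) (rg : riemannian g).
Context (dc : forall t : R, is_derive t 1 c (v t)) (cv : continuous v).
Context (s0 : 0 < s)
  (speed : forall t, 0 <= t <= 1 -> quadratic (g (c t)) (v t) = s ^+ 2).
Context (cmin : forall sigma : R -> 'rV[R]_d, [lipschitz sigma t | t in `[0, 1]] ->
  sigma 0 = c 0 -> sigma 1 = c 1 -> s <= riem_length g sigma).

Let cg i j : continuous (fun x => g x i j).
Proof. by move=> x; apply: differentiable_continuous; have [+ _] := gC11 i j. Qed.

Let cdg k i j : continuous (dmetric g k i j).
Proof. exact: C11_partial_continuous. Qed.

Let cc : continuous c.
Proof.
by apply/continuous_rV => i t; have /is_derive_rV/(_ i) := dc t; exact: isd_cont.
Qed.

(** [force] and [momentum] are the derivatives of the energy density g_ij(x) v^i v^j with respect to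
    the k-th coordinate of position and of velocity. *)
Definition force k t := \sum_i \sum_j dmetric g k i j (c t) * v t 0 i * v t 0 j.
Definition momentum k t := 2 * \sum_j g (c t) k j * v t 0 j.

Section direction.
Context (k : 'I_d) (h h' : R -> R).
Context (dh : forall t : R, is_derive t 1 h (h' t)) (ch' : continuous h').
Context (h0 : h 0 = 0) (h1 : h 1 = 0).

Let ch : continuous h.
Proof. by move=> t; exact: (isd_cont (dh t)). Qed.

(** Varying the k-th coordinate alone gives the Euler-Lagrange equation of index k. *)
Let sig (e t : R) : 'rV[R]_d := c t + (e * h t) *: basis_rV d k.
Let dsig (e t : R) : 'rV[R]_d := v t + (e * h' t) *: basis_rV d k.
Let q e t := quadratic (g (sig e t)) (dsig e t).
(** The derivative of [q] in e, arranged in the way that [isdM] produces it. *)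
Let dq e t := \sum_i \sum_j
  (g (sig e t) i j * dsig e t 0 i * (h' t * (j == k)%:R) +
   dsig e t 0 j * (g (sig e t) i j * (h' t * (i == k)%:R) +
     dsig e t 0 i * (dmetric g k i j (sig e t) * h t))).

Let coordE (u : 'rV[R]_d) (y : R) i : (u + y *: basis_rV d k) 0 i = u 0 i + y * (i == k)%:R.
Proof. by rewrite !mxE eqxx. Qed.

Let dsigma e (t : R) : is_derive t 1 (sig e) (dsig e t).
Proof.
apply/is_derive_rV => i; rewrite coordE.
rewrite (_ : (fun _ => _) = fun t => c t 0 i + e * (i == k)%:R * h t); last first.
  by apply/funext => u; rewrite coordE mulrAC.
have -> : e * h' t * (i == k)%:R = e * (i == k)%:R * h' t by rewrite mulrAC.
have /is_derive_rV/(_ i) dci := dc t.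
exact: (isdD dci (isdZ _ (dh t))).
Qed.

Let csig e : continuous (sig e).
Proof.
by apply/continuous_rV => i t; have /is_derive_rV/(_ i) := dsigma e t; exact: isd_cont.
Qed.

Let cdsig e : continuous (dsig e).
Proof.
apply/continuous_rV => i.
rewrite (_ : (fun _ => _) = fun t => v t 0 i + e * (i == k)%:R * h' t); last first.
  by apply/funext => u; rewrite coordE mulrAC.
move=> t; apply: cvgD; first exact: (continuous_rV v).1.
by apply: cvgM; [exact: cvg_cst|exact: ch'].
Qed.

Let is_derive_q (e t : R) : is_derive e 1 (fun e => q e t) (dq e t).
Proof.
rewrite /q /quadratic /dq.
apply: isd_sum => i; apply: isd_sum => j.
have dsE l : is_derive e 1 (fun e => dsig e t 0 l) (h' t * (l == k)%:R).
  rewrite (_ : (fun _ => _) = fun e => v t 0 l + h' t * (l == k)%:R * e); last first.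
    by apply/funext => u; rewrite coordE; ring.
  have := isdD (isd_cst (v t 0 l) e) (isdZ (h' t * (l == k)%:R) (isd_id e)).
  by rewrite add0r mulr1.
have dgE : is_derive e 1 (fun e => g (sig e t) i j) (dmetric g k i j (sig e t) * h t).
  have dl : is_derive e 1 (fun e : R => e * h t) (h t).
    have := isdZ (h t) (isd_id e); rewrite mulr1.
    by congr (is_derive _ _ _ _); apply/funext => u; rewrite mulrC.
  have := @is_derive_line (fun x => g x i j) k (c t) (e * h t) ((gC11 i j).1 _).
  exact: isd_comp dl.
exact: (isdM (isdM dgE (dsE i)) (dsE j)).
Qed.

(** A bound uniform in e and t dominates the difference quotients of [q], so the derivative in e
    passes under the integral. For |e| <= 1 the varied curves stay in a fixed ball. *)
Let dq_bounded : exists M, forall e t, -1 <= e <= 1 -> 0 <= t <= 1 -> `|dq e t| <= M.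
Proof.
have [Cc Cc0 HCc] := continuous_bounded (fun i => (continuous_rV c).1 cc i).
have [Cv Cv0 HCv] := continuous_bounded (fun i => (continuous_rV v).1 cv i).
have [Ch Ch0 HCh] := @continuous_bounded _ (fun _ : 'I_1 => h) (fun _ => ch).
have [Ch' Ch'0 HCh'] := @continuous_bounded _ (fun _ : 'I_1 => h') (fun _ => ch').
have [Cg Cg0 HCg] := @family_bounded_on_ball _
  (fun (ij : 'I_d * 'I_d) x => g x ij.1 ij.2) (Cc + Ch) (fun ij => @cg ij.1 ij.2).
have [Cd Cd0 HCd] := @family_bounded_on_ball _
  (fun (ij : 'I_d * 'I_d) => dmetric g k ij.1 ij.2) (Cc + Ch) (fun ij => @cdg k ij.1 ij.2).
pose V := Cv + Ch'.
exists (\sum_(i < d) \sum_(j < d) (Cg * V * Ch' + V * (Cg * Ch' + V * (Cd * Ch)))).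
move=> e t e1 t01.
have e1' : `|e| <= 1 by rewrite ler_norml.
have delta i : `|(i == k)%:R : R| <= 1 by case: (i == k); rewrite ?normr1 ?normr0.
have line (a b : R) A B i : `|a| <= A -> `|b| <= B -> `|a + e * b * (i == k)%:R| <= A + B.
  move=> aA bB; rewrite (le_trans (ler_normD _ _))// lerD// !normrM.
  rewrite -[leRHS]mulr1 ler_pM ?mulr_ge0// -[leRHS]mul1r.
  exact: ler_pM.
have sE : `|sig e t| <= Cc + Ch.
  apply: rV_norm_le => [|i]; first exact: addr_ge0.
  by rewrite coordE; apply: line; [exact: HCc|exact: (HCh ord0)].
have dsE i : `|dsig e t 0 i| <= V.
  by rewrite coordE; apply: line; [exact: HCv|exact: (HCh' ord0)].
have V0 : 0 <= V by exact: addr_ge0.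
have hd i : `|h' t * (i == k)%:R| <= Ch'.
  by rewrite normrM -[leRHS]mulr1 ler_pM//; exact: (HCh' ord0).
rewrite (le_trans (ler_norm_sum _ _ _))//; apply: ler_sum => i _.
rewrite (le_trans (ler_norm_sum _ _ _))//; apply: ler_sum => j _.
have gE : `|g (sig e t) i j| <= Cg by exact: (HCg (i, j)).
have dgE : `|dmetric g k i j (sig e t)| <= Cd by exact: (HCd (i, j)).
have hE : `|h t| <= Ch by exact: (HCh ord0).
have mul (a b A B : R) : `|a| <= A -> `|b| <= B -> `|a * b| <= A * B.
  by move=> aA bB; rewrite normrM ler_pM.
have add (a b A B : R) : `|a| <= A -> `|b| <= B -> `|a + b| <= A + B.
  by move=> aA bB; rewrite (le_trans (ler_normD _ _))// lerD.
exact: (add _ _ _ _ (mul _ _ _ _ (mul _ _ _ _ gE (dsE i)) (hd j))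
  (mul _ _ _ _ (dsE j) (add _ _ _ _ (mul _ _ _ _ gE (hd i))
    (mul _ _ _ _ (dsE i) (mul _ _ _ _ dgE hE))))).
Qed.

(** Since h vanishes at both ends, the varied curve is a competitor of length at least s. With E its
    energy, s <= E / (2 s) + s / 2, that is, s^2 <= E. *)
Let energy_le e : s ^+ 2 <= \int[mu]_(t in `[0, 1]) q e t.
Proof.
have [cq cs] := speed_continuous cg (@csig e) (@cdsig e).
have ds' (t : R) : 0 <= t <= 1 -> is_derive t 1 (sig e) (dsig e t) by move=> _; exact: dsigma.
have : s <= riem_length g (sig e).
  apply: cmin; first exact: (C1_lipschitz (dsigma e) (@cdsig e)).
    by rewrite /sig h0 mulr0 scale0r addr0.
  by rewrite /sig h1 mulr0 scale0r addr0.
rewrite (riem_length_eq g (fun t _ => erefl (sig e t)) ds').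
have ccst (a : R) : continuous (fun _ : R => a) by move=> x; exact: cvg_cst.
have cq2 : continuous (fun t => (2 * s)^-1 * q e t).
  by move=> t; apply: cvgM; [exact: ccst|exact: cq].
have cq3 : continuous (fun t => (2 * s)^-1 * q e t + s / 2).
  by move=> t; apply: cvgD; [exact: cq2|exact: ccst].
(* AM-GM: sqrt q <= (q / s + s) / 2 *)
have AMGM : \int[mu]_(t in `[0, 1]) Num.sqrt (q e t) <=
    \int[mu]_(t in `[0, 1]) ((2 * s)^-1 * q e t + s / 2).
  apply: unit_integral_le => // t _.
  have q0 : 0 <= q e t by exact: quadratic_ge0.
  have sq := sqr_sqrtr q0; rewrite -{2}sq -subr_ge0.
  have -> : (2 * s)^-1 * Num.sqrt (q e t) ^+ 2 + s / 2 - Num.sqrt (q e t) =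
    (2 * s)^-1 * (Num.sqrt (q e t) - s) ^+ 2 by field; rewrite gt_eqF.
  by rewrite mulr_ge0 ?sqr_ge0// invr_ge0 mulr_ge0// ltW.
move=> /le_trans/(_ AMGM); rewrite (unit_integralD cq2 (ccst _)) (unit_integralZ _ cq).
rewrite unit_integral_cst => sle.
have s2 : 0 < 2 * s by rewrite mulr_gt0.
have : s / 2 <= (2 * s)^-1 * \int[mu]_(t in `[0, 1]) q e t by lra.
rewrite ler_pdivlMl//; apply: le_trans.
by rewrite le_eqVlt; apply/orP; left; apply/eqP; field.
Qed.

Let cdq0 : continuous (dq 0).
Proof.
have cgs i j : continuous (fun t => g (sig 0 t) i j).
  by move=> t; apply: (@continuous_comp _ _ _ (sig 0) (fun x => g x i j)); [exact: csig|exact: cg].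
have cds i : continuous (fun t => dsig 0 t 0 i) by exact: (continuous_rV _).1.
have cdgs i j : continuous (fun t => dmetric g k i j (sig 0 t)).
  by move=> t; apply: (@continuous_comp _ _ _ (sig 0) (dmetric g k i j)); [exact: csig|exact: cdg].
have cM (a b : R -> R) : continuous a -> continuous b -> continuous (fun t => a t * b t).
  by move=> ca cb x; apply: cvgM; [exact: ca|exact: cb].
have cD (a b : R -> R) : continuous a -> continuous b -> continuous (fun t => a t + b t).
  by move=> ca cb x; apply: cvgD; [exact: ca|exact: cb].
have ccst (a : R) : continuous (fun _ : R => a) by move=> x; exact: cvg_cst.
have F i j := cD _ _ (cM _ _ (cM _ _ (cgs i j) (cds i)) (cM _ _ ch' (ccst (j == k)%:R)))
  (cM _ _ (cds j) (cD _ _ (cM _ _ (cgs i j) (cM _ _ ch' (ccst (i == k)%:R)))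
    (cM _ _ (cds i) (cM _ _ (cdgs i j) ch)))).
by move=> t; apply: cvg_bigsum => i; apply: cvg_bigsum => j; exact: F.
Qed.

(** The increments e = sgn / (n + 1) approach 0 from the side of [sgn]. The energy at e = 0 is
    exactly s^2, the minimum, so the quotients have the sign of [sgn]; the two sides together force
    the derivative to vanish. *)
Let dq0_int (sgn : R) : `|sgn| = 1 -> 0 <= sgn * \int[mu]_(t in `[0, 1]) dq 0 t.
Proof.
move=> sgn1; have sgn0 : sgn != 0 by rewrite -normr_eq0 sgn1 oner_eq0.
pose en n : R := sgn * n.+1%:R^-1.
have en0 n : en n != 0 by rewrite mulf_neq0// invr_eq0 pnatr_eq0.
have en1 n : -1 <= en n <= 1.
  by rewrite -ler_norml normrM sgn1 mul1r ger0_norm ?invr_ge0// invf_le1// ler1n.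
have [M MP] := dq_bounded.
have cq e : continuous (q e) by have [] := speed_continuous cg (@csig e) (@cdsig e).
have ccst (a : R) : continuous (fun _ : R => a) by move=> x; exact: cvg_cst.
pose r n t := (en n)^-1 * (q (en n) t + -1 * q 0 t).
have cN : continuous (fun t => -1 * q 0 t) by move=> t; apply: cvgM; [exact: ccst|exact: cq].
have cD n : continuous (fun t => q (en n) t + -1 * q 0 t).
  by move=> t; apply: cvgD; [exact: cq|exact: cN].
have cr n : continuous (r n) by move=> t; apply: cvgM; [exact: ccst|exact: cD].
have rcvg : \int[mu]_(t in `[0, 1]) r n t @[n --> \oo] --> \int[mu]_(t in `[0, 1]) dq 0 t.
  apply: (cvg_unit_integral (M := M)) => // [t t01|n t t01].
    have /is_derive_diffq h0' := is_derive_q 0 t.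
    have enc : en n @[n --> \oo] --> 0^'.
      have en_cvg : en n @[n --> \oo] --> sgn * 0.
        by apply: cvgM; [exact: cvg_cst|exact: cvg_harmonic].
      rewrite mulr0 in en_cvg; move=> B [e /= e0 eB].
      have /cvgrPdist_lt/(_ _ e0) := en_cvg.
      by apply: filterS => n ne; exact: eB.
    have := cvg_comp _ _ enc h0'; apply: cvg_trans; apply: near_eq_cvg.
    by apply: nearW => n; rewrite /= /diffq /r subr0 mulN1r.
  have := derive_lipschitz (fun e => is_derive_q e t) (fun e e1 => MP e t e1 t01) (en1 n) (_ : -1 <= 0 <= 1).
  rewrite subr0 => /(_ _)/wrap[|h2]; first by lra.
  rewrite /r normrM normfV ler_pdivrMl ?normr_gt0// mulN1r.
  by rewrite mulrC.
have pos n : 0 <= sgn * \int[mu]_(t in `[0, 1]) r n t.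
  rewrite (unit_integralZ _ (cD n)) (unit_integralD (cq _) cN) (unit_integralZ _ (cq 0)).
  have -> : \int[mu]_(t in `[0, 1]) q 0 t = s ^+ 2.
    rewrite -[RHS]unit_integral_cst; apply: eq_Rintegral => t /set_mem.
    rewrite /= in_itv/= => t01; rewrite /q /sig /dsig !mul0r !scale0r !addr0.
    exact: speed.
  have -> x : sgn * ((en n)^-1 * x) = n.+1%:R * x.
    by rewrite /en invfM invrK mulrA mulrA divff// mul1r.
  by rewrite mulr_ge0// mulN1r subr_ge0; exact: energy_le.
have cl : sgn * \int[mu]_(t in `[0, 1]) r n t @[n --> \oo] --> sgn * \int[mu]_(t in `[0, 1]) dq 0 t.
  by apply: cvgM => //; exact: cvg_cst.
by apply: (cvgr_to_ge cl); apply: nearW.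
Qed.

Lemma first_variation :
  \int[mu]_(t in `[0, 1]) (force k t * h t + momentum k t * h' t) = 0.
Proof.
have -> : \int[mu]_(t in `[0, 1]) (force k t * h t + momentum k t * h' t) =
    \int[mu]_(t in `[0, 1]) dq 0 t.
  apply: eq_Rintegral => t _; rewrite /dq.
  have -> : sig 0 t = c t by rewrite /sig mul0r scale0r addr0.
  have -> : dsig 0 t = v t by rewrite /dsig mul0r scale0r addr0.
  (* Symmetry merges the two terms containing h' into the factor 2 of [momentum]. *)
  have sym i j : g (c t) i j = g (c t) j i.
    by have [+ _] := rg (c t) => {1}<-; rewrite mxE.
  rewrite (eq_bigr (fun i => h' t * (g (c t) k i * v t 0 i) +
      (\sum_j h' t * (g (c t) i j * v t 0 j)) * (i == k)%:R +
      (\sum_j dmetric g k i j (c t) * v t 0 i * v t 0 j) * h t)); last first.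
    move=> i _; rewrite (eq_bigr (fun j => h' t * (g (c t) i j * v t 0 i) * (j == k)%:R +
        h' t * (g (c t) i j * v t 0 j) * (i == k)%:R +
        dmetric g k i j (c t) * v t 0 i * v t 0 j * h t)); last by move=> j _; ring.
    by rewrite !big_split/= sum_delta -!mulr_suml (sym i k).
  rewrite !big_split/= sum_delta -!mulr_suml -!mulr_sumr /force /momentum.
  by ring.
have p1 := dq0_int (normr1 R); have p2 : 0 <= -1 * \int[mu]_(t in `[0, 1]) dq 0 t.
  by apply: dq0_int; rewrite normrN1.
by apply/eqP; rewrite eq_le; apply/andP; split; lra.
Qed.

End direction.
End variation.
End first_variation.

(** * The geodesic equation *)

Section inverse_matrix.
Context {R : realType}.

Lemma derivable_bigsum (I : Type) (r : seq I) (f : I -> R -> R) (t : R) :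
  (forall i, derivable (f i) t 1) -> derivable (fun s => \sum_(i <- r) f i s) t 1.
Proof.
move=> df.
by case: (@isd_sum _ _ r f (fun i => 'D_1 (f i) t) t (fun i => derivableP (df i))).
Qed.

Lemma derivable_mulf (f h : R -> R) (t : R) : derivable f t 1 -> derivable h t 1 ->
  derivable (fun s => f s * h s) t 1.
Proof. by move=> /derivableP df /derivableP dh; case: (isdM df dh). Qed.

Lemma derivable_bigprod (I : Type) (r : seq I) (f : I -> R -> R) (t : R) :
  (forall i, derivable (f i) t 1) -> derivable (fun s => \prod_(i <- r) f i s) t 1.
Proof.
move=> df; elim: r => [|i r IH].
  rewrite (_ : (fun _ => _) = fun=> 1); first by case: (isd_cst 1 t).
  by apply/funext => s; rewrite big_nil.
rewrite (_ : (fun _ => _) = fun s => f i s * \prod_(i <- r) f i s).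
  exact: derivable_mulf.
by apply/funext => s; rewrite big_cons.
Qed.

Lemma derivable_det (n : nat) (A : R -> 'M[R]_n) (t : R) :
  (forall i j, derivable (fun s => A s i j) t 1) -> derivable (fun s => \det (A s)) t 1.
Proof.
move=> dA; apply: derivable_bigsum => s; apply: derivable_mulf.
  exact: derivable_cst.
by apply: derivable_bigprod => i; exact: dA.
Qed.

(** Each entry of the inverse is a cofactor divided by the determinant, hence a rational expression
    in the entries of A. *)
Lemma derivable_invmx (n : nat) (A : R -> 'M[R]_n) (t : R) :
  (forall s, A s \in unitmx) -> (forall i j, derivable (fun s => A s i j) t 1) ->
  forall i j, derivable (fun s => invmx (A s) i j) t 1.
Proof.
move=> uA dA i j.
rewrite (_ : (fun _ => _) = fun s => (\det (A s))^-1 *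
    ((-1) ^+ (j + i) * \det (row' j (col' i (A s))))); last first.
  by apply/funext => s; rewrite /invmx uA !mxE.
apply: derivable_mulf.
  apply: derivableV; last exact: derivable_det.
  by have := uA t; rewrite unitmxE unitfE.
apply: derivable_mulf; first by case: (isd_cst ((-1) ^+ (j + i) : R) t).
apply: derivable_det => k l.
by rewrite (_ : (fun _ => _) = fun s => A s (lift j k) (lift i l))// ; apply/funext => s; rewrite !mxE.
Qed.

(** A nonzero vector u with u g(x) = 0 would make the quadratic form vanish at u, against
    positivity. *)
Lemma riemannian_unitmx (d : nat) (g : 'rV[R]_d -> 'M[R]_d) x :
  riemannian g -> g x \in unitmx.
Proof.
move=> /(_ x)[_ pos]; rewrite -row_free_unit; apply: inj_row_free => u u0.
apply/eqP/negPn/negP => /pos; rewrite (_ : quadratic _ _ = 0) ?ltxx//.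
rewrite /quadratic exchange_big big1// => j _.
have /rowP/(_ j) := u0; rewrite !mxE => uj.
rewrite (eq_bigr (fun i => u 0 i * g x i j * u 0 j)); last by move=> i _; ring.
by rewrite -mulr_suml uj mul0r.
Qed.

End inverse_matrix.

(** * From the Euler-Lagrange equation to the geodesic equation *)

Section euler_lagrange.
Context {R : realType} {d : nat}.
Local Notation mu := (@lebesgue_measure R).
Local Notation I01 := (`[0, 1]%classic : set R).

Lemma diff_rV (f : 'rV[R]_d -> R) (x u : 'rV[R]_d) : differentiable f x ->
  'd f x u = \sum_i u 0 i * partial (basis_rV d) [:: i] f x.
Proof.
move=> df; have dZ (a : R) (v : 'rV[R]_d) : 'd f x (a *: v) = a *: 'd f x v.
  by rewrite linearZ.
rewrite {1}(row_sum_delta u) linear_sum; apply: eq_bigr => i _.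
by rewrite [LHS]dZ /= deriveE.
Qed.

Lemma is_derive_chain (f : 'rV[R]_d -> R) (c : R -> 'rV[R]_d) (t : R) (u : 'rV[R]_d) :
  differentiable f (c t) -> is_derive t 1 c u ->
  is_derive t 1 (fun s => f (c s)) (\sum_i u 0 i * partial (basis_rV d) [:: i] f (c t)).
Proof.
move=> df [dc <-]; have dc' : differentiable c t by exact/derivable1_diffP.
have dfc : differentiable (f \o c) t by exact: differentiable_comp.
split; first exact/derivable1_diffP.
by rewrite -(diff_rV _ df) (deriveE _ dc') -[LHS]/('D_1 (f \o c) t) (deriveE _ dfc) (diff_comp dc' df).
Qed.

Lemma minimizing_geodesic_on (g : 'rV[R]_d -> 'M[R]_d) (c v : R -> 'rV[R]_d) (s : R) :
  (forall i j, C11 (fun x => g x i j)) -> riemannian g ->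
  (forall t : R, is_derive t 1 c (v t)) -> continuous v -> 0 < s ->
  (forall t, 0 <= t <= 1 -> quadratic (g (c t)) (v t) = s ^+ 2) ->
  (forall sigma : R -> 'rV[R]_d, [lipschitz sigma t | t in `[0, 1]] ->
    sigma 0 = c 0 -> sigma 1 = c 1 -> s <= riem_length g sigma) ->
  geodesic_on g I01 c.
Proof.
move=> gC11 rg dc cv s0 speed cmin.
have dg i j x : differentiable (fun x => g x i j) x by have [+ _] := gC11 i j.
have sym x i j : g x i j = g x j i.
  by have [+ _] := rg x => {1}<-; rewrite mxE.
have dsym k i j x : dmetric g k i j x = dmetric g k j i x.
  by rewrite /dmetric; congr (partial _ _ _ _); apply/funext => y; exact: sym.
have cc : continuous c.
  by apply/continuous_rV => i t; have /is_derive_rV/(_ i) := dc t; exact: isd_cont.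
have cvi i : continuous (fun t => v t 0 i) by exact: (continuous_rV v).1.
have cforce k : continuous (force g c v k).
  move=> t; apply: cvg_bigsum => i; apply: cvg_bigsum => j.
  apply: cvgM; last exact: cvi.
  apply: cvgM; last exact: cvi.
  apply: (@continuous_comp _ _ _ c (dmetric g k i j)); first exact: cc.
  exact: C11_partial_continuous.
have cmom k : continuous (momentum g c v k).
  move=> t; apply: cvgM; first exact: cvg_cst.
  apply: cvg_bigsum => j; apply: cvgM; last exact: cvi.
  apply: (@continuous_comp _ _ _ c (fun x => g x k j)); first exact: cc.
  exact: differentiable_continuous.
have /choice[F FP] : forall k, exists F : R -> R,
    (forall t : R, is_derive t 1 F (force g c v k t)) /\
    forall t, 0 <= t <= 1 -> momentum g c v k t = F t.
  move=> k; apply: du_bois_reymond => // h h' dh ch' h0 h1.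
  exact: (first_variation gC11 rg dc cv s0 speed cmin).
have gu x := riemannian_unitmx x rg.
(* [Z] is the velocity recovered from the momentum. It is derivable on the whole line, unlike [v],
   of which only continuity is known, and it coincides with [v] on [0, 1]. *)
pose Z i t := \sum_k invmx (g (c t)) i k * (2^-1 * F k t).
have dgc i j (t : R) : is_derive t 1 (fun s => g (c s) i j)
    (\sum_l v t 0 l * dmetric g l i j (c t)).
  exact: (@is_derive_chain (fun x => g x i j)).
have dZ i (t : R) : is_derive t 1 (Z i) ('D_1 (Z i) t).
  apply/derivableP; apply: derivable_bigsum => k; apply: derivable_mulf.
    by apply: derivable_invmx => // a b; case: (dgc a b t).
  by case: (isdZ 2^-1 ((FP k).1 t)).
have gZ k t : \sum_j g (c t) k j * Z j t = 2^-1 * F k t.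
  under eq_bigr do rewrite mulr_sumr.
  rewrite exchange_big/= -[RHS](sum_delta (fun l => 2^-1 * F l t)); apply: eq_bigr => l _.
  under eq_bigr do rewrite mulrA.
  rewrite -mulr_suml mulrC; congr (_ * _).
  have /matrixP/(_ k l) := mulmxV (gu (c t)); rewrite !mxE => ->.
  by rewrite eq_sym.
have vZ t : 0 <= t <= 1 -> forall i, v t 0 i = Z i t.
  move=> t01 i; rewrite /Z.
  have mF k : 2^-1 * F k t = \sum_j g (c t) k j * v t 0 j.
    by rewrite -((FP k).2 t t01) /momentum mulrA mulVf ?mul1r// pnatr_eq0.
  under eq_bigr do rewrite mF mulr_sumr.
  rewrite exchange_big/= -[LHS](sum_delta (fun l => v t 0 l)); apply: eq_bigr => l _.
  under eq_bigr do rewrite mulrA.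
  rewrite -mulr_suml mulrC; congr (_ * _).
  have /matrixP/(_ i l) := mulVmx (gu (c t)); rewrite !mxE => ->.
  by rewrite eq_sym.
move=> t; rewrite /= in_itv/= => t01; pose V := velocity I01 c; rewrite -/V.
have vE u : 0 <= u <= 1 -> velocity I01 c u = v u.
  by move=> u01; have [] := velocity_is_derive u01 (dc u).
pose ZZ u : 'rV[R]_d := \row_i Z i u.
have VZ : {in I01, V =1 ZZ}.
  move=> u /set_mem; rewrite /= in_itv/= => u01; rewrite /V vE//.
  by apply/rowP => i; rewrite mxE vZ.
have dZZ : is_derive t (1 : R) ZZ (\row_i 'D_1 (Z i) t).
  apply/is_derive_rV => i; rewrite mxE (_ : (fun _ => _) = Z i)//.
  by apply/funext => u; rewrite mxE.
have [dV VE] := velocity_is_derive t01 dZZ.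
have [vVE dVE] := velocity_eq_on VZ t01.
split; [by have [] := velocity_is_derive t01 (dc t)|exact/dVE|move=> k].
rewrite vVE VE mxE.
have VtE : V t = v t by exact: vE.
(* Both sides of g(c) Z = F / 2 are differentiated, and the term with the derivative of g along c
   moves to the right. *)
have EL l : \sum_j g (c t) l j * 'D_1 (Z j) t =
    2^-1 * force g c v l t - \sum_i \sum_j dmetric g i l j (c t) * v t 0 i * v t 0 j.
  have d1 := isd_sum (index_enum 'I_d) (fun j => isdM (dgc l j t) (dZ j t)).
  have d2 := isdZ 2^-1 ((FP l).1 t).
  have E : (fun t => \sum_j g (c t) l j * Z j t) = fun t => 2^-1 * F l t.
    by apply/funext => u; exact: gZ.
  have e1 := @derive_val _ _ _ _ _ _ _ d1; have e2 := @derive_val _ _ _ _ _ _ _ d2.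
  rewrite E e2 big_split/= in e1; rewrite e1.
  have -> : \sum_i \sum_j dmetric g i l j (c t) * v t 0 i * v t 0 j =
      \sum_j Z j t * (\sum_i v t 0 i * dmetric g i l j (c t)).
    rewrite exchange_big/=; apply: eq_bigr => j _; rewrite mulr_sumr.
    by apply: eq_bigr => i _; rewrite -vZ//; ring.
  by rewrite addrK.
have -> : 'D_1 (Z k) t = \sum_l invmx (g (c t)) k l * (\sum_j g (c t) l j * 'D_1 (Z j) t).
  under eq_bigr do rewrite mulr_sumr.
  rewrite exchange_big/= -[LHS](sum_delta (fun l => 'D_1 (Z l) t)); apply: eq_bigr => l _.
  under eq_bigr do rewrite mulrA.
  rewrite -mulr_suml mulrC; congr (_ * _).
  have /matrixP/(_ k l) := mulVmx (gu (c t)); rewrite !mxE => ->.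
  by rewrite eq_sym.
rewrite VtE (eq_bigr (fun l => invmx (g (c t)) k l * (2^-1 * force g c v l t -
   \sum_i \sum_j dmetric g i l j (c t) * v t 0 i * v t 0 j))); last by move=> l _; rewrite EL.
have -> : \sum_i \sum_j christoffel g k i j (c t) * v t 0 i * v t 0 j =
    \sum_l invmx (g (c t)) k l * (\sum_i \sum_j dmetric g i l j (c t) * v t 0 i * v t 0 j
      - 2^-1 * force g c v l t).
  transitivity (\sum_i \sum_j \sum_l invmx (g (c t)) k l * (2^-1 * (
      dmetric g i l j (c t) * v t 0 i * v t 0 j +
      dmetric g j l i (c t) * v t 0 j * v t 0 i -
      dmetric g l i j (c t) * v t 0 i * v t 0 j))).
    apply: eq_bigr => i _; apply: eq_bigr => j _.
    rewrite /christoffel -!mulrA mulr_suml mulr_sumr; apply: eq_bigr => l _.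
    rewrite -!/(dmetric _ _ _ _ _) (dsym i l j) (dsym j l i); ring.
  under eq_bigr do rewrite exchange_big/=.
  rewrite exchange_big/=; apply: eq_bigr => l _.
  transitivity (invmx (g (c t)) k l * (2^-1 * (
    \sum_i \sum_j dmetric g i l j (c t) * v t 0 i * v t 0 j +
    \sum_i \sum_j dmetric g j l i (c t) * v t 0 j * v t 0 i - force g c v l t))).
    rewrite /force -big_split/= -sumrB !mulr_sumr; apply: eq_bigr => i _.
    by rewrite -big_split/= -sumrB !mulr_sumr; apply: eq_bigr.
  (* The first two terms of the Christoffel symbol coincide after exchanging the summation indices,
     which cancels their factor 1/2. *)
  rewrite [X in _ + X - _]exchange_big/=.
  by field.
by rewrite -big_split/= big1// => l _; ring.
Qed.

End euler_lagrange.

Lemma minimizing_geodesic {R : realType} {d : nat} (g : 'rV[R]_d -> 'M[R]_d) (p q : 'rV[R]_d)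
    (w : R -> 'rV[R]_d) :
  (forall i j, C11 (fun x => g x i j)) -> riemannian g ->
  C1curves p q w -> minimizing g p q w -> geodesic g w.
Proof.
move=> g_C11 rg wpq wmin.
have gc i j : continuous (fun x => g x i j).
  by move=> x; apply: differentiable_continuous; have [] := g_C11 i j.
have [phi [c [v [s [[s0 sE] [dc cv] sp wc [C1phi phi0 phi1 phip]]]]]] := constant_speed rg gc wpq.
have [_ w0 w1 _] := wpq.
exists phi, c; split=> //; split; last exact: wc.
apply: (minimizing_geodesic_on g_C11 rg dc cv s0 sp) => sigma lip s0' s1'.
rewrite -sE; apply: wmin => //.
  by rewrite s0' -phi0 -wc ?lexx ?ler01// w0.
by rewrite s1' -phi1 -wc ?lexx ?ler01// w1.
Qed.

Unset Implicit Arguments.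
Set Strict Implicit.

Theorem theorem70 (R : realType) (d : nat)
    (rho : R -> R) (rho_cvg : rho e @[e --> 0^'+] --> 0^'+)
    (b : R -> R) (psi : R -> 'rV[R]_d -> R) (psi_moll : mollifier rho b psi)
    (iota : set 'rV[R]_d -> (('rV[R]_d -> R) -> R) ->
            gen rho 'rV[R]_d -> gen rho R)
    (iota_emb : embedding b psi iota)
    (g : 'rV[R]_d -> 'M[R]_d)
    (g_C11 : forall i j, C11 (fun x => g x i j))
    (g_riem : riemannian g)
    (g_complete : geodesically_complete g)
    (gt : 'I_d -> 'I_d -> gen rho 'rV[R]_d -> gen rho R)
    (ge : R -> 'rV[R]_d -> 'M[R]_d)
    (g_reg : regularization iota g gt ge)
    (p q : 'rV[R]_d)
    (gamma : gen rho R -> gen rho 'rV[R]_d) (gamma_pq : gcurves p q gamma)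
    (L : gen rho R) (L_gamma : glength ge gamma L)
    (L_min : gminimal ge p q L)
    (s : R) (L_st : is_st L s)
    (w : R -> 'rV[R]_d) (w_pq : C1curves p q w)
    (w_s : riem_length g w = s) :
  minimizing g p q w /\ geodesic g w.
Proof.
have gc i j : continuous (fun x => g x i j).
  by move=> x; apply: differentiable_continuous; have [] := g_C11 i j.
have [ge_def _ _ ge_cvg _] := g_reg.
have gec e : I0 e -> forall i j, continuous (fun x => ge e x i j).
  move=> e01 i j x; apply: differentiable_continuous.
  (* The empty list of partial derivatives gives differentiability of the coefficient itself. *)
  by have [/(_ e e01)[_ sm] _ _] := ge_def i j; exact: (sm [::] x I).
rewrite -w_s in L_st.
have wmin : minimizing g p q w := minimal_minimizing rho_cvg g_riem gc gec ge_cvg L_min L_st w_pq.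
by split=> //; exact: minimizing_geodesic g_C11 g_riem w_pq wmin.
Qed.
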